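(* Let $0<\mu\le1$. The functions $R_{\mathbf{k}}^{(\mu)}$, with $\mathbf{k}$ ranging over the finitely supported multi-indices in $\mathbb{N}_0^{\mathbb{N}}$, form an orthonormal basis of $L^2(\mathbb{P}_\mu)$. For $F\in L^2(\mathbb{P}_\mu)$, $$F=\sum_{\mathbf{k}}F_{\mathbf{k}}R_{\mathbf{k}}^{(\mu)}\ \text{ in }L^2(\mathbb{P}_\mu),\qquad F_{\mathbf{k}}=\langle F,R_{\mathbf{k}}^{(\mu)}\rangle_{L^2(\mathbb{P}_\mu)},\qquad \|F\|_{L^2(\mathbb{P}_\mu)}^2=\sum_{\mathbf{k}}|F_{\mathbf{k}}|^2 .$$ The operator $\mathbf{D}_\mu^0$ (from $L^2(\mathbb{P}_\mu)$ to $L^2(\mathbb{P}_\mu;\ell^2)$) is closable. Its closure $\mathbf{D}_\mu$ has domain $$\mathrm{Dom}(\mathbf{D}_\mu)=\Big\{F\in L^2(\mathbb{P}_\mu):\sum_{\mathbf{k}}\Lambda_{\mathbf{k}}(\mu)|F_{\mathbf{k}}|^2<\infty\Big\}.$$ The nonnegative self-adjoint operator $\mathbf{N}_\mu=\mathbf{D}_\mu^*\mathbf{D}_\mu$ has domain $$\mathrm{Dom}(\mathbf{N}_\mu)=\Big\{F\in L^2(\mathbb{P}_\mu):\sum_{\mathbf{k}}\Lambda_{\mathbf{k}}(\mu)^2|F_{\mathbf{k}}|^2<\infty\Big\}.$$ Moreover, $$\|\mathbf{D}_\mu F\|_{L^2(\mathbb{P}_\mu;\ell^2)}^2=\sum_{\mathbf{k}}\Lambda_{\mathbf{k}}(\mu)|F_{\mathbf{k}}|^2,\qquad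 F\in\mathrm{Dom}(\mathbf{D}_\mu),$$ and $$\mathbf{N}_\mu F=\sum_{\mathbf{k}}\Lambda_{\mathbf{k}}(\mu)F_{\mathbf{k}}R_{\mathbf{k}}^{(\mu)},\qquad F\in\mathrm{Dom}(\mathbf{N}_\mu).$$ In particular, $\mathbf{N}_\mu R_{\mathbf{k}}^{(\mu)}=\Lambda_{\mathbf{k}}(\mu)R_{\mathbf{k}}^{(\mu)}$.
   Context: $\gamma(\mathrm{d}x)=(2\pi)^{-1/2}e^{-x^2/2}\,\mathrm{d}x$ on $\mathbb{R}$; $W^{1,2}(\gamma)$ is the space of locally absolutely continuous $f$ with $f,f'\in L^2(\gamma)$; $\mathbb{N}=\{1,2,\dots\}$, $\mathbb{N}_0=\{0\}\cup\mathbb{N}$. For $0<\mu\le1$ let $c_\mu=\frac{1-\mu^2}{4\mu^2}$ and let $A_\mu$ be the nonnegative self-adjoint operator in $L^2(\gamma)$ associated with the closed form $$a_\mu[f,g]=\int_{-\infty}^\infty f'\overline{g'}\,\mathrm{d}\gamma+c_\mu\int_{-\infty}^0x^2f\overline g\,\mathrm{d}\gamma,\qquad \mathrm{Dom}(a_\mu)=W^{1,2}(\gamma);$$ it acts as $A_\mu f=-f''+xf'+c_\mu x^2\mathbf{1}_{\{x<0\}}f$. It has compact resolvent, simple eigenvalues $0\le\alpha_0(\mu)<\alpha_1(\mu)<\cdots\to\infty$, and a real-valued orthonormal basis $(e_k^{(\mu)})_{k\ge0}$ of $L^2(\gamma)$ of continuously differentiable eigenfunctions, $A_\mu e_k^{(\mu)}=\alpha_k(\mu)e_k^{(\mu)}$,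 with $e_0^{(\mu)}>0$ everywhere. Set $\nu_\mu(\mathrm{d}x)=(e_0^{(\mu)}(x))^2\gamma(\mathrm{d}x)$ (a probability measure on $\mathbb{R}$), $r_k^{(\mu)}=e_k^{(\mu)}/e_0^{(\mu)}$ (so $r_0^{(\mu)}=1$), and $\lambda_k(\mu)=\alpha_k(\mu)-\alpha_0(\mu)$ (so $\lambda_0(\mu)=0$). Equip $\mathbb{R}^{\mathbb{N}}$ with its product Borel $\sigma$-algebra and $\mathbb{P}_\mu=\nu_\mu^{\otimes\mathbb{N}}$; $X_j(x)=x_j$ are the coordinate maps. For a multi-index $\mathbf{k}=(k_j)_{j\ge1}$ with $k_j\in\mathbb{N}_0$ and only finitely many nonzero entries, $$R_{\mathbf{k}}^{(\mu)}=\prod_{j\ge1}r_{k_j}^{(\mu)}(X_j),\qquad \Lambda_{\mathbf{k}}(\mu)=\sum_{j\ge1}\lambda_{k_j}(\mu).$$ On the finite linear span of the $R_{\mathbf{k}}^{(\mu)}$, the coordinate gradient $\mathbf{D}_\mu^0$ is the linear operator with $$(\mathbf{D}_\mu^0R_{\mathbf{k}}^{(\mu)})_j=(r_{k_j}^{(\mu)})'(X_j)\prod_{i\ne j}r_{k_i}^{(\mu)}(X_i),\qquad j\ge1,$$ taking values in $L^2(\mathbb{P}_\mu;\ell^2)$ with norm $\|V\|^2=\int\sum_{j\ge1}|V_j|^2\,\mathrm{d}\mathbb{P}_\mu$. All sums over $\mathbf{k}$ run over finitely supported multi-indices. *)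

(* Defs.v *)
From HB Require Import structures.
From mathcomp Require Import all_boot all_order all_algebra finmap.
From mathcomp Require Import complex.
From mathcomp Require Import all_classical all_reals all_analysis.

Set Implicit Arguments.
Unset Strict Implicit.
Unset Printing Implicit Defensive.

Import Order.TTheory GRing.Theory Num.Theory.
Import numFieldNormedType.Exports.

Local Open Scope classical_set_scope.
Local Open Scope ring_scope.

Definition Ccst (R : realType) (a : R) : R[i]^o := Complex a 0.

Definition Cabs2 (R : realType) (z : R[i]) : R :=
  (complex.Re z) ^+ 2 + (complex.Im z) ^+ 2.

Definition Cmeasurable (R : realType) (d : measure_display)
    (T : measurableType d) (f : T -> R[i]) : Prop :=
  measurable_fun setT (fun x => complex.Re (f x)) /\
  measurable_fun setT (fun x => complex.Im (f x)).

Definition Cintegral (R : realType) (d : measure_display)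
    (T : measurableType d) (m : {measure set T -> \bar R}) (D : set T)
    (f : T -> R[i]) : R[i] :=
  Complex (\int[m]_(x in D) complex.Re (f x)) (\int[m]_(x in D) complex.Im (f x)).

Definition Cseries (R : realType) (u : nat -> R[i]) : R[i] :=
  Complex (limn (series (fun n => complex.Re (u n))))
          (limn (series (fun n => complex.Im (u n)))).

Definition Cderive (R : realType) (f : R -> R[i]) (x : R) : R[i] :=
  Complex (derive1 (fun t => complex.Re (f t)) x)
          (derive1 (fun t => complex.Im (f t)) x).

(* Complex Hilbert spaces of L^2 type. An element is a function, not a class:
   the space itself is [L2mem], and two members represent the same vector when
   [L2eq] holds. [L2nsq] is the squared norm, and [L2dot] is conjugate-linear in
   its second argument. For the two instances [L2] and [L2l2], [L2eq] is
   equality almost everywhere. *)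

Record L2type (R : realType) := MkL2type {
  L2fun : lmodType R[i];
  L2meas : L2fun -> Prop;
  L2nsq : L2fun -> \bar R;
  L2dot : L2fun -> L2fun -> R[i]
}.

Definition L2mem (R : realType) (H : L2type R) (x : L2fun H) : Prop :=
  L2meas x /\ (L2nsq x < +oo)%E.

Definition L2eq (R : realType) (H : L2type R) (x y : L2fun H) : Prop :=
  L2nsq (x - y) = 0%E.

Definition L2cvg (R : realType) (H : L2type R) (u : nat -> L2fun H)
    (x : L2fun H) : Prop :=
  L2nsq (u n - x) @[n --> \oo] --> 0%E.

(* [x] is the unconditional sum of the family [u]. *)
Definition L2sum (R : realType) (H : L2type R) (I : choiceType)
    (u : I -> L2fun H) (x : L2fun H) : Prop :=
  forall eps : R, 0 < eps -> exists S0 : {fset I}, forall S : {fset I},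
    (S0 `<=` S)%fset -> (L2nsq (x - \sum_(i <- S) u i) < eps%:E)%E.

Definition orthonormal_basis (R : realType) (H : L2type R) (I : choiceType)
    (b : I -> L2fun H) : Prop :=
  [/\ forall i, L2mem (b i),
      forall i j, L2dot (b i) (b j) = (i == j)%:R
    & forall x, L2mem x -> forall eps : R, 0 < eps ->
        exists (S : {fset I}) (c : I -> R[i]),
          (L2nsq (x - \sum_(i <- S) c i *: b i) < eps%:E)%E].

Definition L2 (R : realType) (d : measure_display) (T : measurableType d)
    (m : {measure set T -> \bar R}) : L2type R :=
  @MkL2type R (T -> R[i]^o)
    (fun f => Cmeasurable f)
    (fun f => (\int[m]_x (Cabs2 (f x))%:E)%E)
    (fun f g => Cintegral m setT (fun x => f x * (g x)^*)).

(* L^2(m; l^2); its inner product is that of the Hilbert sum of countably many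
   copies of L^2(m), which induces the norm below by Tonelli's theorem. *)
Definition L2l2 (R : realType) (d : measure_display) (T : measurableType d)
    (m : {measure set T -> \bar R}) : L2type R :=
  @MkL2type R (T -> nat -> R[i]^o)
    (fun V => forall j, Cmeasurable (fun x => V x j))
    (fun V => (\int[m]_x \sum_(0 <= j <oo) (Cabs2 (V x j))%:E)%E)
    (fun V W => Cseries (fun j =>
       L2dot (l := L2 m) (fun x => V x j) (fun x => W x j))).

(* Unbounded operators, given by their graphs: [A x y] reads
   "x is in Dom A and A x = y". *)

Definition linear_operator (R : realType) (H K : L2type R)
    (A : L2fun H -> L2fun K -> Prop) : Prop :=
  [/\ forall x y, A x y -> L2mem x /\ L2mem y,
      forall x x' y y', A x y -> A x' y' -> L2eq x x' -> L2eq y y'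
    & forall (a : R[i]) x x' y y', A x y -> A x' y' ->
        A (a *: x + x') (a *: y + y')].

Definition closable (R : realType) (H K : L2type R)
    (A : L2fun H -> L2fun K -> Prop) : Prop :=
  forall (u : nat -> L2fun H) (v : nat -> L2fun K) (y : L2fun K),
    (forall n, A (u n) (v n)) -> L2mem y ->
    L2cvg u 0 -> L2cvg v y -> L2eq y 0.

Definition op_closure (R : realType) (H K : L2type R)
    (A : L2fun H -> L2fun K -> Prop) (x : L2fun H) (y : L2fun K) : Prop :=
  [/\ L2mem x, L2mem y &
    exists (u : nat -> L2fun H) (v : nat -> L2fun K),
      [/\ forall n, A (u n) (v n), L2cvg u x & L2cvg v y]].

Definition densely_defined (R : realType) (H K : L2type R)
    (A : L2fun H -> L2fun K -> Prop) : Prop :=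
  forall x, L2mem x -> forall eps : R, 0 < eps ->
    exists x' y', A x' y' /\ (L2nsq (x - x') < eps%:E)%E.

Definition op_adjoint (R : realType) (H K : L2type R)
    (A : L2fun H -> L2fun K -> Prop) (y : L2fun K) (x : L2fun H) : Prop :=
  [/\ L2mem y, L2mem x & forall u v, A u v -> L2dot v y = L2dot u x].

Definition op_comp (R : realType) (H K L : L2type R)
    (B : L2fun K -> L2fun L -> Prop) (A : L2fun H -> L2fun K -> Prop)
    (x : L2fun H) (z : L2fun L) : Prop :=
  exists y, A x y /\ B y z.

Definition self_adjoint (R : realType) (H : L2type R)
    (A : L2fun H -> L2fun H -> Prop) : Prop :=
  densely_defined A /\ forall x y, A x y <-> op_adjoint A x y.

Definition nonnegative (R : realType) (H : L2type R)
    (A : L2fun H -> L2fun H -> Prop) : Prop :=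
  forall x y, A x y -> 0 <= L2dot y x.

Definition gauss (R : realType) : probability (measurableTypeR R) R :=
  normal_prob (0 : R) 1.

Definition abs_continuous (R : realType) (a b : R) (f : R -> R) : Prop :=
  forall eps : R, 0 < eps -> exists2 delta : R, 0 < delta &
    forall (n : nat) (s t : 'I_n -> R),
      (forall i, [/\ a <= s i, s i <= t i & t i <= b]) ->
      (forall i j, i != j -> t i <= s j \/ t j <= s i) ->
      \sum_i (t i - s i) < delta ->
      \sum_i `|f (t i) - f (s i)| < eps.

Definition loc_abs_continuous (R : realType) (f : R -> R) : Prop :=
  forall a b : R, a < b -> abs_continuous a b f.

(* W^{1,2}(gauss). The total function [Cderive f] is the derivative at almost
   every point when f is locally absolutely continuous. *)
Definition W12 (R : realType) (f : R -> R[i]) : Prop :=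
  [/\ loc_abs_continuous (fun x => complex.Re (f x)),
      loc_abs_continuous (fun x => complex.Im (f x)),
      L2mem (H := L2 (gauss R)) f & L2mem (H := L2 (gauss R)) (Cderive f)].

Definition cmu (R : realType) (mu : R) : R := (1 - mu ^+ 2) / (4 * mu ^+ 2).

Definition amu (R : realType) (mu : R) (f g : R -> R[i]) : R[i] :=
  Cintegral (gauss R) setT (fun x => Cderive f x * (Cderive g x)^*) +
  Ccst (cmu mu) *
  Cintegral (gauss R) `]-oo, 0] (fun x => Ccst (x ^+ 2) * f x * (g x)^*).

(* Amu mu f h reads "f is in Dom A_mu and A_mu f = h", for the operator A_mu
   associated with the form a_mu. *)
Definition Amu (R : realType) (mu : R) (f h : R -> R[i]^o) : Prop :=
  [/\ W12 f, L2mem (H := L2 (gauss R)) h &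
    forall g : R -> R[i]^o, W12 g ->
      amu mu f g = L2dot (l := L2 (gauss R)) h g].

Definition real_fun (R : realType) (T : Type) (f : T -> R) : T -> R[i]^o :=
  fun x => Ccst (f x).

Record eigensystem (R : realType) (mu : R) (alpha : nat -> R)
    (e : nat -> R -> R) : Prop := MkEigensystem {
  eigen_ge0 : 0 <= alpha 0%N;
  eigen_lt : forall k, alpha k < alpha k.+1;
  eigen_cvg : alpha n @[n --> \oo] --> +oo;
  eigen_derivable : forall k x, derivable (e k) x 1;
  eigen_C1 : forall k, continuous (derive1 (e k));
  eigen_basis :
    orthonormal_basis (H := L2 (gauss R)) (fun k => real_fun (e k));
  eigen_eq : forall k,
    Amu mu (real_fun (e k)) (Ccst (alpha k) *: real_fun (e k));
  eigen_gt0 : forall x, 0 < e 0%N x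
}.

Definition ground_law (R : realType) (e : nat -> R -> R)
    (A : set (measurableTypeR R)) : \bar R :=
  (\int[gauss R]_(x in A) ((e 0%N x) ^+ 2)%:E)%E.

(* R^N with its product sigma-algebra; coordinates are indexed from 0. *)

Definition coord_sets (R : realType) : set (set (nat -> R)) :=
  [set B | exists (j : nat) (A : set (measurableTypeR R)),
     measurable A /\ B = [set x | A (x j)]].

Definition RN (R : realType) := g_sigma_algebraType (@coord_sets R).

Definition coordRN (R : realType) (j : nat) (x : RN R) : R := (x : nat -> R) j.

(* P is the infinite product of copies of nu: its values on the measurable
   cylinders determine it. *)
Definition is_product_law (R : realType)
    (nu : set (measurableTypeR R) -> \bar R) (P : probability (RN R) R) : Prop :=
  forall (n : nat) (A : nat -> set (measurableTypeR R)),
    (forall j, measurable (A j)) ->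
    P [set x | forall j, (j < n)%N -> A j (coordRN j x)] =
    (\big[*%E/1%E]_(j < n) nu (A j))%E.

(* Multi-indices. As k j = 0 off [finsupp k], r_0 = 1 and lambda_0 = 0,
   products and sums over all j >= 1 reduce to [finsupp k]. *)

Definition multi_index : choiceType := {fsfun nat -> nat with 0%N}.

Definition rfun (R : realType) (e : nat -> R -> R) (k : nat) (x : R) : R :=
  e k x / e 0%N x.

Definition lam (R : realType) (alpha : nat -> R) (k : nat) : R :=
  alpha k - alpha 0%N.

Definition Rk (R : realType) (e : nat -> R -> R) (k : multi_index) :
    RN R -> R[i]^o :=
  fun x => Ccst (\prod_(j <- finsupp k) rfun e (k j) (coordRN j x)).

Definition Lam (R : realType) (alpha : nat -> R) (k : multi_index) : R :=
  \sum_(j <- finsupp k) lam alpha (k j).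

Definition gradRk (R : realType) (e : nat -> R -> R) (k : multi_index) :
    RN R -> nat -> R[i]^o :=
  fun x j => Ccst (derive1 (rfun e (k j)) (coordRN j x) *
    \prod_(i <- finsupp k | i != j) rfun e (k i) (coordRN i x)).

Definition D0 (R : realType) (e : nat -> R -> R)
    (F : RN R -> R[i]^o) (V : RN R -> nat -> R[i]^o) : Prop :=
  exists (S : {fset multi_index}) (c : multi_index -> R[i]),
    F = \sum_(k <- S) c k *: Rk e k /\ V = \sum_(k <- S) c k *: gradRk e k.

Definition Dmu (R : realType) (e : nat -> R -> R) (P : probability (RN R) R) :
    L2fun (L2 P) -> L2fun (L2l2 P) -> Prop :=
  op_closure (H := L2 P) (K := L2l2 P) (D0 e).

Definition Nmu (R : realType) (e : nat -> R -> R) (P : probability (RN R) R) :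
    L2fun (L2 P) -> L2fun (L2 P) -> Prop :=
  op_comp (op_adjoint (@Dmu R e P)) (@Dmu R e P).

Definition coef (R : realType) (e : nat -> R -> R) (P : probability (RN R) R)
    (F : L2fun (L2 P)) (k : multi_index) : R[i] :=
  L2dot (l := L2 P) F (Rk e k).

(* Main.v *)
Require Import Defs.
From HB Require Import structures.
From mathcomp Require Import all_boot all_order all_algebra finmap.
From mathcomp Require Import complex.
From mathcomp Require Import all_classical all_reals all_analysis.
From mathcomp Require Import measurable_realfun.
From mathcomp Require Import ring lra.
Import Order.TTheory GRing.Theory Num.Theory.
Import numFieldNormedType.Exports.
Local Open Scope classical_set_scope.
Local Open Scope ring_scope.

Set Implicit Arguments.
Unset Strict Implicit.
Unset Printing Implicit Defensive.

(* The functions r_k = e_k / e_0 are orthonormal and complete in L^2(nu), and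
   testing the eigenvalue equations of e_k against g e_0 and of e_0 against g e_k
   gives the weak equation
     int g' r_k' dnu = lambda_k int g r_k dnu
   for compactly supported C^1 functions g, since the potential terms cancel.
   Cutoffs turn it into int r_k' r_l' dnu = lambda_k delta_kl. By independence of
   the coordinates the R_k are then orthonormal, and their gradients are
   orthogonal with squared norms Lambda_k. Everything else is Hilbert space
   theory: for an orthonormal basis (b_k) and an orthogonal system (w_k) with
   |w_k|^2 = Lambda_k, the map b_k |-> w_k is closable, F is in the domain of its
   closure D iff sum Lambda_k |F_k|^2 is finite, and D^* D F = G iff
   G_k = Lambda_k F_k for all k. *)

(** * Hilbert spaces and orthogonal systems *)

(** Nothing controls the growth of r_k = e_k / e_0 or of its derivative beforehand. The weak
    equation is therefore tested with compactly supported functions only, for which g e_0 and g e_k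
    lie in W^{1,2} and all integrals are finite. A Caccioppoli estimate, uniform in the cutoff, then
    gives r_k' in L^2(nu), and this integrability lets dominated convergence remove the cutoff. The
    zero multi-index has Lambda = 0 and a null gradient, so the gradients cannot be normalised:
    orthogonal systems carry weights L_i >= 0 that may vanish. Closability, domain and norm of the
    closure rest on the identity <V, w_k> = L_k <F, b_k>, which survives limits, and on V staying in
    the closed span of the w_k. Producing V or G from coefficients needs Riesz-Fischer, hence
    completeness of both function spaces. For completeness of the R_k, indicators of
    finite-dimensional boxes are products of functions of one coordinate; these are approximated one
    factor at a time, and a pi-lambda argument reaches all measurable sets. *)

Section ComplexNumbers.
Variable R : realType.
Implicit Types (x y z : R[i]) (a b : R).

Lemma Cext x y : complex.Re x = complex.Re y -> complex.Im x = complex.Im y ->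
  x = y.
Proof. by case: x => a b; case: y => c d /= -> ->. Qed.

Lemma Re_add x y : complex.Re (x + y) = complex.Re x + complex.Re y.
Proof. by case: x; case: y. Qed.
Lemma Im_add x y : complex.Im (x + y) = complex.Im x + complex.Im y.
Proof. by case: x; case: y. Qed.
Lemma Re_opp x : complex.Re (- x) = - complex.Re x.
Proof. by case: x. Qed.
Lemma Im_opp x : complex.Im (- x) = - complex.Im x.
Proof. by case: x. Qed.
Lemma Re_mul x y :
  complex.Re (x * y) = complex.Re x * complex.Re y - complex.Im x * complex.Im y.
Proof. by case: x; case: y. Qed.
Lemma Im_mul x y :
  complex.Im (x * y) = complex.Re x * complex.Im y + complex.Im x * complex.Re y.
Proof. by case: x; case: y. Qed.
Lemma Re_conj x : complex.Re (x^*) = complex.Re x.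
Proof. by case: x. Qed.
Lemma Im_conj x : complex.Im (x^*) = - complex.Im x.
Proof. by case: x. Qed.
Lemma Re_Ccst a : complex.Re (Ccst a) = a. Proof. by []. Qed.
Lemma Im_Ccst a : complex.Im (Ccst a) = 0. Proof. by []. Qed.
Lemma Re_C0 : complex.Re (0 : R[i]) = 0. Proof. by []. Qed.
Lemma Im_C0 : complex.Im (0 : R[i]) = 0. Proof. by []. Qed.
Lemma Re_C1 : complex.Re (1 : R[i]) = 1. Proof. by []. Qed.
Lemma Im_C1 : complex.Im (1 : R[i]) = 0. Proof. by []. Qed.

Lemma Re_mk a b : complex.Re (Complex a b) = a. Proof. by []. Qed.
Lemma Im_mk a b : complex.Im (Complex a b) = b. Proof. by []. Qed.

(** Used after [Cext] to reduce a complex identity to two real ones that [ring] can close. *)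
Definition CE := (Re_mk, Im_mk, Re_add, Im_add, Re_opp, Im_opp, Re_mul, Im_mul,
  Re_conj, Im_conj, (Re_Ccst, Im_Ccst), (Re_C0, Im_C0, Re_C1, Im_C1)).

Lemma Re_sum (I : Type) (s : seq I) (F : I -> R[i]) :
  complex.Re (\sum_(i <- s) F i) = \sum_(i <- s) complex.Re (F i).
Proof.
by elim: s => [|i s IH]; rewrite ?big_nil// !big_cons Re_add IH.
Qed.

Lemma CcstM a b : Ccst (a * b) = Ccst a * Ccst b.
Proof. by apply: Cext; rewrite !CE; ring. Qed.
Lemma CcstD a b : Ccst (a + b) = Ccst a + Ccst b.
Proof. by apply: Cext; rewrite !CE; ring. Qed.
Lemma CcstB a b : Ccst (a - b) = Ccst a - Ccst b.
Proof. by apply: Cext; rewrite !CE; ring. Qed.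
Lemma Ccst_conj a : (Ccst a)^* = Ccst a.
Proof. by apply: Cext; rewrite !CE; ring. Qed.
Lemma Ccst_sum (I : Type) (s : seq I) (F : I -> R) :
  Ccst (\sum_(i <- s) F i) = \sum_(i <- s) Ccst (F i).
Proof. by elim: s => [|i s IH]; rewrite ?big_nil// !big_cons CcstD IH. Qed.

Lemma Cabs2_ge0 z : 0 <= Cabs2 z.
Proof. by rewrite /Cabs2 addr_ge0// sqr_ge0. Qed.
Lemma Cabs20 : Cabs2 (0 : R[i]) = 0.
Proof. by rewrite /Cabs2 !CE; ring. Qed.
Lemma Cabs2M x y : Cabs2 (x * y) = Cabs2 x * Cabs2 y.
Proof. by rewrite /Cabs2 !CE; ring. Qed.
Lemma Cabs2N x : Cabs2 (- x) = Cabs2 x.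
Proof. by rewrite /Cabs2 !CE; ring. Qed.
Lemma Cabs2C a : Cabs2 (Ccst a) = a ^+ 2.
Proof. by rewrite /Cabs2 !CE; ring. Qed.
Lemma Cabs2_eq0 z : Cabs2 z <= 0 -> z = 0.
Proof.
rewrite /Cabs2 => h.
have h1 := sqr_ge0 (complex.Re z); have h2 := sqr_ge0 (complex.Im z).
apply: Cext; rewrite ?CE; apply/eqP; rewrite -sqrf_eq0; apply/eqP; lra.
Qed.
Lemma mulCJ z : z * z^* = Ccst (Cabs2 z).
Proof. by apply: Cext; rewrite /Cabs2 !CE; ring. Qed.
Lemma Cabs2D_le x y : Cabs2 (x + y) <= 2 * Cabs2 x + 2 * Cabs2 y.
Proof.
rewrite /Cabs2 !CE.
have := sqr_ge0 (complex.Re x - complex.Re y).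
have := sqr_ge0 (complex.Im x - complex.Im y).
nra.
Qed.
End ComplexNumbers.

(* The structure shared by [L2 m] and [L2l2 m]. Vectors are functions, so
   definiteness of the norm is not required. *)
Record hilbert (R : realType) (H : L2type R) : Prop := MkHilbert {
  hil0 : L2mem (0 : L2fun H);
  hil_lin : forall a (x y : L2fun H), L2mem x -> L2mem y -> L2mem (a *: x + y);
  hil_dotl : forall a (x y z : L2fun H), L2mem x -> L2mem y -> L2mem z ->
    L2dot (a *: x + y) z = a * L2dot x z + L2dot y z;
  hil_conj : forall x y : L2fun H, L2mem x -> L2mem y ->
    L2dot y x = (L2dot x y)^*;
  hil_nsq : forall x : L2fun H, L2mem x ->
    L2nsq x = (complex.Re (L2dot x x))%:E;
  hil_ge0 : forall x : L2fun H, (0 <= L2nsq x)%E;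
  hil_complete : forall u : nat -> L2fun H, (forall n, L2mem (u n)) ->
    (forall eps : R, 0 < eps -> exists N, forall m n, (N <= m)%N -> (N <= n)%N ->
       (L2nsq (u m - u n)%R < eps%:E)%E) ->
    exists2 x, L2mem x & forall eps : R, 0 < eps -> exists N, forall n,
      (N <= n)%N -> (L2nsq (u n - x)%R < eps%:E)%E
}.

Section HilbertTheory.
Variables (R : realType) (H : L2type R) (hH : hilbert H).
Local Notation mem := (@L2mem R H).
Local Notation dot := (@L2dot R H).
Implicit Types (x y z : L2fun H) (a b : R[i]).

Definition nq x : R := complex.Re (dot x x).

Lemma nsqE x : mem x -> L2nsq x = (nq x)%:E.
Proof. exact: hil_nsq. Qed.

Lemma nq_ge0 x : mem x -> 0 <= nq x.
Proof. by move=> mx; rewrite -lee_fin -nsqE// (hil_ge0 hH). Qed.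

Lemma memZ a x : mem x -> mem (a *: x).
Proof. by move=> mx; rewrite -[_ *: _]addr0; apply: (hil_lin hH) => //; exact: hil0. Qed.
Lemma memD x y : mem x -> mem y -> mem (x + y).
Proof. by move=> mx my; rewrite -[x]scale1r; exact: (hil_lin hH). Qed.
Lemma memN x : mem x -> mem (- x).
Proof. by move=> mx; rewrite -scaleN1r; exact: memZ. Qed.
Lemma memB x y : mem x -> mem y -> mem (x - y).
Proof. by move=> mx my; apply: memD => //; exact: memN. Qed.
Lemma mem_sum (I : Type) (s : seq I) (F : I -> L2fun H) :
  (forall i, mem (F i)) -> mem (\sum_(i <- s) F i).
Proof.
move=> mF; elim: s => [|i s IH]; first by rewrite big_nil; exact: hil0.
by rewrite big_cons; exact: memD.
Qed.

Lemma dotDl x y z : mem x -> mem y -> mem z -> dot (x + y) z = dot x z + dot y z.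
Proof. by move=> mx my mz; rewrite -[x in LHS]scale1r (hil_dotl hH)// mul1r. Qed.
Lemma dot0l z : mem z -> dot 0 z = 0.
Proof.
move=> mz; have := @dotDl 0 0 z (hil0 hH) (hil0 hH) mz.
by rewrite addr0 => /eqP; rewrite -subr_eq0 opprD addNKr oppr_eq0 => /eqP.
Qed.
Lemma dotZl a x z : mem x -> mem z -> dot (a *: x) z = a * dot x z.
Proof.
move=> mx mz; rewrite -[_ *: _]addr0 (hil_dotl hH) ?dot0l ?addr0//; exact: hil0.
Qed.
Lemma dotNl x z : mem x -> mem z -> dot (- x) z = - dot x z.
Proof. by move=> mx mz; rewrite -scaleN1r dotZl// mulN1r. Qed.
Lemma dotBl x y z : mem x -> mem y -> mem z -> dot (x - y) z = dot x z - dot y z.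
Proof. by move=> mx my mz; rewrite dotDl ?dotNl//; exact: memN. Qed.
Lemma dot_suml (I : Type) (s : seq I) (F : I -> L2fun H) z :
  (forall i, mem (F i)) -> mem z ->
  dot (\sum_(i <- s) F i) z = \sum_(i <- s) dot (F i) z.
Proof.
move=> mF mz; elim: s => [|i s IH]; first by rewrite !big_nil dot0l.
by rewrite !big_cons dotDl ?IH//; exact: mem_sum.
Qed.

Lemma dotDr x y z : mem x -> mem y -> mem z -> dot z (x + y) = dot z x + dot z y.
Proof.
move=> mx my mz; rewrite (hil_conj hH (memD mx my) mz) dotDl//.
by rewrite (hil_conj hH mz mx) (hil_conj hH mz my) rmorphD /= !conjCK.
Qed.
Lemma dotZr a x z : mem x -> mem z -> dot z (a *: x) = a^* * dot z x.
Proof.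
move=> mx mz; rewrite (hil_conj hH (memZ a mx) mz) dotZl//.
by rewrite (hil_conj hH mz mx) rmorphM /= conjCK.
Qed.
Lemma dotNr x z : mem x -> mem z -> dot z (- x) = - dot z x.
Proof. by move=> mx mz; rewrite -scaleN1r dotZr// rmorphN rmorph1 mulN1r. Qed.
Lemma dotBr x y z : mem x -> mem y -> mem z -> dot z (x - y) = dot z x - dot z y.
Proof. by move=> mx my mz; rewrite dotDr ?dotNr//; exact: memN. Qed.
Lemma dot_sumr (I : Type) (s : seq I) (F : I -> L2fun H) z :
  (forall i, mem (F i)) -> mem z ->
  dot z (\sum_(i <- s) F i) = \sum_(i <- s) dot z (F i).
Proof.
move=> mF mz; elim: s => [|i s IH].
  rewrite !big_nil (hil_conj hH (hil0 hH) mz) dot0l// rmorph0//.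
by rewrite !big_cons dotDr ?IH//; exact: mem_sum.
Qed.

Lemma dotxx x : mem x -> dot x x = Ccst (nq x).
Proof.
move=> mx; apply: Cext; rewrite ?CE//.
have /(congr1 (@complex.Im R)) := hil_conj hH mx mx; rewrite Im_conj; lra.
Qed.

Lemma nqB x y : mem x -> mem y ->
  nq (x - y) = nq x - 2 * complex.Re (dot x y) + nq y.
Proof.
move=> mx my; rewrite /nq dotBl ?dotBr//; last exact: memB.
by rewrite (hil_conj hH mx my) !CE; ring.
Qed.
Lemma nqN x : mem x -> nq (- x) = nq x.
Proof. by move=> mx; rewrite /nq dotNl ?dotNr// ?opprK//; exact: memN. Qed.
Lemma nqBC x y : mem x -> mem y -> nq (x - y) = nq (y - x).
Proof. by move=> mx my; rewrite -opprB nqN//; exact: memB. Qed.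
Lemma nqZ a x : mem x -> nq (a *: x) = Cabs2 a * nq x.
Proof.
move=> mx; rewrite /nq dotZl ?dotZr//; last exact: memZ.
by rewrite /Cabs2 !CE; ring.
Qed.
Lemma nqD_le x y : mem x -> mem y -> nq (x + y) <= 2 * nq x + 2 * nq y.
Proof.
move=> mx my; have := nq_ge0 (memB mx my); rewrite nqB// /nq dotDl ?dotDr//; last exact: memD.
rewrite (hil_conj hH mx my) !CE; lra.
Qed.
Lemma nqB3_le x y z : mem x -> mem y -> mem z ->
  nq (x - z) <= 2 * nq (x - y) + 2 * nq (y - z).
Proof.
move=> mx my mz; rewrite -(subrKA y); apply: nqD_le; exact: memB.
Qed.

(** Expanding the squared norm of [nq y x - <x, y> y] gives the inequality multiplied by [nq y],
    which settles [0 < nq y]. The norm need not be definite, so [nq y = 0] is a case of its own. *)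
Lemma cauchy_schwarz x y : mem x -> mem y -> Cabs2 (dot x y) <= nq x * nq y.
Proof.
move=> mx my.
have ex : nq (Ccst (nq y) *: x - dot x y *: y) =
    nq y * (nq y * nq x - Cabs2 (dot x y)).
  rewrite nqB ?nqZ; [|exact: mx|exact: my|exact: memZ|exact: memZ].
  rewrite dotZl ?dotZr//; last exact: memZ.
  by rewrite /Cabs2 !CE; ring.
have := nq_ge0 (memB (memZ (Ccst (nq y)) mx) (memZ (dot x y) my)).
rewrite ex => h; have := nq_ge0 my; rewrite le_eqVlt => /orP[/eqP ny0|ny].
  rewrite -ny0 mulr0.
  case: (ltP 0 (Cabs2 (dot x y))) => [c|//]; exfalso.
  (* When [nq y = 0], the squared norm of [x - t <x, y> y] is affine in [t] with slope
     [-2 |<x, y>|^2]; this [t] makes it negative. *)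
  pose t := nq x / Cabs2 (dot x y) + 1.
  have := nq_ge0 (memB mx (memZ (Ccst t * dot x y) my)).
  rewrite nqB ?nqZ -?ny0; [|exact: my|exact: mx|exact: memZ].
  have -> : dot x ((Ccst t * dot x y) *: y) = Ccst (t * Cabs2 (dot x y)).
    by rewrite dotZr// rmorphM /= Ccst_conj -mulrA (mulrC (_^*)) mulCJ CcstM.
  have -> : t * Cabs2 (dot x y) = nq x + Cabs2 (dot x y).
    by rewrite /t mulrDl divfK ?gt_eqF// mul1r.
  rewrite Re_Ccst mulr0 => h2.
  have := nq_ge0 mx; lra.
have : 0 <= nq y * nq x - Cabs2 (dot x y).
  by rewrite -(pmulr_rge0 _ ny).
by rewrite mulrC subr_ge0.
Qed.

Definition ncvg (u : nat -> L2fun H) x := forall eps : R, 0 < eps ->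
  exists N, forall n, (N <= n)%N -> nq (u n - x) < eps.

Lemma ncvgP u x : (forall n, mem (u n)) -> mem x -> L2cvg u x <-> ncvg u x.
Proof.
move=> mu mx; have mux n : mem (u n - x) by exact: memB.
rewrite /L2cvg; under eq_cvg do rewrite nsqE//; split.
  move=> /fine_cvgP[_] /cvgrPdist_lt h eps e0.
  have [N _ hN] := h _ e0; exists N => n Nn; have := hN n Nn.
  by rewrite /= sub0r normrN ger0_norm// nq_ge0.
move=> h; apply/fine_cvgP; split; first by near=> n.
apply/cvgrPdist_lt => eps e0; have [N hN] := h _ e0; exists N => // n /= Nn.
by rewrite sub0r normrN ger0_norm ?hN// nq_ge0.
Unshelve. all: by end_near. Qed.

Lemma Cabs2_squeeze0 (C : R) (z : R[i]) (u : nat -> R) : 0 <= C ->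
  (forall eps, 0 < eps -> exists N, forall n, (N <= n)%N -> u n < eps) ->
  (forall n, Cabs2 z <= C * u n) -> z = 0.
Proof.
move=> C0 hu hz; apply: Cabs2_eq0; rewrite leNgt; apply/negP => zp.
have e0 : 0 < Cabs2 z / (C + 1) by rewrite divr_gt0//; lra.
have [N /(_ N (leqnn N)) hN] := hu _ e0.
have := hz N; apply/negP; rewrite -ltNge.
rewrite ltr_pdivlMr in hN; last lra.
have [uN|uN] := leP 0 (u N); first by apply: le_lt_trans hN; nra.
by apply: le_lt_trans zp; nra.
Qed.

End HilbertTheory.

Section FiniteSums.
Variables (R : realType) (I : choiceType) (f : I -> R).
Hypothesis f0 : forall i, 0 <= f i.

Lemma esum_fset_ge (S : {fset I}) :
  ((\sum_(i <- S) f i)%:E <= \esum_(i in [set: I]) (f i)%:E)%E.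
Proof.
apply: esum_ge; exists [set` S]; first by split.
by rewrite fsbig_finite//= set_fsetK -sumEFin.
Qed.

Lemma esum_fset_le (M : \bar R) :
  (forall S : {fset I}, ((\sum_(i <- S) f i)%:E <= M)%E) ->
  (\esum_(i in [set: I]) (f i)%:E <= M)%E.
Proof.
move=> h; apply: ge_ereal_sup => _ [X [finX _] <-].
by rewrite fsbig_finite//= sumEFin.
Qed.

(** A finite set whose sum exceeds the total minus [eps] works, because the total bounds every
    finite sum. If there were none, the total would be at most itself minus [eps]. *)
Lemma esum_fset_gt (eps : R) : (\esum_(i in [set: I]) (f i)%:E < +oo)%E ->
  0 < eps -> exists S : {fset I}, forall T : {fset I}, (S `<=` T)%fset ->
  \sum_(i <- T) f i < \sum_(i <- S) f i + eps.
Proof.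
set M := esum _ _ => Mfin e0.
have M0 : (0 <= M)%E by apply: esum_ge0 => i _; rewrite lee_fin.
have Mn : M \is a fin_num by rewrite ge0_fin_numE.
apply: contrapT => /forallNP h.
suff : (M <= (fine M - eps)%:E)%E by rewrite -{1}(fineK Mn) lee_fin; lra.
apply: esum_fset_le => S; rewrite lee_fin leNgt; apply/negP => hS.
apply: (h S) => T ST.
have := esum_fset_ge T; rewrite -/M -(fineK Mn) lee_fin; lra.
Qed.

End FiniteSums.
Arguments esum_fset_ge {R I f}.
Arguments esum_fset_gt {R I f} f0 {eps}.
Arguments esum_fset_le {R I f}.

(** * Orthogonal systems with possibly vanishing weights: Bessel, Parseval, Riesz-Fischer *)

Section OrthogonalSystem.
Variables (R : realType) (H : L2type R) (hH : hilbert H).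
Variables (I : choiceType) (w : I -> L2fun H) (L : I -> R).
Hypothesis mw : forall i, L2mem (w i).
Hypothesis L0 : forall i, 0 <= L i.
Hypothesis ww : forall i j, L2dot (w i) (w j) = Ccst (L i) *+ (i == j).
Local Notation mem := (@L2mem R H).
Local Notation dot := (@L2dot R H).

Definition lin_comb (S : {fset I}) (c : I -> R[i]) : L2fun H :=
  \sum_(i <- S) c i *: w i.

Lemma lin_comb_mem S c : mem (lin_comb S c).
Proof. by apply: (mem_sum hH) => i; exact: memZ. Qed.

Lemma dot_lin_comb S c j :
  dot (lin_comb S c) (w j) = (c j * Ccst (L j)) *+ (j \in S).
Proof.
have mcw i : mem (c i *: w i) by exact: memZ.
rewrite dot_suml//; case: (boolP (j \in S)) => jS.
  rewrite (big_fsetD1 j jS)/= dotZl// ww eqxx mulr1n big_seq big1 ?addr0//.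
  move=> i; rewrite in_fsetD1 => /andP[ij _].
  by rewrite dotZl// ww (negbTE ij) mulr0.
rewrite big_seq big1// => i iS; rewrite dotZl// ww.
by case: eqP iS jS => [->|_] iS; rewrite ?iS// mulr0.
Qed.

Section Coefficients.
Variables (x : L2fun H) (a : I -> R[i]).
Hypothesis mx : mem x.
Hypothesis xw : forall i, dot x (w i) = Ccst (L i) * a i.

(** Complete the square in each [c i]: the choice [c = a] is optimal. Where [L i = 0] the number
    [a i] is arbitrary, and the weight in front of it makes that harmless. *)
Lemma pythagoras (S : {fset I}) c : nq (x - lin_comb S c) =
  nq x - \sum_(i <- S) L i * Cabs2 (a i) + \sum_(i <- S) L i * Cabs2 (c i - a i).
Proof.
have ms := lin_comb_mem S c.
have mcw i : mem (c i *: w i) by exact: memZ.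
rewrite nqB// {2}/nq {1 3}/lin_comb dot_sumr// dot_suml// !Re_sum.
have -> : \sum_(i <- S) complex.Re (dot (c i *: w i) (lin_comb S c)) =
    \sum_(i <- S) L i * Cabs2 (c i).
  apply: eq_big_seq => i iS; rewrite dotZl// (hil_conj hH ms (mw i)) dot_lin_comb iS.
  by rewrite mulr1n /Cabs2 !CE; ring.
rewrite -addrA -[RHS]addrA; congr (_ + _).
rewrite mulr_sumr -!sumrN -!big_split/=; apply: eq_bigr => i _.
by rewrite dotZr// xw /Cabs2 !CE; ring.
Qed.

Lemma bessel (S : {fset I}) : \sum_(i <- S) L i * Cabs2 (a i) <= nq x.
Proof.
have := nq_ge0 hH (memB hH mx (lin_comb_mem S a)).
rewrite pythagoras [X in _ + X]big1 ?addr0 ?subr_ge0// => i _.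
by rewrite subrr Cabs20 mulr0.
Qed.

Lemma nq_sub_partial (S : {fset I}) : nq (x - lin_comb S a) =
  nq x - \sum_(i <- S) L i * Cabs2 (a i).
Proof.
rewrite pythagoras [X in _ + X]big1 ?addr0// => i _.
by rewrite subrr Cabs20 mulr0.
Qed.

Hypothesis x_span : forall eps : R, 0 < eps ->
  exists S c, nq (x - lin_comb S c) < eps.

(** Replacing any approximating coefficients [c] by [a] only improves the approximation. *)
Lemma coef_sum_gt eps : 0 < eps ->
  exists S : {fset I}, nq x - eps < \sum_(i <- S) L i * Cabs2 (a i).
Proof.
move=> /x_span[S [c]]; rewrite pythagoras => h; exists S.
have : 0 <= \sum_(i <- S) L i * Cabs2 (c i - a i).
  by apply: sumr_ge0 => i _; rewrite mulr_ge0// Cabs2_ge0.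
lra.
Qed.

Lemma La_ge0 i : 0 <= L i * Cabs2 (a i).
Proof. by rewrite mulr_ge0// Cabs2_ge0. Qed.

Lemma parseval : L2nsq x = \esum_(i in [set: I]) (L i * Cabs2 (a i))%:E.
Proof.
rewrite (nsqE hH)//; apply/eqP; rewrite eq_le; apply/andP; split.
  apply/lee_addgt0Pr => eps /coef_sum_gt[S hS].
  apply: (@le_trans _ _ ((\sum_(i <- S) L i * Cabs2 (a i))%:E + eps%:E)%E).
    rewrite -EFinD lee_fin; lra.
  apply: leeD => //; exact: (esum_fset_ge (f := fun i => L i * Cabs2 (a i))).

by apply: esum_fset_le => S; rewrite lee_fin bessel.
Qed.

Lemma expansion : L2sum (fun i => a i *: w i) x.
Proof.
move=> eps e0.
have fin : (\esum_(i in [set: I]) (L i * Cabs2 (a i))%:E < +oo)%E.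
  by rewrite -parseval (nsqE hH)// ltry.
have [S1 h1] : exists S : {fset I}, nq x - eps / 2 < \sum_(i <- S) L i * Cabs2 (a i).
  by apply: coef_sum_gt; rewrite divr_gt0.
exists S1 => S SS; rewrite -/(lin_comb S a) (nsqE hH); last exact/(memB hH mx)/lin_comb_mem.
rewrite lte_fin nq_sub_partial.
suff : \sum_(i <- S1) L i * Cabs2 (a i) <= \sum_(i <- S) L i * Cabs2 (a i) by lra.
rewrite [leRHS](big_fsetID _ (fun i => i \in S1))/=.
rewrite (_ : [fset i in S | i \in S1]%fset = S1).
  by rewrite lerDl sumr_ge0// => i _; exact: La_ge0.
by apply/fsetP => i; rewrite !inE; apply/andb_idl => /(fsubsetP SS).
Qed.

End Coefficients.

(** Every partial sum over a set containing [i] already has the right inner product with [w i], and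
    Cauchy-Schwarz bounds the remaining error. *)
Lemma sum_coef (x : L2fun H) (a : I -> R[i]) i : mem x ->
  L2sum (fun j => a j *: w j) x -> dot x (w i) = a i * Ccst (L i).
Proof.
move=> mx sx; apply/eqP; rewrite -subr_eq0; apply/eqP.
apply: Cabs2_eq0; rewrite leNgt; apply/negP => zp.
(* The tolerance at which Cauchy-Schwarz against [w i] contradicts [zp]; the [+ 1] covers a null
   [w i]. *)
have e0 : 0 < Cabs2 (dot x (w i) - a i * Ccst (L i)) / (nq (w i) + 1).
  rewrite divr_gt0//; have := nq_ge0 hH (mw i); lra.
have [S0 /(_ (S0 `|` [fset i])%fset)] := sx _ e0.
rewrite fsubsetUl => /(_ isT); set S := (_ `|` _)%fset.
have mS := lin_comb_mem S a; rewrite -/(lin_comb S a) (nsqE hH) ?lte_fin; last exact: memB.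
rewrite ltr_pdivlMr; last by have := nq_ge0 hH (mw i); lra.
have := cauchy_schwarz hH (memB hH mx mS) (mw i).
rewrite dotBl// dot_lin_comb (_ : i \in S) ?inE ?eqxx ?orbT// mulr1n.
have := nq_ge0 hH (memB hH mx mS); nra.
Qed.

(** The finite sets [S n] leave a tail of squared norm below [q n], so the partial sums over them
    are Cauchy; their limit is then the unconditional sum. *)
Lemma riesz_fischer (a : I -> R[i]) :
  (\esum_(i in [set: I]) (L i * Cabs2 (a i))%:E < +oo)%E ->
  exists2 x, mem x & L2sum (fun i => a i *: w i) x.
Proof.
move=> fin; have La0 := La_ge0 a.
have [q q0 small] : exists2 q : nat -> R, forall n, 0 < q n &
    forall eps, 0 < eps -> exists N, forall n, (N <= n)%N -> q n < eps.
  exists (fun n => n.+1%:R^-1) => [n|eps e0]; first by rewrite invr_gt0.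
  have [N _ hN] := near_infty_natSinv_lt (PosNum e0).
  by exists N => n Nn; exact: hN.
have /choice[S hS] : forall n : nat, exists S : {fset I}, forall T : {fset I},
    (S `<=` T)%fset -> nq (lin_comb T a - lin_comb S a) < q n.
  move=> n; have [S hS] := esum_fset_gt La0 fin (q0 n).
  exists S => T ST.
  (* The partial sum over [T] is itself a vector, with coefficients [b]; [nq_sub_partial] applied to
     it measures its distance to the sum over [S]. *)
  pose b i := if i \in T then a i else 0.
  have Tb i : dot (lin_comb T a) (w i) = Ccst (L i) * b i.
    by rewrite dot_lin_comb /b; case: ifP; rewrite ?mulr1n ?mulr0n ?mulr0// mulrC.
  have Sb : lin_comb S a = lin_comb S b.
    by apply: eq_big_seq => i iS; rewrite /b (fsubsetP ST).
  have Tab : lin_comb T a = lin_comb T b.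
    by apply: eq_big_seq => i iT; rewrite /b iT.
  rewrite Sb (nq_sub_partial (lin_comb_mem _ _) Tb).
  have := nq_sub_partial (lin_comb_mem T a) Tb T; rewrite -Tab subrr.
  rewrite {1}/nq dot0l//= ?CE; last exact: hil0.
  have bS : \sum_(i <- S) L i * Cabs2 (b i) = \sum_(i <- S) L i * Cabs2 (a i).
    by apply: eq_big_seq => i iS; rewrite /b (fsubsetP ST).
  have bT : \sum_(i <- T) L i * Cabs2 (b i) = \sum_(i <- T) L i * Cabs2 (a i).
    by apply: eq_big_seq => i iT; rewrite /b iT.
  by rewrite bS bT => /esym/subr0_eq ->; rewrite ltrBlDl; exact: hS.
have msl n := lin_comb_mem (S n) a.
have [|x mx hx] := hil_complete hH (u := fun n => lin_comb (S n) a) msl.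
  move=> eps e0; have [|N hN] := small (eps / 4); first by rewrite divr_gt0.
  (* The two partial sums are compared through the one over the union; each leg costs twice
     [eps / 4]. *)
  exists N => m n Nm Nn; have mT := lin_comb_mem (S m `|` S n)%fset a.
  rewrite (nsqE hH) ?lte_fin; last exact: memB.
  apply: (le_lt_trans (nqB3_le hH (msl m) mT (msl n))).
  rewrite (nqBC hH (msl m) mT).
  have := hS m _ (fsubsetUl (S m) (S n)); have := hS n _ (fsubsetUr (S m) (S n)).
  have := hN m Nm; have := hN n Nn; lra.
exists x => // eps e0.
have [|N1 hN1] := small (eps / 4); first by rewrite divr_gt0.
have [|N2 hN2] := hx (eps / 4); first by rewrite divr_gt0.
pose N := maxn N1 N2; exists (S N) => T ST.
have mT := lin_comb_mem T a.
rewrite -/(lin_comb T a) (nsqE hH) ?lte_fin; last exact: memB.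
apply: (le_lt_trans (nqB3_le hH mx (msl N) mT)).
have := hN1 N (leq_maxl _ _); have := hN2 N (leq_maxr _ _).
rewrite (nsqE hH) ?lte_fin; last exact: memB.
rewrite (nqBC hH mx (msl N)) (nqBC hH (msl N) mT).
have := hS N T ST; lra.
Qed.

End OrthogonalSystem.

(** By Cauchy-Schwarz the defect of the limit identity is at most a constant times the squared
    errors of [u n] and [v n]. This is the tool that extends identities from an operator to its
    closure. *)
Lemma dot_cvg_eq (R : realType) (H K : L2type R) (hH : hilbert H) (hK : hilbert K)
    (u : nat -> L2fun H) (v : nat -> L2fun K) x y x' y' (c : R[i]) :
  (forall n, L2mem (u n)) -> (forall n, L2mem (v n)) ->
  L2mem x -> L2mem y -> L2mem x' -> L2mem y' ->
  L2cvg u x -> L2cvg v y ->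
  (forall n, L2dot (v n) y' = c * L2dot (u n) x') ->
  L2dot y y' = c * L2dot x x'.
Proof.
move=> mu mv mx my mx' my' /(ncvgP hH mu mx) ux /(ncvgP hK mv my) vy uv.
apply/eqP; rewrite -subr_eq0; apply/eqP.
pose C := 2 * nq y' + 2 * (Cabs2 c * nq x').
have c0 := Cabs2_ge0 c; have x'0 := nq_ge0 hH mx'; have y'0 := nq_ge0 hK my'.
have C0 : 0 <= C by rewrite addr_ge0 ?mulr_ge0.
apply: (Cabs2_squeeze0 (C := C) (u := fun n => nq (u n - x) + nq (v n - y))) => //.
  move=> eps e0; have [|N1 h1] := ux (eps / 2); first by rewrite divr_gt0.
  have [|N2 h2] := vy (eps / 2); first by rewrite divr_gt0.
  exists (maxn N1 N2) => n; rewrite geq_max => /andP[n1 n2].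
  have := h1 _ n1; have := h2 _ n2; lra.
move=> n; have mux := memB hH (mu n) mx; have mvy := memB hK (mv n) my.
have -> : L2dot y y' - c * L2dot x x' =
    c * L2dot (u n - x) x' - L2dot (v n - y) y'.
  by rewrite !dotBl// uv; ring.
have h := Cabs2D_le (c * L2dot (u n - x) x') (- L2dot (v n - y) y').
rewrite Cabs2N Cabs2M in h.
have h1 := cauchy_schwarz hH mux mx'; have h2 := cauchy_schwarz hK mvy my'.
have u0 := nq_ge0 hH mux; have v0 := nq_ge0 hK mvy.
have h3 : Cabs2 c * Cabs2 (L2dot (u n - x) x') <= Cabs2 c * (nq (u n - x) * nq x').
  exact: ler_wpM2l.
have a0 : 0 <= Cabs2 c * nq x' * nq (v n - y) by rewrite !mulr_ge0.
have b0 : 0 <= nq y' * nq (u n - x) by rewrite !mulr_ge0.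
rewrite /C; nra.
Qed.

(** * The closure D of b_k |-> w_k, and D^* D *)

Section NumberOperator.
Variables (R : realType) (H K : L2type R) (hH : hilbert H) (hK : hilbert K).
Variables (I : choiceType) (b : I -> L2fun H) (w : I -> L2fun K) (L : I -> R).
Hypothesis b_onb : orthonormal_basis b.
Hypothesis mw : forall i, L2mem (w i).
Hypothesis L0 : forall i, 0 <= L i.
Hypothesis ww : forall i j, L2dot (w i) (w j) = Ccst (L i) *+ (i == j).
Local Notation cf F k := (L2dot F (b k)).

Definition pre_grad (F : L2fun H) (V : L2fun K) : Prop :=
  exists (S : {fset I}) (c : I -> R[i]),
    F = \sum_(k <- S) c k *: b k /\ V = \sum_(k <- S) c k *: w k.
Definition grad := op_closure pre_grad.
Definition number_op := op_comp (op_adjoint grad) grad.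

Let one0 : I -> 0 <= 1 :> R. Proof. by []. Qed.

Let mb i : L2mem (b i). Proof. by case: b_onb. Qed.

Let bb i j : L2dot (b i) (b j) = Ccst 1 *+ (i == j).
Proof. by case: b_onb => _ -> _. Qed.

Let b_span (F : L2fun H) : L2mem F -> forall eps : R, 0 < eps ->
  exists S c, nq (F - lin_comb b S c) < eps.
Proof.
move=> mF eps e0; case: b_onb => _ _ /(_ F mF eps e0)[S [c h]]; exists S, c.
by rewrite (nsqE hH) ?lte_fin// in h; apply: memB => //; exact: lin_comb_mem.
Qed.

Lemma onb_expansion (F : L2fun H) : L2mem F ->
  L2sum (fun k => cf F k *: b k) F.
Proof.
move=> mF; apply: (expansion hH mb one0 bb mF _ (b_span mF)) => i.
by rewrite mul1r.
Qed.

Lemma onb_parseval (F : L2fun H) : L2mem F ->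
  L2nsq F = \esum_(k in [set: I]) (Cabs2 (cf F k))%:E.
Proof.
move=> mF; rewrite (parseval hH mb one0 bb mF (a := fun k => cf F k) _ (b_span mF)).
  by apply: eq_esum => i _; rewrite mul1r.
by move=> i; rewrite mul1r.
Qed.

Lemma pre_grad_mem F V : pre_grad F V -> L2mem F /\ L2mem V.
Proof.
move=> [S [c [-> ->]]]; split.
- exact: (lin_comb_mem hH mb).
- exact: (lin_comb_mem hK mw).
Qed.

Lemma pre_grad_basis k : pre_grad (b k) (w k).
Proof. by exists [fset k]%fset, (fun=> 1); rewrite !big_seq_fset1 !scale1r. Qed.

Lemma lin_comb_incl (G : L2type R) (g : I -> L2fun G) (S T : {fset I}) c :
  (S `<=` T)%fset ->
  lin_comb g S c = lin_comb g T (fun i => if i \in S then c i else 0).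
Proof.
move=> ST; rewrite /lin_comb -(big_fset_incl _ ST).
  by apply: eq_big_seq => i ->.
by move=> i _ /negbTE ->; rewrite scale0r.
Qed.

Lemma pre_grad_lin a F F' V V' : pre_grad F V -> pre_grad F' V' ->
  pre_grad (a *: F + F') (a *: V + V').
Proof.
move=> [S [c [-> ->]]] [S' [c' [-> ->]]].
(* Coefficients are unconstrained off their finite set, so they are cut to zero there before being
   added over the union. *)
exists (S `|` S')%fset, (fun i => a * (if i \in S then c i else 0) +
  (if i \in S' then c' i else 0)).
have comb (G : L2type R) (g : I -> L2fun G) :
    a *: lin_comb g S c + lin_comb g S' c' = \sum_(k <- (S `|` S')%fset)
      (a * (if k \in S then c k else 0) + (if k \in S' then c' k else 0)) *: g k.
  rewrite (lin_comb_incl _ _ (fsubsetUl S S')) (lin_comb_incl _ _ (fsubsetUr S S')).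
  by rewrite scaler_sumr -big_split; apply: eq_bigr => i _; rewrite scalerDl scalerA.
by split; rewrite -comb.
Qed.

Lemma pre_grad_coef F V k : pre_grad F V ->
  L2dot V (w k) = Ccst (L k) * cf F k.
Proof.
move=> [S [c [-> ->]]].
rewrite (dot_lin_comb hK mw ww) (dot_lin_comb hH mb bb) mulr1 mulrnAr.
by rewrite mulrC.
Qed.

Lemma L2nsq0 (G : L2type R) : hilbert G -> L2nsq (0 : L2fun G) = 0%E.
Proof. by move=> hG; rewrite (nsqE hG) /nq ?(dot0l hG)//; exact: hil0. Qed.

Lemma L2eq_coef F F' k : L2mem F -> L2mem F' -> L2eq F F' -> cf F k = cf F' k.
Proof.
move=> mF mF'; rewrite /L2eq (nsqE hH); last exact: memB.
move=> [F0]; apply/eqP; rewrite -subr_eq0 -(dotBl hH)//; apply/eqP/Cabs2_eq0.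
by rewrite (le_trans (cauchy_schwarz hH (memB hH mF mF') (mb k)))// F0 mul0r.
Qed.

(** Single-valuedness is the point: if two finite combinations of the [b k] agree up to a null
    vector, their difference has zero coefficients by orthonormality, and so has its image. *)
Lemma pre_grad_linear : linear_operator pre_grad.
Proof.
split; [exact: pre_grad_mem| |exact: pre_grad_lin].
move=> F F' V V' FV FV' FF'.
have [mF mV] := pre_grad_mem FV; have [mF' mV'] := pre_grad_mem FV'.
have := pre_grad_lin (-1) FV' FV.
rewrite !scaleN1r ![- _ + _]addrC => -[S [c [eF eV]]].
rewrite /L2eq eV big_seq big1 ?L2nsq0// => k kS.
have := dot_lin_comb hH mb bb S c k.
rewrite kS mulr1n /lin_comb -eF (dotBl hH)// (L2eq_coef k mF mF' FF') subrr mulr1.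
by move=> <-; rewrite scale0r.
Qed.

Lemma grad_mem F V : grad F V -> L2mem F /\ L2mem V.
Proof. by case. Qed.

Lemma grad_basis k : grad (b k) (w k).
Proof.
split => //; exists (fun=> b k), (fun=> w k); split.
- by move=> _; exact: pre_grad_basis.
- by rewrite /L2cvg subrr L2nsq0//; exact: cvg_cst.
- by rewrite /L2cvg subrr L2nsq0//; exact: cvg_cst.
Qed.

Lemma grad_coef F V k : grad F V -> L2dot V (w k) = Ccst (L k) * cf F k.
Proof.
move=> [mF mV [u [v [uv uF vV]]]].
apply: (dot_cvg_eq hH hK _ _ mF mV (mb k) (mw k) uF vV).
- by move=> n; case: (pre_grad_mem (uv n)).
- by move=> n; case: (pre_grad_mem (uv n)).
- by move=> n; exact: pre_grad_coef.
Qed.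

(** [V] is a limit of finite combinations of the [w k], so it has no component orthogonal to the
    system and its norm is read off from [grad_coef]. *)
Lemma grad_parseval F V : grad F V ->
  L2nsq V = \esum_(k in [set: I]) (L k * Cabs2 (cf F k))%:E.
Proof.
move=> gFV; have [mF mV [u [v [uv uF vV]]]] := gFV.
apply: (parseval hK mw L0 ww mV (a := fun k => cf F k)).
  by move=> k; exact: grad_coef.
move=> eps e0.
have mv n : L2mem (v n) by case: (pre_grad_mem (uv n)).
have [N /(_ N (leqnn N)) hN] := (ncvgP hK mv mV).1 vV _ e0.
have [S [c [_ vE]]] := uv N; exists S, c.
by rewrite (nqBC hK mV) /lin_comb -?vE//; exact: lin_comb_mem.
Qed.

(** A limit [y] along [u n --> 0] is an image of [0] under the closed relation, so all its
    coefficients vanish, and Parseval makes [y] null. *)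
Lemma pre_grad_closable : closable pre_grad.
Proof.
move=> u v y uv my u0 vy.
have gy : grad 0 y by split; [exact: hil0|by []|exists u, v; split].
rewrite /L2eq subr0 (grad_parseval gy) esum1// => k _.
by rewrite (dot0l hH)// Cabs20 mulr0.
Qed.

Lemma L2sum_cvg (G : L2type R) (hG : hilbert G) (g : I -> L2fun G) (c : I -> R[i])
    (x : L2fun G) (S : nat -> {fset I}) (S0 : nat -> {fset I}) :
  (forall i, L2mem (g i)) -> L2mem x ->
  (forall n T, (S0 n `<=` T)%fset ->
     (L2nsq (x - \sum_(i <- T) c i *: g i)%R < (n.+1%:R^-1)%:E)%E) ->
  (forall n, (S0 n `<=` S n)%fset) ->
  L2cvg (fun n => \sum_(i <- S n) c i *: g i) x.
Proof.
move=> mg mx h SS; apply/(ncvgP hG) => //.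
  by move=> n; exact: lin_comb_mem.
move=> eps e0; have [N _ hN] := near_infty_natSinv_lt (PosNum e0).
exists N => n Nn; apply: lt_trans (hN n Nn).
have mn := lin_comb_mem hG mg (S n) c.
by have := h n _ (SS n); rewrite (nsqE hG) ?lte_fin ?(nqBC hG mx mn)//; exact: memB.
Qed.

(** Conversely, Riesz-Fischer builds [V] from the coefficients of [F], and partial sums approximate
    both at once. *)
Lemma grad_domain F : (exists V, grad F V) <->
  L2mem F /\ (\esum_(k in [set: I]) (L k * Cabs2 (cf F k))%:E < +oo)%E.
Proof.
split=> [[V gFV]|[mF fin]].
  have [mF mV] := grad_mem gFV.
  by split => //; rewrite -(grad_parseval gFV) (nsqE hK)// ltry.
have [V mV sV] := riesz_fischer hK mw L0 ww fin.
have n0 n : 0 < n.+1%:R^-1 :> R by rewrite invr_gt0.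
have [S hS] := choice (fun n => onb_expansion mF (n0 n)).
have [T hT] := choice (fun n => sV _ (n0 n)).
exists V; split => //.
(* Unconditional summation allows one finite set, large enough for both expansions, to serve [F] and
   [V] simultaneously. *)
exists (fun n => \sum_(k <- (S n `|` T n)%fset) cf F k *: b k).
exists (fun n => \sum_(k <- (S n `|` T n)%fset) cf F k *: w k); split.
- by move=> n; exists (S n `|` T n)%fset, (fun k => cf F k).
- by apply: (L2sum_cvg hH (S0 := S)) => // n; exact: fsubsetUl.
- by apply: (L2sum_cvg hK (S0 := T)) => // n; exact: fsubsetUr.
Qed.

(** Testing the adjoint relation on the pairs [(b k, w k)] gives the coefficients of [G].
    Conversely, these put [F] in the domain of [grad], and the adjoint relation holds on finite
    combinations, hence on the closure. *)
Lemma number_opP F G : number_op F G <->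
  [/\ L2mem F, L2mem G & forall k, cf G k = Ccst (L k) * cf F k].
Proof.
split=> [[V [gFV [mV mG adj]]]|[mF mG FG]].
  have [mF _] := grad_mem gFV; split => // k.
  have := adj _ _ (grad_basis k).
  rewrite (hil_conj hK mV (mw k)) (hil_conj hH mG (mb k)) (grad_coef k gFV).
  by move=> /(congr1 (fun z => z^*)); rewrite !conjCK.
have [V gFV] : exists V, grad F V.
  apply/grad_domain; split => //.
  apply: (@le_lt_trans _ _ (\esum_(k in [set: I])
      ((Cabs2 (cf F k))%:E + (Cabs2 (cf G k))%:E))%E).
    apply: le_esum => k _; rewrite FG Cabs2M Cabs2C -EFinD lee_fin.
    (* The square gives [L <= L^2 + 1/4], hence [L |F_k|^2 <= |F_k|^2 + |G_k|^2]. *)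
    have := Cabs2_ge0 (cf F k); have := L0 k; have := sqr_ge0 (2 * L k - 1); nra.
  rewrite esumD; [|by move=> *; rewrite lee_fin Cabs2_ge0..].
  by rewrite -!onb_parseval// !(nsqE hH)// -EFinD ltry.
exists V; split => //; have [_ mV] := grad_mem gFV; split => // u v guv.
have [mu mv [us [vs [uvs usu vsv]]]] := guv.
rewrite -[RHS]mul1r.
apply: (dot_cvg_eq hH hK _ _ mu mv mG mV usu vsv).
- by move=> n; case: (pre_grad_mem (uvs n)).
- by move=> n; case: (pre_grad_mem (uvs n)).
move=> n; have [S [c [-> ->]]] := uvs n; rewrite mul1r.
rewrite (dot_suml hK)//; last by move=> i; exact: memZ.
rewrite (dot_suml hH)//; last by move=> i; exact: memZ.
apply: eq_bigr => k _; rewrite (dotZl hK)// (dotZl hH)//.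
by rewrite (hil_conj hK mV (mw k)) (hil_conj hH mG (mb k)) (grad_coef k gFV) FG.
Qed.

Lemma number_op_basis k : number_op (b k) (Ccst (L k) *: b k).
Proof.
apply/number_opP; split => //; first exact: memZ.
by move=> j; rewrite (dotZl hH)// !bb; case: eqP => [->|_]; rewrite ?mulr0.
Qed.

Lemma number_op_linear : linear_operator number_op.
Proof.
split.
- by move=> F G /number_opP[].
- move=> F F' G G' /number_opP[mF mG FG] /number_opP[mF' mG' FG'] FF'.
  have mGG := memB hH mG mG'.
  rewrite /L2eq (onb_parseval mGG) esum1// => k _.
  by rewrite (dotBl hH)// FG FG' (L2eq_coef k mF mF' FF') subrr Cabs20.
- move=> a F F' G G' /number_opP[mF mG FG] /number_opP[mF' mG' FG'].
  apply/number_opP; split; [exact: (hil_lin hH)|exact: (hil_lin hH)|move=> k].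
  by rewrite !(hil_dotl hH)// FG FG'; ring.
Qed.

Lemma number_op_ge0 : nonnegative number_op.
Proof.
move=> F G [V [gFV [mV mG adj]]]; have [mF _] := grad_mem gFV.
rewrite (hil_conj hH mF mG) -(adj _ _ gFV) (dotxx hK)// Ccst_conj.
by rewrite lecE/= eqxx (nq_ge0 hK).
Qed.

(** Finite combinations of the [b k] lie in the domain, which is therefore dense. Symmetry holds
    because both sides equal an inner product of gradients. For the other inclusion, testing an
    adjoint pair on the eigenvectors [b k] gives exactly the coefficient condition of
    [number_opP]. *)
Lemma number_op_self_adjoint : self_adjoint number_op.
Proof.
split.
  move=> F mF eps e0; case: b_onb => _ _ /(_ F mF eps e0)[S [c h]].
  exists (\sum_(k <- S) c k *: b k), (\sum_(k <- S) c k *: (Ccst (L k) *: b k)).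
  split => //; elim: (S : seq I) => [|k s IH].
    rewrite !big_nil; apply/number_opP; split; [exact: hil0|exact: hil0|].
    by move=> k; rewrite (dot0l hH)// mulr0.
  by rewrite !big_cons; case: number_op_linear => _ _; apply => //; exact: number_op_basis.
move=> F G; split=> [[V [gFV [mV mG adj]]]|[mF mG adj]].
  have [mF _] := grad_mem gFV; split => // u v [U [guU [mU mv adju]]].
  rewrite (hil_conj hH mF mv) -(adju _ _ gFV) -(adj _ _ guU).
  by rewrite -(hil_conj hK mV mU).
apply/number_opP; split => // k.
have := adj _ _ (number_op_basis k); rewrite (dotZl hH)//.
rewrite (hil_conj hH mF (mb k)) (hil_conj hH mG (mb k)).
by move=> /(congr1 (fun z => z^*)); rewrite rmorphM /= !conjCK Ccst_conj.
Qed.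

(** Square summability of the coefficients [L k F_k] yields [G] by Riesz-Fischer, and [sum_coef]
    identifies its coefficients. *)
Lemma number_op_domain F : (exists G, number_op F G) <->
  L2mem F /\ (\esum_(k in [set: I]) ((L k) ^+ 2 * Cabs2 (cf F k))%:E < +oo)%E.
Proof.
split=> [[G /number_opP[mF mG FG]]|[mF fin]].
  split => //; suff -> : \esum_(k in [set: I]) ((L k) ^+ 2 * Cabs2 (cf F k))%:E =
    L2nsq G by rewrite (nsqE hH)// ltry.
  by rewrite onb_parseval//; apply: eq_esum => k _; rewrite FG Cabs2M Cabs2C.
have [|G mG sG] := riesz_fischer hH mb one0 bb (a := fun k => Ccst (L k) * cf F k).
  rewrite (eq_esum (b := fun k => ((L k) ^+ 2 * Cabs2 (cf F k))%:E))// => k _.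
  by rewrite mul1r Cabs2M Cabs2C.
exists G; apply/number_opP; split => // k.
by rewrite (sum_coef hH mb bb k mG sG) mulr1.
Qed.

Lemma number_op_expansion F G : number_op F G ->
  L2sum (fun k => (Ccst (L k) * cf F k) *: b k) G.
Proof.
move=> /number_opP[mF mG FG]; have := onb_expansion mG.
by rewrite (_ : (fun k => cf G k *: b k) = (fun k => (Ccst (L k) * cf F k) *: b k))//;
  apply/funext => k; rewrite FG.
Qed.

End NumberOperator.

(** * Completeness of L^2(m) and L^2(m; l^2) *)

Section SquareIntegrable.
Context d (T : measurableType d) (R : realType).
Variable m : {measure set T -> \bar R}.
Implicit Types f g : T -> R.

(** Fatou's lemma; a bound from rank [N] on suffices, since the lower limit ignores finitely many
    terms. *)
Lemma fatou_bound (D : set T) (F : nat -> T -> \bar R) (G : T -> \bar R)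
    (M : \bar R) (N : nat) : measurable D ->
  (forall n, measurable_fun D (F n)) -> (forall n x, D x -> (0 <= F n x)%E) ->
  (forall x, D x -> F n x @[n --> \oo] --> G x) ->
  (forall n, (N <= n)%N -> (\int[m]_(x in D) F n x <= M)%E) ->
  (\int[m]_(x in D) G x <= M)%E.
Proof.
move=> mD mF F0 FG FM.
have -> : (\int[m]_(x in D) G x = \int[m]_(x in D) limn_einf (F ^~ x))%E.
  apply: eq_integral => x; rewrite inE => Dx.
  rewrite is_cvg_limn_einfE; last by apply/cvg_ex; exists (G x); exact: FG.
  by apply/esym/cvg_lim => //; exact: FG.
apply: le_trans (fatou m mD mF F0) _.
rewrite limn_einf_lim; apply: lime_le; first exact: is_cvg_einfs.
apply: nearW => n; apply: le_trans (FM (maxn n N) (leq_maxr _ _)).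
by apply: ereal_inf_lbound; exists (maxn n N) => //=; exact: leq_maxl.
Qed.

Definition sqi f : Prop :=
  measurable_fun setT f /\ (\int[m]_x ((f x) ^+ 2)%:E < +oo)%E.

Lemma measurable_sqr (D : set T) f : measurable_fun D f ->
  measurable_fun D (fun x => ((f x) ^+ 2)%:E).
Proof. by move=> mf; apply/measurable_EFinP/measurable_funX. Qed.

Lemma sqi_integrable f g : sqi f -> sqi g ->
  m.-integrable setT (EFin \o (fun x => f x * g x)).
Proof.
move=> [mf f2] [mg g2].
have h0 (h : T -> R) : measurable_fun setT h -> (\int[m]_x ((h x) ^+ 2)%:E < +oo)%E ->
    m.-integrable setT (fun x => ((h x) ^+ 2)%:E).
  move=> mh h2; apply/integrableP; split; first exact: measurable_sqr.
  by under eq_integral do rewrite gee0_abs ?lee_fin ?sqr_ge0//.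
apply: (le_integrable measurableT _ _ (integrableD measurableT (h0 _ mf f2) (h0 _ mg g2))).
  by apply/measurable_EFinP; exact: measurable_funM.
move=> x _ /=; rewrite lee_fin (ger0_norm (addr_ge0 (sqr_ge0 _) (sqr_ge0 _))).
rewrite ler_norml; have := sqr_ge0 (f x - g x); have := sqr_ge0 (f x + g x); nra.
Qed.

Lemma sqi_comb a f g : sqi f -> sqi g -> sqi (fun x => a * f x + g x).
Proof.
move=> hf hg; have [mf f2] := hf; have [mg g2] := hg.
have mh : measurable_fun setT (fun x => a * f x + g x).
  by apply: measurable_funD => //; exact: measurable_funM.
split => //.
have I1 := integrableZl measurableT (a ^+ 2) (sqi_integrable hf hf).
have I2 := integrableZl measurableT (2 * a) (sqi_integrable hf hg).
have I3 := sqi_integrable hg hg.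
have I4 := integrableD measurableT (integrableD measurableT I1 I2) I3.
have := integrable_lty measurableT I4.
congr (_ < _)%E; apply: eq_integral => x _ /=.
by rewrite -!EFinM -!EFinD; congr (_%:E); ring.
Qed.

(** The inner product of the real space L^2(m), to which the complex one is reduced through real and
    imaginary parts. *)
Definition rip f g : R := (\int[m]_x (f x * g x))%R.

Lemma ripC f g : rip f g = rip g f.
Proof. by apply: eq_Rintegral => x _; rewrite mulrC. Qed.

Lemma rip_comb a f g h : sqi f -> sqi g -> sqi h ->
  rip (fun x => a * f x + g x) h = a * rip f h + rip g h.
Proof.
move=> hf hg hh.
rewrite /rip -RintegralZl//; last exact: sqi_integrable.
rewrite -RintegralD//;
  [|exact: (integrableZl _ _ (sqi_integrable hf hh))|exact: sqi_integrable].
by apply: eq_Rintegral => x _; ring.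
Qed.

Lemma rip_sqr f : sqi f -> (\int[m]_x ((f x) ^+ 2)%:E = (rip f f)%:E)%E.
Proof.
move=> [mf f2]; rewrite /rip /Rintegral fineK.
  by apply: eq_integral => x _; rewrite expr2.
under eq_integral do rewrite -expr2.
by rewrite ge0_fin_numE//; apply: integral_ge0 => x _; rewrite lee_fin sqr_ge0.
Qed.

Lemma sqi0 : sqi (fun=> 0).
Proof. by split => //; under eq_integral do rewrite expr0n/=; rewrite integral0. Qed.

Lemma sqiB f g : sqi f -> sqi g -> sqi (fun x => f x - g x).
Proof.
move=> hf hg; have := sqi_comb (-1) hg hf.
by congr sqi; apply/funext => x; ring.
Qed.

(* A rapidly Cauchy subsequence converges a.e. because
   [2 |d_k| <= 2^-k + 2^k d_k^2] and the squared norms of the increments [d_k]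
   decay like [4^-k]; Fatou's lemma then controls the distance to the limit. *)
Lemma sqi_complete (u : nat -> T -> R) : (forall n, sqi (u n)) ->
  (forall eps : R, 0 < eps -> exists N, forall p q, (N <= p)%N -> (N <= q)%N ->
     (\int[m]_x ((u p x - u q x) ^+ 2)%:E < eps%:E)%E) ->
  exists2 f, sqi f & forall eps : R, 0 < eps -> exists N, forall n, (N <= n)%N ->
     (\int[m]_x ((u n x - f x) ^+ 2)%:E < eps%:E)%E.
Proof.
move=> hu uC; have mu n : measurable_fun setT (u n) by case: (hu n).
have q0 k : 0 < 4^-1 ^+ k :> R by rewrite exprn_gt0// invr_gt0.
have [phi hphi] := choice (fun k => uC _ (q0 k)).
(* The running maximum makes both [psi k] and [psi k.+1] at least [phi k], so the increment [d' k]
   satisfies the bound of rank [k]. *)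
pose psi k := maxn k (\max_(i < k.+1) phi i).
have psi1 k : (phi k <= psi k)%N.
  by rewrite /psi leq_max (leq_bigmax (F := fun i : 'I_k.+1 => phi i) ord_max) orbT.
have psi2 k : (phi k <= psi k.+1)%N.
  rewrite /psi leq_max; apply/orP; right.
  by have := leq_bigmax (F := fun i : 'I_k.+2 => phi i) (inord k); rewrite inordK.
pose d' k x := u (psi k.+1) x - u (psi k) x.
have md k : measurable_fun setT (d' k) by exact: measurable_funB.
have hd k : (\int[m]_x ((d' k x) ^+ 2)%:E <= (4^-1 ^+ k)%:E)%E.
  by apply/ltW; apply: hphi.
have half n : \sum_(0 <= k < n) 2^-1 ^+ k <= 2 :> R.
  suff -> : \sum_(0 <= k < n) 2^-1 ^+ k = 2 - 2 * 2^-1 ^+ n :> R.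
    by rewrite gerBl mulr_ge0// exprn_ge0// invr_ge0.
  elim: n => [|n IH]; first by rewrite big_nil expr0; ring.
  by rewrite big_nat_recr//= IH exprS; field.
pose e' k x : \bar R := (2 ^+ k * (d' k x) ^+ 2)%:E.
have e0 k x : (0 <= e' k x)%E by rewrite lee_fin; apply: mulr_ge0;
  [exact: exprn_ge0|exact: sqr_ge0].
have me k : measurable_fun setT (e' k).
  by apply/measurable_EFinP; apply: measurable_funM => //; exact: measurable_funX.
pose F n x := (\sum_(0 <= k < n) e' k x)%E.
pose G x := (\sum_(0 <= k <oo) e' k x)%E.
have FG x : F n x @[n --> \oo] --> G x by exact: is_cvg_nneseries.
have F0 n x : (0 <= F n x)%E by exact: sume_ge0.
have mF n : measurable_fun setT (F n) by exact: emeasurable_sum.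
have mG : measurable_fun setT G by apply: (emeasurable_fun_cvg F) => // x _; exact: FG.
have G0 x : (0 <= G x)%E by exact: nneseries_ge0.
have G2 : (\int[m]_x G x <= 2%:E)%E.
  apply: (fatou_bound (F := F) (N := 0)) => // n _.
  rewrite /F ge0_integral_sum//; apply: (@le_trans _ _ (\sum_(0 <= k < n) (2^-1 ^+ k)%:E)%E).
    apply: lee_sum => k _; rewrite /e'.
    under eq_integral do rewrite EFinM.
    rewrite (ge0_integralZl _ measurableT (measurable_sqr (md k))); first last.
    - by rewrite lee_fin exprn_ge0.
    - by move=> x _; rewrite lee_fin sqr_ge0.
    apply: (@le_trans _ _ ((2 ^+ k)%:E * (4^-1 ^+ k)%:E)%E).
      by apply: lee_wpmul2l => //; rewrite lee_fin exprn_ge0.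
    have -> : 2^-1 = 2 * 4^-1 :> R by field.
    by rewrite -EFinM lee_fin -exprMn.
  by rewrite sumEFin lee_fin.
have iG : m.-integrable setT G.
  apply/integrableP; split => //; under eq_integral do rewrite gee0_abs//.
  by apply: le_lt_trans G2 _; rewrite ltry.
have [Z [mZ Z0 ZG]] := integrable_ae measurableT iG.
have Gfin x : ~ Z x -> G x \is a fin_num.
  by move=> nZ; apply: contrapT => h; apply: nZ; apply: ZG => /(_ I).
have ucvg x : ~ Z x -> cvgn (fun k => u (psi k) x).
  move=> /Gfin Gx.
  have : cvgn (series (d'^~ x)).
    apply: normed_cvg; apply: nondecreasing_is_cvgn.
      by apply: nondecreasing_series => n _ _; exact: normr_ge0.
    exists (2 + fine (G x)) => _ [n _ <-] /=; rewrite /series/=.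
    apply: (@le_trans _ _ (\sum_(0 <= k < n) (2^-1 ^+ k + 2 ^+ k * d' k x ^+ 2))).
      apply: ler_sum => k _; rewrite exprVn.
      have p0 : 0 < 2 ^+ k :> R by rewrite exprn_gt0.
      rewrite -(ler_pM2l p0) mulrDr divff ?gt_eqF// mulrA -expr2 -exprMn.
      rewrite -[X in X * `|_|](gtr0_norm p0) -normrM.
      rewrite -[in leRHS]real_normK ?num_real//.
      have := sqr_ge0 (`|2 ^+ k * d' k x| - 1); nra.
    rewrite big_split/=; apply: lerD => //.
    rewrite -lee_fin fineK// -sumEFin.
    by apply: (@nneseries_lim_ge _ (e' ^~ x)) => k _ _; exact: e0.
  have -> : series (d'^~ x) = (fun n => u (psi n) x - u (psi 0) x).
    apply/funext => n; rewrite /series/=.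
    by rewrite (telescope_sumr (fun k => u (psi k) x)).
  move=> h; rewrite (_ : (fun k => u (psi k) x) =
      (fun n => u (psi n) x - u (psi 0) x) + cst (u (psi 0) x)).
    by apply: is_cvgD => //; exact: is_cvg_cst.
  by apply/funext => n; rewrite !fctE subrK.
(* Set to zero on the null set [Z], the subsequence converges everywhere and its limit is
   measurable. *)
pose g k x := u (psi k) x * \1_(~` Z) x.
have gcvg x : cvgn (g ^~ x).
  rewrite /g; have [Zx|Zx] := pselect (Z x).
    rewrite indicE memNset; last by move=> /(_ Zx).
    by under eq_fun do rewrite mulr0; exact: is_cvg_cst.
  rewrite indicE mem_set//; under eq_fun do rewrite mulr1; exact: ucvg.
pose f x := limn (g ^~ x).
have mg k : measurable_fun setT (g k).
  by apply: measurable_funM => //; apply: measurable_indic; exact: measurableC.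
have mf : measurable_fun setT f.
  by apply: (measurable_fun_cvg (h := g)) => // x _; exact: gcvg.
have main eps : 0 < eps -> exists N, forall n, (N <= n)%N ->
    (\int[m]_x ((u n x - f x) ^+ 2)%:E < eps%:E)%E.
  move=> e1; have [|N hN] := uC (eps / 2); first by rewrite divr_gt0.
  exists N => n Nn; apply: (@le_lt_trans _ _ (eps / 2)%:E); last first.
    by rewrite lte_fin; lra.
  have mh (h : T -> R) : measurable_fun setT h ->
      measurable_fun setT (fun x => ((u n x - h x) ^+ 2)%:E).
    by move=> mh; apply: measurable_sqr; exact: measurable_funB.
  rewrite (ge0_negligible_integral mZ)//; last 2 first.
  - exact: mh.
  - by move=> x _; rewrite lee_fin sqr_ge0.
  apply: (fatou_bound (F := fun k x => ((u n x - g k x) ^+ 2)%:E) (N := N)) => //.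
  - exact: measurableD.
  - by move=> k; apply: measurable_funS (mh _ (mg k)).
  - by move=> k x _; rewrite lee_fin sqr_ge0.
  - move=> x _; apply: cvg_EFin; first by near=> k.
    have h : (u n x - g k x) @[k --> \oo] --> u n x - f x.
      by apply: cvgB; [exact: cvg_cst|exact: gcvg].
    by under eq_cvg do rewrite /= expr2; rewrite expr2; exact: cvgM.
  - move=> k Nk;
    apply: (@le_trans _ _ (\int[m]_(x in setT `\` Z) ((u n x - u (psi k) x) ^+ 2)%:E)%E).
      rewrite le_eqVlt; apply/orP; left; apply/eqP; apply: eq_integral => x.
      rewrite inE => -[_ /= nZ]; rewrite /g indicE mem_set// mulr1//.
    apply: (@le_trans _ _ (\int[m]_x ((u n x - u (psi k) x) ^+ 2)%:E)%E).
      apply: ge0_subset_integral => //; first exact: measurableD.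
        exact: mh.
      by move=> x _; rewrite lee_fin sqr_ge0.
    by apply/ltW/hN => //; rewrite (leq_trans Nk)// leq_maxl.
exists f => //; have [N /(_ N (leqnn N)) hN] := main 1 ltr01.
have : sqi (fun x => u N x - f x).
  split; first exact: measurable_funB.
  by apply: lt_trans hN _; rewrite ltry.
move=> /(sqiB (hu N)); congr sqi; apply/funext => x; rewrite subKr//.
Unshelve. all: by end_near. Qed.

End SquareIntegrable.

Section L2Hilbert.
Context d (T : measurableType d) (R : realType).
Variable m : {measure set T -> \bar R}.
Local Notation H := (L2 m).
Implicit Types f g h : T -> R[i]^o.
Let re f : T -> R := fun x => complex.Re (f x).
Let im f : T -> R := fun x => complex.Im (f x).

Lemma L2_nsqE f : Cmeasurable f -> L2nsq (l := H) f =
  (\int[m]_x ((re f x) ^+ 2)%:E + \int[m]_x ((im f x) ^+ 2)%:E)%E.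
Proof.
move=> [mr mi]; rewrite -ge0_integralD//.
- by move=> x _; rewrite lee_fin sqr_ge0.
- exact: measurable_sqr.
- by move=> x _; rewrite lee_fin sqr_ge0.
- exact: measurable_sqr.
Qed.

Lemma L2_memP f : L2mem (H := H) f <-> sqi m (re f) /\ sqi m (im f).
Proof.
have i0 (h : T -> R) : (0 <= \int[m]_x ((h x) ^+ 2)%:E)%E.
  by apply: integral_ge0 => x _; rewrite lee_fin sqr_ge0.
split=> [[mf]|[[mr r2] [mi i2]]].
  rewrite L2_nsqE// => h; case: mf => mr mi; split; split => //.
  - by apply: le_lt_trans h; rewrite leeDl.
  - by apply: le_lt_trans h; rewrite leeDr.
by split; [split|rewrite L2_nsqE//; exact: lte_add_pinfty].
Qed.

Lemma L2_dotE f g : L2mem (H := H) f -> L2mem (H := H) g ->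
  L2dot (l := H) f g = Complex (rip m (re f) (re g) + rip m (im f) (im g))
                               (rip m (im f) (re g) - rip m (re f) (im g)).
Proof.
move=> /L2_memP[rf jf] /L2_memP[rg jg]; apply: Cext => /=.
  rewrite /rip -RintegralD//; [|exact: sqi_integrable|exact: sqi_integrable].
  by apply: eq_Rintegral => x _; rewrite !CE; ring.
rewrite /rip -RintegralB//; [|exact: sqi_integrable|exact: sqi_integrable].
by apply: eq_Rintegral => x _; rewrite !CE; ring.
Qed.

Lemma re_lin a f g :
  re (a *: f + g) = fun x => complex.Re a * re f x + (- complex.Im a * im f x + re g x).
Proof. by apply/funext => x; rewrite /re /im !fctE Re_add [a *: f x]/( a * f x) Re_mul;
  ring. Qed.

Lemma im_lin a f g :
  im (a *: f + g) = fun x => complex.Re a * im f x + (complex.Im a * re f x + im g x).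
Proof. by apply/funext => x; rewrite /re /im !fctE Im_add [a *: f x]/( a * f x) Im_mul;
  ring. Qed.

Lemma L2_lin a f g : L2mem (H := H) f -> L2mem (H := H) g ->
  L2mem (H := H) (a *: f + g).
Proof.
move=> /L2_memP[rf jf] /L2_memP[rg jg]; apply/L2_memP; rewrite re_lin im_lin.
by split; do 2 apply: sqi_comb => //.
Qed.

Lemma L2_hilbert : hilbert H.
Proof.
split.
- by apply/L2_memP; split; exact: sqi0.
- exact: L2_lin.
- move=> a f g h mf mg mh; rewrite !L2_dotE//; last exact: L2_lin.
  move: mf mg mh => /L2_memP[rf jf] /L2_memP[rg jg] /L2_memP[rh jh].
  by apply: Cext; rewrite re_lin im_lin !CE !rip_comb//; try exact: sqi_comb; ring.
- move=> f g mf mg; rewrite !L2_dotE//; apply: Cext; rewrite !CE.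
    by rewrite (ripC m (re f)) (ripC m (im f)).
  by rewrite (ripC m (re f)) (ripC m (im f)); ring.
- move=> f mf; rewrite L2_nsqE ?L2_dotE//; last by case: mf.
  by move/L2_memP : mf => [rf jf]; rewrite !rip_sqr.
- by move=> f; apply: integral_ge0 => x _; rewrite lee_fin Cabs2_ge0.
move=> u mu uC.
have mB f g : L2mem (H := H) f -> L2mem (H := H) g -> L2mem (H := H) (f - g).
  by move=> mf mg; rewrite addrC -scaleN1r; exact: L2_lin.
have i0 (h : T -> R) : (0 <= \int[m]_x ((h x) ^+ 2)%:E)%E.
  by apply: integral_ge0 => x _; rewrite lee_fin sqr_ge0.
have sr n : sqi m (re (u n)) by case/L2_memP : (mu n).
have si n : sqi m (im (u n)) by case/L2_memP : (mu n).
have [fr sfr hfr] : exists2 f, sqi m f & forall eps : R, 0 < eps ->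
    exists N, forall n, (N <= n)%N ->
      (\int[m]_x ((re (u n) x - f x) ^+ 2)%:E < eps%:E)%E.
  apply: sqi_complete => // eps /uC[N hN]; exists N => p q Np Nq.
  apply: le_lt_trans (hN p q Np Nq); rewrite L2_nsqE; last by case: (mB _ _ (mu p) (mu q)).
  under eq_integral do rewrite -Re_opp -Re_add; exact: leeDl.
have [fi sfi hfi] : exists2 f, sqi m f & forall eps : R, 0 < eps ->
    exists N, forall n, (N <= n)%N ->
      (\int[m]_x ((im (u n) x - f x) ^+ 2)%:E < eps%:E)%E.
  apply: sqi_complete => // eps /uC[N hN]; exists N => p q Np Nq.
  apply: le_lt_trans (hN p q Np Nq); rewrite L2_nsqE; last by case: (mB _ _ (mu p) (mu q)).
  under eq_integral do rewrite -Im_opp -Im_add; exact: leeDr.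
have mf : L2mem (H := H) (fun x => Complex (fr x) (fi x)) by apply/L2_memP.
exists (fun x => Complex (fr x) (fi x)) => // eps e0.
have [|N1 h1] := hfr (eps / 2); first by rewrite divr_gt0.
have [|N2 h2] := hfi (eps / 2); first by rewrite divr_gt0.
exists (maxn N1 N2) => n; rewrite geq_max => /andP[n1 n2].
rewrite L2_nsqE; last by case: (mB _ _ (mu n) mf).
have -> : eps%:E = ((eps / 2)%:E + (eps / 2)%:E)%E by rewrite -EFinD -splitr.
apply: lteD.
  by under eq_integral do rewrite /re !fctE Re_add Re_opp/=; exact: h1.
by under eq_integral do rewrite /im !fctE Im_add Im_opp/=; exact: h2.
Qed.

End L2Hilbert.

(** * The Hilbert sum L^2(m; l^2), handled through its components in L^2(m) *)

Section L2l2Hilbert.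
Context d (T : measurableType d) (R : realType).
Variable m : {measure set T -> \bar R}.
Local Notation H := (L2 m).
Local Notation K := (L2l2 m).
Local Notation hH := (L2_hilbert m).
Implicit Types V W : T -> nat -> R[i]^o.

Let cp V (j : nat) : L2fun H := fun x => V x j.
Let nj V j : R := nq (cp V j).

Lemma nneseries_le (u : nat -> \bar R) M : (forall n, (0 <= u n)%E) ->
  (forall n, (\sum_(0 <= k < n) u k <= M)%E) -> (\sum_(0 <= k <oo) u k <= M)%E.
Proof.
move=> u0 h; apply: lime_le; first by apply: is_cvg_nneseries => n _ _; exact: u0.
exact: nearW.
Qed.

Lemma L2l2_nsqE V : (forall j, Cmeasurable (cp V j)) ->
  L2nsq (l := K) V = (\sum_(0 <= j <oo) L2nsq (cp V j))%E.
Proof.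
move=> mV; rewrite /= integral_nneseries//.
- move=> n; have [mr mi] := mV n.
  by apply/measurable_EFinP/measurable_funD; exact: measurable_funX.
- by move=> n x _; rewrite lee_fin Cabs2_ge0.
Qed.

Lemma L2l2_mem_cp V : L2mem (H := K) V -> forall j, L2mem (cp V j).
Proof.
move=> [mV nV] j; split; first exact: mV.
apply: le_lt_trans nV; rewrite L2l2_nsqE//.
apply: (@le_trans _ _ (\sum_(0 <= k < j.+1) L2nsq (cp V k))%E); last first.
  by apply: nneseries_lim_ge => k _ _; exact: (hil_ge0 hH).
by rewrite big_nat_recr//= leeDr// sume_ge0// => k _; exact: (hil_ge0 hH).
Qed.

Lemma L2l2_memP V : L2mem (H := K) V <-> (forall j, L2mem (cp V j)) /\
  exists M, forall n, \sum_(0 <= j < n) nj V j <= M.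
Proof.
split=> [mV|[mV [M hM]]].
  split; first exact: L2l2_mem_cp.
  have mc := L2l2_mem_cp mV; move: (mV) => [mmV nV].
  have n0 : (0 <= L2nsq (l := K) V)%E.
    by apply: integral_ge0 => x _; apply: nneseries_ge0 => j _ _; rewrite lee_fin Cabs2_ge0.
  exists (fine (L2nsq (l := K) V)) => n; rewrite -lee_fin fineK ?ge0_fin_numE//.
  rewrite L2l2_nsqE// -sumEFin.
  under eq_bigr do rewrite -(nsqE hH)//.
  by apply: nneseries_lim_ge => k _ _; exact: (hil_ge0 hH).
split; first by move=> j; case: (mV j).
rewrite L2l2_nsqE; last by move=> j; case: (mV j).
apply: (@le_lt_trans _ _ M%:E); last by rewrite ltry.
apply: nneseries_le; first by move=> j; exact: (hil_ge0 hH).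
move=> n; under eq_bigr do rewrite (nsqE hH)//.
by rewrite sumEFin lee_fin; exact: hM.
Qed.

Lemma nj_cvg V : L2mem (H := K) V -> cvgn (series (nj V)).
Proof.
move=> /L2l2_memP[mV [M hM]]; apply: nondecreasing_is_cvgn.
  by apply: nondecreasing_series => n _ _; exact: (nq_ge0 hH).
by exists M => _ [n _ <-]; exact: hM.
Qed.

Lemma L2l2_nsq_series V : L2mem (H := K) V ->
  L2nsq (l := K) V = (limn (series (nj V)))%:E.
Proof.
move=> mV; have mc := L2l2_mem_cp mV.
rewrite L2l2_nsqE; last by case: mV.
rewrite -EFin_lim; last exact: nj_cvg.
congr (limn _); apply/funext => n.
have -> : (EFin \o series (nj V)) n = (\sum_(0 <= k < n) (nj V k)%:E)%E.
  by rewrite /= /series/= sumEFin.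
by apply: eq_bigr => j _; rewrite (nsqE hH).
Qed.

Lemma L2l2_dotE V W : L2dot (l := K) V W =
  Complex (limn (series (fun j => complex.Re (L2dot (cp V j) (cp W j)))))
          (limn (series (fun j => complex.Im (L2dot (cp V j) (cp W j))))).
Proof. by []. Qed.

Lemma Cabs_le_sum (a b : R) (z : R[i]) : 0 <= a -> 0 <= b -> Cabs2 z <= a * b ->
  `|complex.Re z| <= a + b /\ `|complex.Im z| <= a + b.
Proof.
rewrite /Cabs2 => a0 b0 h; have r0 := sqr_ge0 (complex.Re z).
have i0 := sqr_ge0 (complex.Im z).
by split; rewrite -(@ler_pXn2r _ 2%N) ?nnegrE ?normr_ge0 ?addr_ge0// real_normK ?num_real//;
  nra.
Qed.

(** Cauchy-Schwarz in each component dominates the terms by the summable [nj V j + nj W j]. *)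
Lemma L2l2_dot_cvg V W : L2mem (H := K) V -> L2mem (H := K) W ->
  cvgn (series (fun j => complex.Re (L2dot (cp V j) (cp W j)))) /\
  cvgn (series (fun j => complex.Im (L2dot (cp V j) (cp W j)))).
Proof.
move=> mV mW; have mv := L2l2_mem_cp mV; have mw := L2l2_mem_cp mW.
have c : cvgn (series (nj V + nj W)).
  by rewrite seriesD; apply: is_cvgD; exact: nj_cvg.
have b j := Cabs_le_sum (nq_ge0 hH (mv j)) (nq_ge0 hH (mw j))
  (cauchy_schwarz hH (mv j) (mw j)).
have p0 j : 0 <= (nj V + nj W) j by rewrite addr_ge0 ?(nq_ge0 hH).
split; apply: normed_cvg; apply: (series_le_cvg _ p0 _ c) => j.
- exact: normr_ge0.
- exact: (b j).1.
- exact: normr_ge0.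
- exact: (b j).2.
Qed.

Lemma series_lin (a b : R) (u v w : nat -> R) : cvgn (series u) ->
  cvgn (series v) -> cvgn (series w) ->
  limn (series (fun n => a * u n + (b * v n + w n))) =
  a * limn (series u) + (b * limn (series v) + limn (series w)).
Proof.
move=> cu cv cw; apply/cvg_lim => //.
rewrite [X in X @ _ --> _](_ : _ =
  fun n => a * series u n + (b * series v n + series w n)).
  by apply: cvgD; [exact: cvgMr|apply: cvgD => //; exact: cvgMr].
by apply/funext => n; rewrite /series/= !big_split/= !mulr_sumr.
Qed.

Lemma L2l2_lin a V W : L2mem (H := K) V -> L2mem (H := K) W ->
  L2mem (H := K) (a *: V + W).
Proof.
move=> /L2l2_memP[mV [M hM]] /L2l2_memP[mW [N hN]]; apply/L2l2_memP.
have mj j : L2mem (cp (a *: V + W) j) by exact: (hil_lin hH a (mV j) (mW j)).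
split => //; exists (2 * Cabs2 a * M + 2 * N) => n.
apply: (@le_trans _ _ (\sum_(0 <= j < n) (2 * Cabs2 a * nj V j + 2 * nj W j))).
  apply: ler_sum => j _.
  apply: le_trans (nqD_le hH (memZ hH a (mV j)) (mW j)) _.
  by rewrite (nqZ hH)// mulrA.
rewrite big_split/= -!mulr_sumr; apply: lerD; apply: ler_wpM2l => //.
by rewrite mulr_ge0// Cabs2_ge0.
Qed.

Lemma L2l2_hilbert : hilbert K.
Proof.
have ge0 V : (0 <= L2nsq (l := K) V)%E.
  by apply: integral_ge0 => x _; apply: nneseries_ge0 => j _ _; rewrite lee_fin Cabs2_ge0.
split => //.
- apply/L2l2_memP; split; first by move=> j; exact: (hil0 hH).
  exists 0 => n; rewrite big1// => j _.
  by rewrite /nj /nq (dot0l hH)//; exact: (hil0 hH).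
- exact: L2l2_lin.
- move=> a V W U mV mW mU.
  have mv := L2l2_mem_cp mV; have mw := L2l2_mem_cp mW; have mu := L2l2_mem_cp mU.
  have [rv iv] := L2l2_dot_cvg mV mU; have [rw iw] := L2l2_dot_cvg mW mU.
  have e j : L2dot (cp (a *: V + W) j) (cp U j) =
      a * L2dot (cp V j) (cp U j) + L2dot (cp W j) (cp U j).
    exact: (hil_dotl hH a (mv j) (mw j) (mu j)).
  rewrite !L2l2_dotE; apply: Cext; rewrite !CE.
    rewrite -addrA -mulNr -series_lin//; congr (limn (series _)).
    by apply/funext => j; rewrite e !CE; ring.
  rewrite -addrA -series_lin//; congr (limn (series _)).
  by apply/funext => j; rewrite e !CE; ring.
- move=> V W mV mW.
  have mv := L2l2_mem_cp mV; have mw := L2l2_mem_cp mW.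
  have [rv iv] := L2l2_dot_cvg mV mW.
  have e j : L2dot (cp W j) (cp V j) = (L2dot (cp V j) (cp W j))^*.
    by rewrite (hil_conj hH).
  rewrite !L2l2_dotE; apply: Cext; rewrite !CE.
    by congr (limn (series _)); apply/funext => j; rewrite e !CE.
  rewrite -limN//; congr (limn _); apply/funext => n.
  rewrite -[LHS]/(\sum_(0 <= k < n) complex.Im (L2dot (cp W k) (cp V k))).
  rewrite -[RHS]/(- \sum_(0 <= k < n) complex.Im (L2dot (cp V k) (cp W k))).
  by rewrite -sumrN; apply: eq_bigr => j _; rewrite e !CE.
- by move=> V mV; rewrite L2l2_nsq_series.
move=> u mu uC; have mc n j := L2l2_mem_cp (mu n) j.
have mBK V W : L2mem (H := K) V -> L2mem (H := K) W -> L2mem (H := K) (V - W).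
  by move=> mV mW; rewrite addrC -scaleN1r; exact: L2l2_lin.
have part V n : L2mem (H := K) V -> ((\sum_(0 <= j < n) nj V j)%:E <= L2nsq (l := K) V)%E.
  move=> mV; rewrite L2l2_nsqE; last by case: mV.
  rewrite -sumEFin; under eq_bigr do rewrite -(nsqE hH (L2l2_mem_cp mV _)).
  by apply: nneseries_lim_ge => k _ _; exact: (hil_ge0 hH).
have uC' eps : 0 < eps -> exists N, forall p q, (N <= p)%N -> (N <= q)%N -> forall n,
    \sum_(0 <= j < n) nj (u p - u q) j < eps.
  move=> /uC[N hN]; exists N => p q Np Nq n; rewrite -lte_fin.
  by apply: le_lt_trans (hN p q Np Nq); apply: part; exact: mBK.
have lim j : exists f, L2mem (H := H) f /\ forall eps : R, 0 < eps -> exists N, forall n,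
    (N <= n)%N -> nq (cp (u n) j - f) < eps.
  have [|f mf hf] := hil_complete hH (u := fun n => cp (u n) j) (fun n => mc n j).
    move=> eps /uC'[N hN]; exists N => p q Np Nq.
    rewrite (nsqE hH) ?lte_fin; last exact: (memB hH).
    have := hN p q Np Nq j.+1; rewrite big_nat_recr//=; apply: le_lt_trans.
    rewrite lerDr sumr_ge0// => k _; apply: (nq_ge0 hH).
    by apply: L2l2_mem_cp; exact: mBK.
  exists f; split => // eps /hf[N hN]; exists N => n /hN.
  by rewrite (nsqE hH) ?lte_fin//; exact: (memB hH).
have [F hF] := choice lim; pose W x j := F j x.
have mF j : L2mem (H := H) (F j) by case: (hF j).
have small n eps : 0 < eps -> exists N, forall p, (N <= p)%N ->
    \sum_(0 <= j < n) nq (cp (u p) j - F j) < eps.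
  elim: n eps => [|n IH] eps e0; first by exists 0%N => p _; rewrite big_nil.
  have [|N1 h1] := IH (eps / 2); first by rewrite divr_gt0.
  have [|N2 h2] := (hF n).2 (eps / 2); first by rewrite divr_gt0.
  exists (maxn N1 N2) => p; rewrite geq_max => /andP[p1 p2].
  rewrite big_nat_recr//= (splitr eps); apply: ltrD; [exact: h1|exact: h2].
(* For each [J] an auxiliary rank [p] brings the first [J] components of [u p] close to the limit.
   Only [p] depends on [J], not [N], so the bound extends to the whole series. *)
have main eps : 0 < eps -> exists N, forall n, (N <= n)%N -> forall J,
    \sum_(0 <= j < J) nj (u n - W) j <= eps.
  move=> e0; have [|N hN] := uC' (eps / 4); first by rewrite divr_gt0.
  exists N => n Nn J; have [|N2 h2] := small J (eps / 4); first by rewrite divr_gt0.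
  pose p := maxn N N2.
  apply: (@le_trans _ _ (\sum_(0 <= j < J) (2 * nj (u n - u p) j + 2 * nq (cp (u p) j - F j)))).
    by apply: ler_sum => j _; exact: (nqB3_le hH (mc n j) (mc p j) (mF j)).
  rewrite big_split/= -!mulr_sumr.
  have e1 := hN n p Nn (leq_maxl _ _) J; have e2 := h2 p (leq_maxr _ _); lra.
have mW1 n eps : (forall J, \sum_(0 <= j < J) nj (u n - W) j <= eps) ->
    L2mem (H := K) (u n - W).
  move=> h; apply/L2l2_memP; split; last by exists eps.
  by move=> j; exact: (memB hH (mc n j) (mF j)).
have mW : L2mem (H := K) W.
  have [N /(_ N (leqnn N)) /mW1] := main 1 ltr01.
  by move=> /(L2l2_lin (-1))/(_ (mu N)); rewrite scaleN1r opprB subrK.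
exists W => // eps e0; have [|N hN] := main (eps / 2); first by rewrite divr_gt0.
exists N => n Nn; apply: (@le_lt_trans _ _ (eps / 2)%:E); last by rewrite lte_fin; lra.
have mB := mBK _ _ (mu n) mW; rewrite L2l2_nsqE; last by case: mB.
apply: nneseries_le; first by move=> j; exact: (hil_ge0 hH).
move=> J; under eq_bigr do rewrite (nsqE hH (L2l2_mem_cp mB _)).
by rewrite sumEFin lee_fin; exact: hN.
Qed.

End L2l2Hilbert.

(** * Product laws on sequence space *)

Section Independence.
Context d d1 d2 (T : measurableType d) (T1 : measurableType d1)
  (T2 : measurableType d2) (R : realType).
Variables (P : probability T R) (X : {mfun T >-> T1}) (Y : {mfun T >-> T2}).
Hypothesis XY : forall A B, measurable A -> measurable B ->
  P (X @^-1` A `&` Y @^-1` B) = (P (X @^-1` A) * P (Y @^-1` B))%E.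

Let Z (x : T) : T1 * T2 := (X x, Y x).
Let mZ : measurable_fun setT Z.
Proof. exact: measurable_fun_pair. Qed.
Let Zp : {mfun T >-> (T1 * T2)%type} := HB.pack Z (isMeasurableFun.Build _ _ _ _ _ mZ).

(** Rectangles determine a product measure, so [XY] identifies the joint law and Fubini becomes
    available. *)
Let jointE (A : set (T1 * T2)) : measurable A ->
  (distribution P X \x distribution P Y)%E A = distribution P Zp A.
Proof. by move=> mA; apply: (product_measure_unique _ mA) => B C mB mC; exact: XY. Qed.

Lemma indep_ge0_expectation (f : T1 -> \bar R) (g : T2 -> \bar R) :
  measurable_fun setT f -> measurable_fun setT g ->
  (forall x, 0 <= f x)%E -> (forall y, 0 <= g y)%E ->
  (\int[P]_x (f (X x) * g (Y x)) = \int[P]_x f (X x) * \int[P]_x g (Y x))%E.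
Proof.
move=> mf mg f0 g0.
pose h (z : T1 * T2) := (f z.1 * g z.2)%E.
have mh : measurable_fun setT h.
  by apply: emeasurable_funM; apply: measurableT_comp.
have h0 z : (0 <= h z)%E by exact: mule_ge0.
transitivity (\int[distribution P Zp]_z h z)%E.
  by rewrite ge0_integral_distribution.
transitivity (\int[(distribution P X \x distribution P Y)%E]_z h z)%E.
  by apply: eq_measure_integral => A mA _; apply/esym/jointE.
rewrite fubini_tonelli1//; rewrite /fubini_F /h/=.
under eq_integral do rewrite ge0_integralZl//.
rewrite ge0_integralZr//; last exact: integral_ge0.
by rewrite !ge0_integral_distribution.
Qed.

Lemma indep_integrable (f : T1 -> R) (g : T2 -> R) :
  measurable_fun setT f -> measurable_fun setT g ->
  P.-integrable setT (EFin \o (f \o X)) -> P.-integrable setT (EFin \o (g \o Y)) ->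
  P.-integrable setT (EFin \o (fun x => f (X x) * g (Y x))).
Proof.
move=> mf mg /integrableP[_ fi] /integrableP[_ gi]; apply/integrableP; split.
  apply/measurable_EFinP; apply: measurable_funM.
    by apply: measurableT_comp.
  by apply: measurableT_comp.
under eq_integral do rewrite /= normrM EFinM.
rewrite (@indep_ge0_expectation (fun x => `|f x|%:E) (fun y => `|g y|%:E))//.
- by apply: lte_mul_pinfty => //; [apply: integral_ge0|rewrite ge0_fin_numE//;
  exact: integral_ge0].
- by apply/measurable_EFinP; apply: measurableT_comp.
- by apply/measurable_EFinP; apply: measurableT_comp.
Qed.

Lemma indep_expectation (f : T1 -> R) (g : T2 -> R) :
  measurable_fun setT f -> measurable_fun setT g ->
  P.-integrable setT (EFin \o (f \o X)) -> P.-integrable setT (EFin \o (g \o Y)) ->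
  \int[P]_x (f (X x) * g (Y x)) = \int[P]_x f (X x) * \int[P]_x g (Y x).
Proof.
move=> mf mg fi gi; have fgi := indep_integrable mf mg fi gi.
pose h (z : T1 * T2) := (f z.1 * g z.2)%:E.
have mh : measurable_fun setT h.
  by apply/measurable_EFinP; apply: measurable_funM; apply: measurableT_comp.
have e (k : T1 * T2 -> \bar R) :
    (\int[(distribution P X \x distribution P Y)%E]_z k z = \int[distribution P Zp]_z k z)%E.
  by apply: eq_measure_integral => A mA _; exact: jointE.
have hi : (distribution P X \x distribution P Y)%E.-integrable setT h.
  apply/integrableP; split => //; rewrite e ge0_integral_distribution//.
    by case/integrableP: fgi.
  exact: measurableT_comp.
rewrite /Rintegral; transitivity (fine (\int[distribution P Zp]_z h z)%E).
  by rewrite integral_distribution.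
rewrite -e -integral12_prod_meas1// /fubini_F /h/=.
have gi' : (distribution P Y).-integrable setT (EFin \o g).
  apply/integrableP; split; first exact/measurable_EFinP.
  rewrite ge0_integral_distribution//; first by case/integrableP: gi.
  by apply: measurableT_comp => //; exact/measurable_EFinP.
have fi' : (distribution P X).-integrable setT (EFin \o f).
  apply/integrableP; split; first exact/measurable_EFinP.
  rewrite ge0_integral_distribution//; first by case/integrableP: fi.
  by apply: measurableT_comp => //; exact/measurable_EFinP.
transitivity (\int[distribution P X]_x (f x * \int[distribution P Y]_y g y)).
  congr fine; apply: eq_integral => x _.
  under eq_integral do rewrite EFinM.
  by rewrite integralZl// EFinM /Rintegral fineK//; exact: integrable_fin_num.
rewrite RintegralZr//; congr (_ * _); rewrite /Rintegral integral_distribution//;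
  exact/measurable_EFinP.
Qed.

End Independence.

(** * Finite-dimensional boxes and truncation of sequences *)

Section SequenceSpace.
Variable R : realType.

(** Unlike the one-coordinate generators, these sets are stable under intersection, as the Dynkin
    arguments require. *)
Definition boxes : set (set (RN R)) := [set B |
  exists (n : nat) (A : nat -> set (measurableTypeR R)),
    (forall j, measurable (A j)) /\
    B = [set x | forall j, (j < n)%N -> A j (coordRN j x)]].

Lemma measurable_coord j : measurable_fun setT (@coordRN R j : RN R -> measurableTypeR R).
Proof.
move=> _ A mA; rewrite setTI; apply: sub_sigma_algebra; exists j, A; split => //.
Qed.

Lemma box_measurable (n : nat) (A : nat -> set (measurableTypeR R)) :
  (forall j, measurable (A j)) ->
  measurable [set x : RN R | forall j, (j < n)%N -> A j (coordRN j x)].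
Proof.
move=> mA; rewrite (_ : [set _ | _] =
    \bigcap_(j < n) (@coordRN R j @^-1` A j : set (RN R))).
  apply: bigcap_measurableType => j _.
  by rewrite -[X in measurable X]setTI; exact: measurable_coord.
by apply/seteqP; split => x /= h j; exact: h.
Qed.

Lemma boxes_generate : @measurable _ (RN R) = <<s boxes >>.
Proof.
apply/seteqP; split; apply: smallest_sub.
- exact: smallest_sigma_algebra.
- move=> _ [j [A [mA ->]]]; apply: sub_sigma_algebra.
  exists j.+1, (fun i => if i == j then A else setT); split.
    by move=> i; case: ifP.
  apply/seteqP; split => x /= h.
    by move=> i _; case: eqP => // ->.
  by have := h j (ltnSn j); rewrite eqxx.
- exact: sigma_algebra_measurable.
- by move=> _ [n [A [mA ->]]]; exact: box_measurable.
Qed.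

Lemma boxes_setI : setI_closed boxes.
Proof.
move=> _ _ [n [A [mA ->]]] [k [B [mB ->]]].
exists (maxn n k), (fun j => (if (j < n)%N then A j else setT) `&`
  (if (j < k)%N then B j else setT)); split.
  by move=> j; apply: measurableI; case: ifP.
apply/seteqP; split => x /=.
  by move=> [xA xB] j _; split; case: ifP => // ?; [exact: xA|exact: xB].
move=> h; split => j jn.
  by have [] := h j (leq_trans jn (leq_maxl _ _)); rewrite jn.
by have [] := h j (leq_trans jn (leq_maxr _ _)); rewrite jn.
Qed.

(** Keeps the information of the first [n] coordinates without leaving the space: a function depends
    only on them iff it is invariant under [trunc n]. *)
Definition trunc (n : nat) (x : RN R) : RN R :=
  fun j => if (j < n)%N then coordRN j x else 0.

Lemma measurable_trunc n : measurable_fun setT (trunc n).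
Proof.
apply: (@measurability _ _ (RN R) (RN R) setT (trunc n) (@coord_sets R)) => //.
move=> _ [_ [j [A [mA ->]]] <-]; rewrite setTI.
have [jn|jn] := boolP (j < n)%N.
  rewrite (_ : _ @^-1` _ = (@coordRN R j @^-1` A : set (RN R))).
    by rewrite -[X in measurable X]setTI; exact: measurable_coord.
  by apply/seteqP; split => x; rewrite /= /trunc jn.
have [A0|A0] := pselect (A 0).
  rewrite (_ : _ @^-1` _ = setT)//; apply/seteqP; split => x //= _.
  by rewrite /trunc (negbTE jn).
rewrite (_ : _ @^-1` _ = set0)//; apply/seteqP; split => x //=.
by rewrite /trunc (negbTE jn).
Qed.

End SequenceSpace.

(** * Independence and laws of the coordinates under a product law *)

Section ProductLaw.
Variables (R : realType) (nu : probability (measurableTypeR R) R).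
Variable P : probability (RN R) R.
Hypothesis hP : is_product_law nu P.

Let cX (n : nat) : {mfun RN R >-> measurableTypeR R} :=
  HB.pack (@coordRN R n : RN R -> measurableTypeR R)
    (isMeasurableFun.Build _ _ _ _ _ (measurable_coord n)).
Let tX (n : nat) : {mfun RN R >-> RN R} :=
  HB.pack (@trunc R n) (isMeasurableFun.Build _ _ _ _ _ (@measurable_trunc R n)).

Lemma coord_law n (A : set (measurableTypeR R)) : measurable A ->
  P (@coordRN R n @^-1` A) = nu A.
Proof.
move=> mA; pose B j := if j == n then A else setT.
have mB j : measurable (B j) by rewrite /B; case: ifP.
rewrite (_ : _ @^-1` _ = [set x | forall j, (j < n.+1)%N -> B j (coordRN j x)]).
  rewrite hP// big_ord_recr/= {2}/B eqxx big1 ?mul1e// => i _.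
  by rewrite /B lt_eqF ?probability_setT// ltEnat/=.
apply/seteqP; split => x /= h.
  by move=> j _; rewrite /B; case: eqP => // ->.
by have := h n (ltnSn n); rewrite /B eqxx.
Qed.

(** Induction over the Dynkin system generated by boxes. For a box [B], both events are described by
    boxes, of lengths [n] and [n.+1], on which the product law is explicit. *)
Lemma coord_trunc_indep n (A : set (measurableTypeR R)) (B : set (RN R)) :
  measurable A -> measurable B ->
  P (@coordRN R n @^-1` A `&` @trunc R n @^-1` B) =
  (P (@coordRN R n @^-1` A) * P (@trunc R n @^-1` B))%E.
Proof.
move=> mA mB; rewrite coord_law//.
have mtr S : measurable S -> measurable (@trunc R n @^-1` S).
  by move=> mS; rewrite -[X in measurable X]setTI; exact: measurable_trunc.
have mcA : measurable (@coordRN R n @^-1` A : set (RN R)).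
  by rewrite -[X in measurable X]setTI; exact: measurable_coord.
have fnA : nu A \is a fin_num by exact: fin_num_measure.
move: B mB; rewrite boxes_generate.
apply: (dynkin_induction (P := fun B => P (@coordRN R n @^-1` A `&` @trunc R n @^-1` B) =
  (nu A * P (@trunc R n @^-1` B))%E) (@boxes_generate R) (@boxes_setI R)).
- by rewrite preimage_setT setIT coord_law// probability_setT mule1.
- move=> _ [k [C [mC ->]]].
  (* A truncated sequence is [0] from coordinate [n] on: a constraint there that excludes [0]
     empties the event, and all others are automatic. *)
  have [[j [nj jk C0]]|hC] := pselect (exists j, [/\ (n <= j)%N, (j < k)%N & ~ C j 0]).
    rewrite (_ : _ @^-1` [set _ | _] = set0) ?setI0 ?measure0 ?mule0//.
    apply/seteqP; split => x //= /(_ j jk).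
    by rewrite /coordRN /trunc ltnNge nj.
  pose D j := if (j < k)%N then C j else setT.
  have mD j : measurable (D j) by rewrite /D; case: ifP.
  have -> : @trunc R n @^-1` [set x | forall j, (j < k)%N -> C j (coordRN j x)] =
      [set x | forall j, (j < n)%N -> D j (coordRN j x)].
    apply/seteqP; split => x /= h j.
      by move=> jn; rewrite /D; case: ifP => // /h; rewrite /coordRN /trunc jn.
    move=> jk; rewrite /coordRN /trunc; case: ifPn => jn.
      by have := h j jn; rewrite /D jk.
    by apply: contrapT => C0; apply: hC; exists j; rewrite leqNgt.
  (* [A] is adjoined as the constraint on coordinate [n], the last one of a box of length [n.+1]. *)
  pose E j := if (j < n)%N then D j else A.
  have mE j : measurable (E j) by rewrite /E; case: ifP.
  rewrite (_ : _ `&` _ = [set x | forall j, (j < n.+1)%N -> E j (coordRN j x)]).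
    rewrite !hP// big_ord_recr/= {2}/E ltnn muleC; congr (_ * _)%E.
    by apply: eq_bigr => i _; rewrite /E ltn_ord.
  apply/seteqP; split => x /=.
    move=> [xA h] j; rewrite ltnS leq_eqVlt => /orP[/eqP ->|jn].
      by rewrite /E ltnn.
    by rewrite /E jn; exact: h.
  move=> h; split; first by have := h n (ltnSn n); rewrite /E ltnn.
  by move=> j jn; have := h j (ltnW jn); rewrite /E jn.
- move=> S mS h; have mtS := mtr _ mS; rewrite preimage_setC probability_setC//.
  have : P (@coordRN R n @^-1` A) = (P (@coordRN R n @^-1` A `\` @trunc R n @^-1` S) +
      P (@coordRN R n @^-1` A `&` @trunc R n @^-1` S))%E by exact: measureDI.
  rewrite h setDE coord_law//.
  have [a ->] : exists a, nu A = a%:E by exists (fine (nu A)); rewrite fineK.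
  have [p ->] : exists p, P (@trunc R n @^-1` S) = p%:E.
    by exists (fine (P (@trunc R n @^-1` S))); rewrite fineK//; exact: fin_num_measure.
  have [q ->] : exists q, P (@coordRN R n @^-1` A `&` ~` (@trunc R n @^-1` S)) = q%:E.
    exists (fine (P (@coordRN R n @^-1` A `&` ~` (@trunc R n @^-1` S)))).
    by rewrite fineK//; apply: fin_num_measure; apply: measurableI => //; exact: measurableC.
  move=> [e1]; have e2 : q = a * (1 - p) by lra.
  exact: (congr1 (@EFin R) e2).
- move=> F mF tF h; rewrite preimage_bigcup setI_bigcupr.
  have tG (G : nat -> set (RN R)) : (forall k, G k `<=` @trunc R n @^-1` F k) ->
      trivIset setT G.
    move=> GF; apply/trivIsetP => i j _ _ ij; apply/seteqP; split => // x [xi xj].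
    have /trivIsetP/(_ i j I I ij) := tF; rewrite -subset0.
    by move=> /(_ (trunc n x)); apply; split; [exact: (GF i)|exact: (GF j)].
  rewrite measure_bigcup//; last 2 first.
  - by move=> k _; apply: measurableI => //; exact: mtr.
  - by apply: tG => k; exact: subIsetr.
  rewrite measure_bigcup//; last 2 first.
  - by move=> k _; exact: mtr.
  - by apply: tG => k; exact: subset_refl.
  rewrite -(fineK fnA) -nneseriesZl//.
  by apply: eq_eseriesr => k _; rewrite fineK//; exact: h.
Qed.

(** Invariance under [trunc n] makes [G] a function of the truncated sequence, hence independent of
    coordinate [n]. *)
Lemma coord_trunc_integrable n (f : R -> R) (G : RN R -> R) :
  measurable_fun setT f -> measurable_fun setT G ->
  (forall x, G (trunc n x) = G x) ->
  P.-integrable setT (fun x => (f (coordRN n x))%:E) ->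
  P.-integrable setT (EFin \o G) ->
  P.-integrable setT (fun x => (f (coordRN n x) * G x)%:E) /\
  \int[P]_x (f (coordRN n x) * G x) = \int[P]_x f (coordRN n x) * \int[P]_x G x.
Proof.
move=> mf mG Gn fi Gi.
have GE : G = G \o trunc n by apply/funext => x /=; rewrite Gn.
have ind (A : set (measurableTypeR R)) (B : set (RN R)) :
    measurable A -> measurable B ->
    P (cX n @^-1` A `&` tX n @^-1` B) = (P (cX n @^-1` A) * P (tX n @^-1` B))%E.
  exact: coord_trunc_indep.
rewrite GE in Gi *; split.
- exact: (indep_integrable ind).
- exact: (indep_expectation ind).
Qed.

Lemma coord_ge0_integral n (f : R -> \bar R) : measurable_fun setT f ->
  (forall x, 0 <= f x)%E ->
  (\int[P]_x f (coordRN n x) = \int[nu]_x f x)%E.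
Proof.
move=> mf f0; rewrite -(ge0_integral_distribution (P := P) (cX n))//.
by apply: eq_measure_integral => A mA _; exact: coord_law.
Qed.

Lemma coord_integrable n (f : R -> R) : nu.-integrable setT (EFin \o f) ->
  P.-integrable setT (fun x => (f (coordRN n x))%:E) /\
  \int[P]_x f (coordRN n x) = \int[nu]_x f x.
Proof.
move=> /integrableP[mf fi].
have Pi : P.-integrable setT (fun x => (f (coordRN n x))%:E).
  apply/integrableP; split.
    by apply: (measurableT_comp mf); exact: measurable_coord.
  rewrite (@coord_ge0_integral n (fun x => `|(f x)%:E|%E))//.
  exact: measurableT_comp.
split => //; congr fine.
rewrite -(integral_distribution (P := P) (X := cX n) mf)//.
by apply: eq_measure_integral => A mA _; exact: coord_law.
Qed.

End ProductLaw.

(** * The one-dimensional ground state transform *)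

Section Density.
Context d (T : measurableType d) (R : realType).
Variables (m m' : {measure set T -> \bar R}) (w : T -> R).
Hypotheses (mw : measurable_fun setT w) (w0 : forall x, 0 <= w x).
Hypothesis m'E : forall A, measurable A -> m' A = (\int[m]_(x in A) (w x)%:E)%E.

Import HBNNSimple.

Let density_nnsfun (f : {nnsfun T >-> R}) :
  (\int[m']_x (f x)%:E = \int[m]_x (f x * w x)%:E)%E.
Proof.
transitivity (\sum_(k \in range f) \int[m']_x (k * \1_(f @^-1` [set k]) x)%:E)%E.
  under eq_integral do rewrite fimfunE -fsumEFin//.
  rewrite ge0_integral_fsum//.
  - by move=> y; exact/measurable_EFinP/measurable_funM.
  - by move=> y x _; rewrite nnfun_muleindic_ge0.
transitivity (\sum_(k \in range f) \int[m]_x (k * \1_(f @^-1` [set k]) x * w x)%:E)%E.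
  apply: eq_fsbigr => r _; rewrite integralZl_indic_nnsfun// integral_indic// setIT m'E//.
  rewrite integral_mkcond; have [r0|r0] := ltP r 0.
    rewrite preimage_nnfun0// [X in (_ * X)%E]integral0_eq; last first.
      by move=> x _; rewrite patchE in_set0.
    rewrite mule0 [RHS]integral0_eq// => x _.
    by rewrite indicE in_set0 mulr0 mul0r.
  rewrite -ge0_integralZl//.
  - apply: eq_integral => x _; rewrite patchE indicE /= -mulrA EFinM.
    by case: ifP => _; rewrite ?mul1r ?mul0r.
  - apply/(measurable_restrictT _ _).1 => //.
    by apply: measurable_funTS; exact/measurable_EFinP.
  - by move=> x _; rewrite patchE; case: ifP; rewrite lee_fin.
rewrite -ge0_integral_fsum//.
- by apply: eq_integral => x _; rewrite fsumEFin// -mulr_fsuml// -fimfunE.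
- by move=> r; apply/measurable_EFinP/measurable_funM => //; exact: measurable_funM.
- move=> r x _; rewrite EFinM mule_ge0 ?lee_fin//.
  by have := nnfun_muleindic_ge0 f r x; rewrite -EFinM lee_fin.
Qed.

Lemma density_ge0_integral (f : T -> \bar R) : measurable_fun setT f ->
  (forall x, 0 <= f x)%E ->
  (\int[m']_x f x = \int[m]_x (f x * (w x)%:E))%E.
Proof.
move=> mf f0; pose f_ := nnsfun_approx measurableT mf.
have fc x : (f_ n x)%:E @[n --> \oo] --> f x by apply: cvg_nnsfun_approx.
have nd x a b : (a <= b)%N -> ((f_ a x) <= (f_ b x)).
  by move=> ab; exact/lefP/nd_nnsfun_approx.
transitivity (limn (fun n => \int[m']_x (f_ n x)%:E)%E).
  rewrite -monotone_convergence//.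
  - by apply: eq_integral => y _; apply/esym/cvg_lim => //; exact: fc.
  - by move=> n; exact/measurable_EFinP/measurable_funP.
  - by move=> n y _; rewrite lee_fin.
  - by move=> y _ a b ab; rewrite lee_fin; exact: nd.
under eq_fun do rewrite density_nnsfun.
rewrite -monotone_convergence//.
- apply: eq_integral => y _; apply/cvg_lim => //.
  under eq_cvg do rewrite EFinM.
  by apply: cvgeZr.
- by move=> n; apply/measurable_EFinP/measurable_funM.
- by move=> n y _; rewrite lee_fin mulr_ge0.
- by move=> y _ a b ab; rewrite lee_fin ler_wpM2r//; exact: nd.
Qed.

Lemma density_integrable (f : T -> R) : measurable_fun setT f ->
  m.-integrable setT (fun x => (f x * w x)%:E) ->
  m'.-integrable setT (EFin \o f) /\
  \int[m']_x f x = \int[m]_x (f x * w x).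
Proof.
move=> mf /integrableP[mfw fi].
have mEf : measurable_fun setT (EFin \o f) by exact/measurable_EFinP.
have im' : m'.-integrable setT (EFin \o f).
  apply/integrableP; split => //.
  rewrite density_ge0_integral//; last exact: measurableT_comp.
  apply: le_lt_trans fi; rewrite le_eqVlt; apply/orP; left; apply/eqP.
  apply: eq_integral => x _ /=.
  by rewrite -EFinM normrM (ger0_norm (w0 x)).
split => //; congr fine; rewrite integralE [RHS]integralE; congr (_ - _)%E.
- rewrite density_ge0_integral//; last exact: measurable_funepos.
  apply: eq_integral => x _; rewrite !funeposE/= -!EFin_max -EFinM.
  by rewrite maxr_pMl// mul0r.
- rewrite density_ge0_integral//; last exact: measurable_funeneg.
  apply: eq_integral => x _; rewrite !funenegE/= -!EFin_max -EFinM.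
  by rewrite maxr_pMl// mul0r mulNr.
Qed.
End Density.

Section Dominated.
Context d (T : measurableType d) (R : realType).
Variable m : {measure set T -> \bar R}.

Lemma Rintegral_dominated (f_ : nat -> T -> R) (f g : T -> R) :
  (forall n, measurable_fun setT (f_ n)) -> measurable_fun setT f ->
  (forall x, f_ n x @[n --> \oo] --> f x) ->
  m.-integrable setT (EFin \o g) -> (forall n x, `|f_ n x| <= g x) ->
  m.-integrable setT (EFin \o f) /\
  \int[m]_x f_ n x @[n --> \oo] --> \int[m]_x f x.
Proof.
move=> mf_ mf ff gi fg.
have [] := @dominated_convergence _ _ _ m setT measurableT
  (fun n x => (f_ n x)%:E) (EFin \o f) (EFin \o g).
- by move=> n; exact/measurable_EFinP.
- exact/measurable_EFinP.
- by apply: aeW => x _; apply: cvg_EFin; [exact: nearW|exact: ff].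
- exact: gi.
- by apply: aeW => x n _ /=; rewrite lee_fin.
move=> fi _ h; split => //; apply: fine_cvg.
by rewrite fineK//; exact: integrable_fin_num.
Qed.
End Dominated.

(** * Continuously differentiable functions and compact support *)

Section C1Functions.
Variable R : realType.
Implicit Types f g df dg : R -> R.

(** The derivative is carried along explicitly, so that product, quotient and chain rules compose as
    terms. *)
Definition C1 f df : Prop :=
  (forall x, is_derive x (1 : R) f (df x)) /\ continuous df.

Lemma C1_derive1 f df : C1 f df -> derive1 f = df.
Proof.
by move=> [h _]; apply/funext => x; rewrite derive1E; apply: derive_val.
Qed.

Lemma C1_derivable f : (forall x, derivable f x 1) -> continuous (derive1 f) ->
  C1 f (derive1 f).
Proof. by move=> h c; split => // x; rewrite derive1E; exact/derivableP. Qed.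

Lemma C1_continuous f df : C1 f df -> continuous f.
Proof.
move=> [h _] x; apply/differentiable_continuous/derivable1_diffP.
by have := h x => -[].
Qed.

Lemma C1_mul f df g dg : C1 f df -> C1 g dg ->
  C1 (fun x => f x * g x) (fun x => f x * dg x + g x * df x).
Proof.
move=> hf hg; have cf := C1_continuous hf; have cg := C1_continuous hg.
case: hf hg => [hf cdf] [hg cdg]; split.
  by move=> x; have := hf x; have := hg x => ? ?; exact: is_deriveM.
by move=> x; apply: cvgD; apply: cvgM; [exact: cf|exact: cdg|exact: cg|exact: cdf].
Qed.

Lemma C1_inv f df : C1 f df -> (forall x, f x != 0) ->
  C1 (fun x => (f x)^-1) (fun x => - (f x) ^- 2 * df x).
Proof.
move=> hf f0; have cf := C1_continuous hf; case: hf => hf cdf; split.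
  by move=> x; have := hf x => ?; apply: is_deriveV.
move=> x; apply: cvgM; last exact: cdf.
apply: cvgN; apply: cvgV; first by rewrite expf_neq0.
by rewrite !expr2; apply: cvgM; exact: cf.
Qed.

Lemma C1_comp f df g dg : C1 f df -> C1 g dg ->
  C1 (fun x => g (f x)) (fun x => dg (f x) * df x).
Proof.
move=> hf hg; have cf := C1_continuous hf.
case: hf hg => [hf cdf] [hg cdg]; split.
  by move=> x; have := hf x; have := hg (f x) => ? ?; exact: is_derive1_comp.
move=> x; apply: cvgM; last exact: cdf.
by apply: continuous_comp; [exact: cf|exact: cdg].
Qed.

Lemma C1_cst (a : R) : C1 (fun=> a) (fun=> 0).
Proof.
split => [x|x]; last exact: cvg_cst.
exact: is_derive_cst.
Qed.

Lemma C1_id : C1 (fun x => x) (fun=> 1).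
Proof.
split => [x|x]; last exact: cvg_cst.
exact: is_derive_id.
Qed.

Lemma C1_add f df g dg : C1 f df -> C1 g dg ->
  C1 (fun x => f x + g x) (fun x => df x + dg x).
Proof.
move=> [hf cdf] [hg cdg]; split.
  by move=> x; have := hf x; have := hg x => ? ?; exact: is_deriveD.
by move=> x; apply: cvgD; [exact: cdf|exact: cdg].
Qed.

Lemma C1_eq f df dg : C1 f df -> (forall x, df x = dg x) -> C1 f dg.
Proof. by move=> hf /funext <-. Qed.

(** Serves to differentiate [max 0 s ^+ 2] across the kink of the maximum, where the algebraic rules
    do not apply. *)
Lemma is_derive_sqr_error f x l :
  (forall h, `|f (h + x) - f x - l * h| <= h ^+ 2) -> is_derive x (1 : R) f l.
Proof.
move=> hf.
have lim : h^-1 *: (f (h *: 1 + x) - f x) @[h --> 0^'] --> l.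
  apply/cvgrPdist_le => eps e0; near=> h.
  have h0 : h != 0 by near: h; exact: nbhs_dnbhs_neq.
  have hp : 0 < `|h| by rewrite normr_gt0.
  rewrite [h *: 1]mulr1 [h^-1 *: _]/(h^-1 * _).
  apply: (@le_trans _ _ `|h|); last first.
    near: h; apply: dnbhs0_le => //.
  rewrite -(ler_pM2l hp) -normrM mulrBr mulrA divff// mul1r -expr2 real_normK ?num_real//.
  by rewrite -normrN opprB mulrC.
apply: DeriveDef; first exact: cvgP lim.
exact: cvg_lim lim.
Unshelve. all: by end_near. Qed.

Lemma C1_pos_sqr :
  C1 (fun s => (Num.max 0 s) ^+ 2) (fun s => 2 * Num.max 0 s).
Proof.
split=> [x|x].
  apply: is_derive_sqr_error => h; rewrite ler_norml.
  case: (leP 0 x) => hx; case: (leP 0 (h + x)) => hy; nra.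
apply: cvgM; first exact: cvg_cst.
by apply: continuous_max; [exact: cvg_cst|exact: cvg_id].
Qed.

Definition csupp (M : R) f := forall x, M < `|x| -> f x = 0.

(** The condition [M < |x|] is open, so [f] vanishes in a whole neighbourhood of such a point. *)
Lemma csupp_deriv M f df : C1 f df -> csupp M f -> csupp M df.
Proof.
move=> [hf _] fM x xM.
have fx : \near x, f x = (fun=> 0 : R) x.
  have : nbhs x [set y | M < `|y|].
    have : `|y| @[y --> x] --> `|x| by exact: norm_continuous.
    by move=> /cvgrPdist_lt /(_ (`|x| - M)); rewrite subr_gt0 => /(_ xM);
      apply: filterS => y /=; rewrite ltr_norml => /andP[]; lra.
  by apply: filterS => y /= /fM.
have h1 := near_eq_is_derive fx (hf x).
have h2 : is_derive x (1 : R) (fun=> 0 : R) 0 by exact: is_derive_cst.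
by rewrite -(@derive_val _ _ _ _ _ _ _ h1) (@derive_val _ _ _ _ _ _ _ h2).
Qed.

Lemma segment_bounded f a b : continuous f ->
  exists B, forall x, a <= x <= b -> `|f x| <= B.
Proof.
move=> cf; have cK : compact (f @` `[a, b]).
  apply: continuous_compact; last exact: segment_compact.
  exact: continuous_subspaceT.
have [B [_ hB]] := compact_bounded cK.
exists (B + 1) => x xab; apply: (hB (B + 1)); first by rewrite ltrDl.
by exists x => //=; rewrite in_itv.
Qed.

Lemma csupp_bounded M f : continuous f -> csupp M f -> exists B, forall x, `|f x| <= B.
Proof.
move=> cf fM; have [B hB] := segment_bounded (- M) M cf.
exists (Num.max 0 B) => x; rewrite le_max; have [xM|xM] := ltP M `|x|.
  by rewrite fM// normr0 lexx.
by rewrite hB ?orbT//; rewrite -ler_norml.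
Qed.

Lemma C1_loc_abs_continuous f df : C1 f df -> loc_abs_continuous f.
Proof.
move=> hf a b ab; have cf := C1_continuous hf; case: hf => hf cdf.
have [B0 hB0] := segment_bounded a b cdf.
(* A strictly positive Lipschitz constant on the segment, so that [delta = eps / B] makes sense. *)
pose B := Num.max B0 0 + 1.
have B1 : 0 < B by rewrite /B ltr_pwDr// le_max lexx orbT.
have hB x : a <= x <= b -> `|df x| <= B.
  by move=> /hB0; rewrite /B => h; rewrite (le_trans h)// ler_wpDr// le_max lexx.
have lip s t : a <= s -> s <= t -> t <= b -> `|f t - f s| <= B * (t - s).
  move=> as_; rewrite le_eqVlt => /orP[/eqP ->|st] tb.
    by rewrite !subrr normr0 mulr0.
  have [|c] := @MVT R f df s t st (fun x _ => hf x).
    exact: continuous_subspaceT.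
  rewrite in_itv/= => /andP[sc ct] ->; rewrite normrM (gtr0_norm (_ : 0 < t - s)) ?subr_gt0//.
  rewrite ler_wpM2r ?subr_ge0 ?(ltW st)//; apply: hB.
  by rewrite (le_trans as_ (ltW sc)) (le_trans (ltW ct) tb).
move=> eps e0; exists (eps / B); first by rewrite divr_gt0.
move=> n s t hst _ hsum.
apply: (@le_lt_trans _ _ (\sum_i B * (t i - s i))).
  by apply: ler_sum => i _; have [h1 h2 h3] := hst i; exact: lip.
by rewrite -mulr_sumr mulrC -ltr_pdivlMr.
Qed.

End C1Functions.

Section Cutoff.
Variable R : realType.

(** A piecewise polynomial bump supported in [[-1/c, 1/c]]. The outer square makes it C^1; as [c]
    tends to 0 it tends to 1 pointwise, while its derivative is at most [4 c]. *)
Definition cutoff (c x : R) : R := (Num.max 0 (1 - (c * x) ^+ 2)) ^+ 2.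
Definition dcutoff (c x : R) : R :=
  2 * Num.max 0 (1 - (c * x) ^+ 2) * (- (2 * c * (c * x))).

Lemma cutoff_C1 c : C1 (cutoff c) (dcutoff c).
Proof.
have h1 : C1 (fun x : R => c * x) (fun x => c * 1 + x * 0) := C1_mul (C1_cst c) (C1_id R).
have h2 := C1_add (C1_cst 1) (C1_mul (C1_cst (-1)) (C1_mul h1 h1)).
have := C1_comp h2 (C1_pos_sqr R).
rewrite (_ : (fun x => _ ^+ 2) = cutoff c); last first.
  by apply/funext => x; rewrite /cutoff mulN1r expr2.
by move=> /C1_eq; apply => x; rewrite /dcutoff mulN1r expr2; ring.
Qed.

Lemma cutoff_ge0 c x : 0 <= cutoff c x.
Proof. exact: sqr_ge0. Qed.

Lemma cutoff_le1 c x : cutoff c x <= 1.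
Proof.
rewrite /cutoff; move: (sqr_ge0 (c * x)); move: (_ ^+ 2) => t t0.
by case: (leP 0 (1 - t)) => h; rewrite ?expr0n/= ?expr2; nra.
Qed.

Lemma cutoff_csupp c : 0 < c -> csupp c^-1 (cutoff c).
Proof.
move=> c0 x; rewrite -(ltr_pM2l c0) divff ?gt_eqF// => h.
have h1 : 1 < (c * x) ^+ 2.
  rewrite -real_normK ?num_real// normrM (gtr0_norm c0).
  by rewrite -[ltLHS](expr1n _ 2) ltr_pXn2r// nnegrE// mulr_ge0// ltW.
by rewrite /cutoff max_l ?expr0n//; lra.
Qed.

Lemma dcutoff_le c x : 0 < c -> `|dcutoff c x| <= 4 * c.
Proof.
move=> c0; rewrite /dcutoff; case: (leP 0 (1 - (c * x) ^+ 2)) => h.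
  have /andP[h1 h2] : -1 <= c * x <= 1.
    by rewrite -ler_norml -(@ler_pXn2r _ 2%N) ?nnegrE// expr1n real_normK ?num_real//; lra.
  have y0 := sqr_ge0 (c * x); set y := c * x in h y0 h1 h2 *.
  have -> : 2 * (1 - y ^+ 2) * - (2 * c * y) = (4 * c) * ((1 - y ^+ 2) * - y) by ring.
  rewrite normrM gtr0_norm; last lra.
  rewrite -[leRHS]mulr1 ler_wpM2l//; first lra.
  rewrite ler_norml; nra.
by rewrite mulr0 mul0r normr0; lra.
Qed.

Lemma cutoff_cvg (x : R) : cutoff n.+1%:R^-1 x @[n --> \oo] --> (1 : R).
Proof.
have b c : `|1 - cutoff c x| <= 2 * (c * x) * (c * x).
  have y0 := sqr_ge0 (c * x); rewrite /cutoff; case: (leP 0 (1 - (c * x) ^+ 2)) => h;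
    rewrite ler_norml; nra.
apply/cvgrPdist_le => eps e0; near=> n; apply: le_trans (b _) _.
near: n; have : 2 * (n.+1%:R^-1 * x) * (n.+1%:R^-1 * x) @[n --> \oo] --> 2 * (0 * x) * (0 * x).
  have h : (n.+1%:R^-1 * x) @[n --> \oo] --> 0 * x.
    by apply: cvgMl; exact: cvg_harmonic.
  by apply: cvgM => //; apply: cvgMr.
rewrite !mul0r mulr0 => /cvgrPdist_le /(_ _ e0); apply: filterS => n.
by rewrite sub0r normrN; apply: le_trans; exact: ler_norm.
Unshelve. all: by end_near. Qed.

Lemma dcutoff_cvg (x : R) : dcutoff n.+1%:R^-1 x @[n --> \oo] --> (0 : R).
Proof.
apply/cvgr0Pnorm_le => eps e0; near=> n; apply: le_trans (dcutoff_le _ _) _.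
  by rewrite invr_gt0.
near: n; have : 4 * n.+1%:R^-1 @[n --> \oo] --> 4 * (0 : R).
  by apply: cvgMr; exact: cvg_harmonic.
rewrite mulr0 => /cvgr0Pnorm_le /(_ _ e0); apply: filterS => n.
by apply: le_trans; exact: ler_norm.
Unshelve. all: by end_near. Qed.

End Cutoff.

Lemma bounded_integrable d (T : measurableType d) (R : realType)
    (m : {finite_measure set T -> \bar R}) (f : T -> R) (B : R) :
  measurable_fun setT f -> (forall x, `|f x| <= B) ->
  m.-integrable setT (EFin \o f).
Proof.
move=> mf fB; apply: (@le_integrable _ _ _ m setT measurableT _ (fun=> B%:E)).
- exact/measurable_EFinP.
- by move=> x _ /=; rewrite lee_fin (le_trans (fB x))// ler_norm.
- exact: finite_measure_integrable_cst.
Qed.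

(** * Weak eigenvalue equations and the ground state substitution *)

Section Eigensystem.
Variables (R : realType) (mu : R) (alpha : nat -> R) (e : nat -> R -> R).
Hypothesis H : eigensystem mu alpha e.
Local Notation G := (gauss R).
Local Notation de k := (derive1 (e k)).
Local Notation r := (rfun e).
Local Notation dr k := (derive1 (rfun e k)).

Let Ce k : C1 (e k) (de k).
Proof. by apply: C1_derivable => [x|]; [exact: eigen_derivable H k x|exact: eigen_C1 H k]. Qed.

Let ce k : continuous (e k). Proof. exact: C1_continuous (Ce k). Qed.
Let e0 x : 0 < e 0%N x. Proof. exact: eigen_gt0 H x. Qed.
Let e0n x : e 0%N x != 0. Proof. by rewrite gt_eqF. Qed.

Let dr0 k x := e k x * (- (e 0%N x) ^- 2 * de 0%N x) + (e 0%N x)^-1 * de k x.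

Lemma rfun_C1 k : C1 (r k) (dr k).
Proof.
have h : C1 (r k) (dr0 k) := C1_mul (Ce k) (C1_inv (Ce 0) e0n).
by rewrite (C1_derive1 h).
Qed.

(** The Wronskian of [e 0] and [e k]: the density of [nu] clears the denominators of the quotient
    rule. *)
Lemma drfun_eq k x : dr k x * (e 0%N x) ^+ 2 = e 0%N x * de k x - e k x * de 0%N x.
Proof.
have h : C1 (r k) (dr0 k) := C1_mul (Ce k) (C1_inv (Ce 0) e0n).
by rewrite (C1_derive1 h) /dr0; field.
Qed.

Lemma rfun_eq k x : e k x = r k x * e 0%N x.
Proof. by rewrite /rfun divfK. Qed.

Lemma rfun0 x : r 0 x = 1.
Proof. by rewrite /rfun divff. Qed.

Let mem_cont f : continuous f -> measurable_fun setT (f : R -> R).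
Proof. exact: continuous_measurable_fun. Qed.

Lemma real_fun_mem (f : R -> R) : sqi G f -> L2mem (H := L2 G) (real_fun f).
Proof. by move=> hf; apply/L2_memP; split => //; exact: sqi0. Qed.

Lemma test_sqi (M : R) (f : R -> R) : continuous f -> csupp M f -> sqi G f.
Proof.
move=> cf fM; have [B hB] := csupp_bounded cf fM.
have mf := mem_cont cf; split => //.
apply: (integrable_lty measurableT); apply: (@bounded_integrable _ _ _ G _ (B ^+ 2)).
  exact: measurable_funX.
move=> x; rewrite normrX ler_sqr ?nnegrE//; exact: le_trans (hB x).
Qed.

Lemma Cderive_real_fun (f : R -> R) : Cderive (real_fun f) = real_fun (derive1 f).
Proof.
apply/funext => x; apply: Cext; rewrite /Cderive /real_fun !CE//.
exact: derive1_cst.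
Qed.

Lemma test_W12 (M : R) (f df : R -> R) : C1 f df -> csupp M f -> W12 (real_fun f).
Proof.
move=> hf fM; have cf := C1_continuous hf; split.
- exact: C1_loc_abs_continuous hf.
- exact: C1_loc_abs_continuous (C1_cst 0).
- by apply: real_fun_mem; exact: test_sqi cf fM.
rewrite Cderive_real_fun (C1_derive1 hf); apply: real_fun_mem.
by apply: (test_sqi (M := M)); [case: hf|exact: csupp_deriv hf fM].
Qed.

Lemma amu_real (f g : R -> R) : complex.Re (amu mu (real_fun f) (real_fun g)) =
  \int[G]_x (derive1 f x * derive1 g x) +
  cmu mu * \int[G]_(x in `]-oo, 0]) (x ^+ 2 * f x * g x).
Proof.
rewrite /amu !Cderive_real_fun !CE mul0r subr0; congr (_ + _ * _).
  by apply: eq_Rintegral => x _; rewrite /real_fun !CE; ring.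
by apply: eq_Rintegral => x _; rewrite /real_fun !CE; ring.
Qed.

Lemma eigen_test k (M : R) (f df : R -> R) : C1 f df -> csupp M f ->
  \int[G]_x (de k x * df x) + cmu mu * \int[G]_(x in `]-oo, 0]) (x ^+ 2 * e k x * f x) =
  alpha k * \int[G]_x (e k x * f x).
Proof.
move=> hf fM; have [_ mh /(_ _ (test_W12 hf fM))] := eigen_eq H k.
move=> /(congr1 (@complex.Re R)); rewrite amu_real (C1_derive1 hf) => ->.
have me : L2mem (H := L2 G) (real_fun (e k)) by case: (eigen_basis H).
have mf : L2mem (H := L2 G) (real_fun f).
  by apply/real_fun_mem/(test_sqi (M := M)) => //; exact: C1_continuous hf.
rewrite (dotZl (L2_hilbert G))// !CE mul0r subr0; congr (_ * _).
by apply: eq_Rintegral => x _; rewrite /real_fun !CE; ring.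
Qed.

Lemma csuppM (M : R) (f g : R -> R) : csupp M f -> csupp M (fun x => f x * g x).
Proof. by move=> h x /h ->; rewrite mul0r. Qed.

(* Both sides are [a_mu[e_k, g e_0] - a_mu[e_0, g e_k]]: the potential terms
   cancel, and so do the products [g e_k' e_0']. *)
Lemma ground_state_identity k (M : R) (g dg : R -> R) : C1 g dg -> csupp M g ->
  \int[G]_x (dg x * dr k x * (e 0%N x) ^+ 2) =
  lam alpha k * \int[G]_x (g x * r k x * (e 0%N x) ^+ 2).
Proof.
move=> hg gM; have cg := C1_continuous hg; have cdg : continuous dg by case: hg.
have cde j : continuous (de j) by case: (Ce j).
have cM (f h : R -> R) : continuous f -> continuous h -> continuous (fun x => f x * h x).
  by move=> cf ch x; apply: cvgM; [exact: cf|exact: ch].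
have cD (f h : R -> R) : continuous f -> continuous h -> continuous (fun x => f x + h x).
  by move=> cf ch x; apply: cvgD; [exact: cf|exact: ch].
have h1 := C1_mul hg (Ce 0); have h2 := C1_mul hg (Ce k).
have E1 := eigen_test k h1 (csuppM _ gM); have E2 := eigen_test 0 h2 (csuppM _ gM).
have dgM := csupp_deriv hg gM.
have int f : continuous f -> csupp M f -> G.-integrable setT (EFin \o f).
  move=> cf fM; have [B hB] := csupp_bounded cf fM.
  by apply: (@bounded_integrable _ _ _ G _ B) => //; exact: mem_cont.
have I1 : G.-integrable setT (EFin \o (fun x => de k x * (g x * de 0%N x + e 0%N x * dg x))).
  apply: int;
    first exact: (cM _ _ (cde k) (cD _ _ (cM _ _ cg (cde 0%N)) (cM _ _ (@ce 0%N) cdg))).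
  by move=> x xM; rewrite (gM x xM) (dgM x xM); ring.
have I2 : G.-integrable setT (EFin \o (fun x => de 0%N x * (g x * de k x + e k x * dg x))).
  apply: int;
    first exact: (cM _ _ (cde 0%N) (cD _ _ (cM _ _ cg (cde k)) (cM _ _ (@ce k) cdg))).
  by move=> x xM; rewrite (gM x xM) (dgM x xM); ring.
have -> : \int[G]_x (dg x * dr k x * (e 0%N x) ^+ 2) =
    \int[G]_x (de k x * (g x * de 0%N x + e 0%N x * dg x)) -
    \int[G]_x (de 0%N x * (g x * de k x + e k x * dg x)).
  rewrite -RintegralB//; apply: eq_Rintegral => x _.
  by rewrite -mulrA drfun_eq; ring.
have E3 : \int[G]_(x in `]-oo, 0]) (x ^+ 2 * e k x * (g x * e 0%N x)) =
    \int[G]_(x in `]-oo, 0]) (x ^+ 2 * e 0%N x * (g x * e k x)).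
  by apply: eq_Rintegral => x _; ring.
have E4 : \int[G]_x (e k x * (g x * e 0%N x)) = \int[G]_x (g x * r k x * (e 0%N x) ^+ 2).
  by apply: eq_Rintegral => x _; rewrite rfun_eq; ring.
have E5 : \int[G]_x (e 0%N x * (g x * e k x)) = \int[G]_x (g x * r k x * (e 0%N x) ^+ 2).
  by apply: eq_Rintegral => x _; rewrite [e k x]rfun_eq; ring.
rewrite E3 E4 in E1; rewrite E5 in E2.
rewrite /lam mulrBl -E1 -E2; ring.
Qed.

End Eigensystem.

(** * Orthogonality, finite energy and completeness of the r_k under nu *)

Section GroundLaw.
Variables (R : realType) (mu : R) (alpha : nat -> R) (e : nat -> R -> R).
Hypothesis H : eigensystem mu alpha e.
Variable nu : probability (measurableTypeR R) R.
Hypothesis nuE : forall A, measurable A -> nu A = ground_law e A.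
Local Notation G := (gauss R).
Local Notation r := (rfun e).
Local Notation dr k := (derive1 (rfun e k)).

Let ek_cont k : continuous (e k).
Proof.
apply: C1_continuous; apply: C1_derivable => [x|].
- exact: eigen_derivable H k x.
- exact: eigen_C1 H k.
Qed.

Let me k : measurable_fun setT (e k).
Proof. by apply: continuous_measurable_fun; exact: ek_cont. Qed.

Let Cr k := rfun_C1 H k.
Let cr k : continuous (r k). Proof. exact: C1_continuous (Cr k). Qed.
Let cdr k : continuous (dr k). Proof. by case: (Cr k). Qed.
Let mr k : measurable_fun setT (r k).
Proof. by apply: continuous_measurable_fun; exact: cr. Qed.
Let mdr k : measurable_fun setT (dr k).
Proof. by apply: continuous_measurable_fun; exact: cdr. Qed.

Let mw : measurable_fun setT (fun x => (e 0%N x) ^+ 2).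
Proof. exact: measurable_funX. Qed.
Let w0 x : 0 <= (e 0%N x) ^+ 2. Proof. exact: sqr_ge0. Qed.

Lemma eigen_sqi k : sqi G (e k).
Proof.
by case: (eigen_basis H) => /(_ k) /L2_memP[].
Qed.

Lemma eigen_orth k l : rip G (e k) (e l) = (k == l)%:R.
Proof.
case: (eigen_basis H) => _ /(_ k l) /(congr1 (@complex.Re R)) h _.
transitivity (complex.Re ((k == l)%:R : R[i])); last by case: (k == l).
by rewrite -h; apply: eq_Rintegral => x _; rewrite /real_fun !CE; ring.
Qed.

Let nu_int (f : R -> R) : measurable_fun setT f ->
  G.-integrable setT (fun x => (f x * (e 0%N x) ^+ 2)%:E) ->
  nu.-integrable setT (EFin \o f) /\
  \int[nu]_x f x = \int[G]_x (f x * (e 0%N x) ^+ 2).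
Proof.
exact: (@density_integrable _ (measurableTypeR R) R G nu _ mw w0 nuE).
Qed.

(** Multiplication by [e 0] maps L^2(nu) isometrically into L^2(gauss) and sends [r k] to [e k], so
    orthonormality is inherited from the eigenfunctions. *)
Lemma rfun_orth k l : rip nu (r k) (r l) = (k == l)%:R.
Proof.
rewrite -eigen_orth /rip.
have E x : r k x * r l x * (e 0%N x) ^+ 2 = e k x * e l x.
  by rewrite (rfun_eq H k) (rfun_eq H l); ring.
have fi : G.-integrable setT (fun x => (r k x * r l x * (e 0%N x) ^+ 2)%:E).
  have := sqi_integrable (eigen_sqi k) (eigen_sqi l).
  by apply: eq_integrable => // x _ /=; rewrite E.
have [_ ->] := nu_int (measurable_funM (mr k) (mr l)) fi.
by apply: eq_Rintegral => x _; rewrite E.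
Qed.

Lemma rfun_sqi k : sqi nu (r k).
Proof.
split; first exact: mr.
have [_ h] := eigen_sqi k; apply: (le_lt_trans _ h).
rewrite [leLHS](_ : _ = \int[G]_x (((r k x) ^+ 2)%:E * ((e 0%N x) ^+ 2)%:E))%E.
  rewrite le_eqVlt; apply/orP; left; apply/eqP; apply: eq_integral => x _.
  by rewrite -EFinM [in RHS](rfun_eq H k) [in RHS]exprMn.
have f0 x : (0 <= ((r k x) ^+ 2)%:E)%E by rewrite lee_fin sqr_ge0.
exact: (@density_ge0_integral _ (measurableTypeR R) R G nu _ mw w0 nuE _
  (measurable_sqr (mr k)) f0).
Qed.

Lemma lam_ge0 k : 0 <= lam alpha k.
Proof.
rewrite /lam subr_ge0; elim: k => // k; move/le_trans; apply; apply/ltW.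
exact: eigen_lt H k.
Qed.

Lemma lam0 : lam alpha 0 = 0.
Proof. exact: subrr. Qed.

Let int_csupp (M : R) (f : R -> R) : continuous f -> csupp M f ->
  nu.-integrable setT (EFin \o f).
Proof.
move=> cf fM; have [B hB] := csupp_bounded cf fM.
apply: (@bounded_integrable _ _ _ nu _ B) => //; exact: continuous_measurable_fun.
Qed.

Let weak_eigen k (M : R) (g dg : R -> R) : C1 g dg -> csupp M g ->
  \int[nu]_x (dg x * dr k x) = lam alpha k * \int[nu]_x (g x * r k x).
Proof.
move=> hg gM; have cg := C1_continuous hg; have cdg : continuous dg by case: hg.
have dgM := csupp_deriv hg gM.
have cM (f h : R -> R) : continuous f -> continuous h -> continuous (fun x => f x * h x).
  by move=> cf ch x; apply: cvgM; [exact: cf|exact: ch].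
have intw (f : R -> R) : continuous f -> csupp M f ->
    nu.-integrable setT (EFin \o f) /\
    \int[nu]_x f x = \int[G]_x (f x * (e 0%N x) ^+ 2).
  move=> cf fM; apply: nu_int; first exact: continuous_measurable_fun.
  have ch : continuous (fun x => f x * (e 0%N x * e 0%N x)).
    exact: (cM _ _ cf (cM _ _ (@ek_cont 0%N) (@ek_cont 0%N))).
  have hM : csupp M (fun x => f x * (e 0%N x * e 0%N x)).
    by move=> x xM; rewrite fM// mul0r.
  have [B hB] := csupp_bounded ch hM.
  apply: (@bounded_integrable _ _ _ G _ B).
    by apply: measurable_funM => //; exact: continuous_measurable_fun.
  by move=> x; rewrite expr2.
have [_ ->] := intw _ (cM _ _ cdg (@cdr k)) (csuppM _ dgM).
have [_ ->] := intw _ (cM _ _ cg (@cr k)) (csuppM _ gM).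
exact: (ground_state_identity H k hg gM).
Qed.

Let c_ (n : nat) : R := n.+1%:R^-1.
Let c_gt0 n : 0 < c_ n. Proof. by rewrite invr_gt0. Qed.
Let c_le1 n : c_ n <= 1. Proof. by rewrite invf_le1// ler1n. Qed.
Let ccut n : continuous (cutoff (c_ n)). Proof. exact: C1_continuous (cutoff_C1 _). Qed.
Let dcut16 n x : (dcutoff (c_ n) x) ^+ 2 <= 16.
Proof.
have h : `|dcutoff (c_ n) x| <= 4.
  apply: le_trans (dcutoff_le x (c_gt0 n)) _; have := c_le1 n; lra.
rewrite -real_normK ?num_real//; have := normr_ge0 (dcutoff (c_ n) x); nra.
Qed.

(* Caccioppoli: test the weak equation with [chi^2 r_k] and use
   [(chi r_k' + 2 r_k chi')^2 >= 0]. *)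
Let cutoff_energy k n :
  (\int[nu]_x ((cutoff (c_ n) x * dr k x) ^+ 2)%:E <= (2 * lam alpha k + 64)%:E)%E.
Proof.
set chi := cutoff (c_ n); set dchi := dcutoff (c_ n).
have hchi : C1 chi dchi := cutoff_C1 (c_ n).
have chiM : csupp (c_ n)^-1 chi := cutoff_csupp (c_gt0 n).
have cM (f h : R -> R) : continuous f -> continuous h -> continuous (fun x => f x * h x).
  by move=> cf ch x; apply: cvgM; [exact: cf|exact: ch].
have h1 := C1_mul hchi (C1_mul hchi (Cr k)).
have gM : csupp (c_ n)^-1 (fun x => chi x * (chi x * r k x)) := csuppM _ chiM.
have W := weak_eigen k h1 gM.
have irr := sqi_integrable (rfun_sqi k) (rfun_sqi k).
have mchi : measurable_fun setT chi by apply: continuous_measurable_fun; exact: ccut.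
have i1 : nu.-integrable setT (EFin \o (fun x => (chi x * dr k x) ^+ 2)).
  apply: (@int_csupp (c_ n)^-1).
    rewrite (_ : (fun x => _) = fun x => (chi x * dr k x) * (chi x * dr k x)).
      exact: (cM _ _ (cM _ _ (@ccut n) (@cdr k)) (cM _ _ (@ccut n) (@cdr k))).
    by apply/funext => x; rewrite expr2.
  by move=> x /chiM ->; rewrite mul0r expr0n.
have i2 : nu.-integrable setT (EFin \o (fun x => (chi x * (chi x * dr k x + r k x * dchi x) +
    chi x * r k x * dchi x) * dr k x)).
  apply: (@int_csupp (c_ n)^-1).
    have cdg : continuous (fun x => chi x * (chi x * dr k x + r k x * dchi x) +
      chi x * r k x * dchi x) by case: h1.
    exact: (cM _ _ cdg (@cdr k)).
  by move=> x /chiM ->; ring.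
have i3 : nu.-integrable setT (EFin \o (fun x => chi x * (chi x * r k x) * r k x)).
  apply: (@int_csupp (c_ n)^-1).
    exact: (cM _ _ (cM _ _ (@ccut n) (cM _ _ (@ccut n) (@cr k))) (@cr k)).
  by move=> x /chiM ->; ring.
have i2' := integrableZl measurableT 2 i2.
have irr' := integrableZl measurableT 64 irr.
have b1 : \int[nu]_x ((chi x * dr k x) ^+ 2) <=
    \int[nu]_x (2 * ((chi x * (chi x * dr k x + r k x * dchi x) +
      chi x * r k x * dchi x) * dr k x) + 64 * (r k x * r k x)).
  apply: le_Rintegral => //; first exact: (integrableD measurableT i2' irr').
  (* The square gives [chi^2 r'^2 <= 2 (chi^2 r)' r' + 4 chi'^2 r^2], and [chi'^2 <= 16] turns the
     last factor into the constant 64. *)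
  move=> x _; have := sqr_ge0 (chi x * dr k x + 2 * (r k x * dchi x)).
  have := dcut16 n x; rewrite -/dchi => h16.
  have : (dchi x) ^+ 2 * (r k x) ^+ 2 <= 16 * (r k x) ^+ 2.
    by rewrite ler_wpM2r// sqr_ge0.
  nra.
have b2 : \int[nu]_x (chi x * (chi x * r k x) * r k x) <= 1.
  have <- : rip nu (r k) (r k) = 1 by rewrite rfun_orth eqxx.
  apply: le_Rintegral => // x _.
  have := cutoff_ge0 (c_ n) x; have := cutoff_le1 (c_ n) x; rewrite -/chi => h h'.
  have : chi x * chi x <= 1 by nra.
  have := sqr_ge0 (r k x); nra.
have fi1 := integrable_fin_num measurableT i1.
rewrite -(fineK fi1) lee_fin; apply: le_trans b1 _.
rewrite RintegralD// RintegralZl// RintegralZl// -/(rip nu (r k) (r k)) rfun_orth eqxx.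
rewrite [X in 2 * X](W) mulr1 lerD2r ler_wpM2l//.
by rewrite -[leRHS]mulr1 ler_wpM2l// lam_ge0.
Qed.

(** The bound of [cutoff_energy] does not depend on [n] and the cutoffs tend to 1, so Fatou's lemma
    applies. *)
Lemma drfun_sqi k : sqi nu (dr k).
Proof.
split; first exact: mdr.
apply: (@le_lt_trans _ _ (2 * lam alpha k + 64)%:E); last by rewrite ltry.
apply: (@fatou_bound _ (measurableTypeR R) R nu setT
  (fun n x => ((cutoff (c_ n) x * dr k x) ^+ 2)%:E)
  (fun x => ((dr k x) ^+ 2)%:E) _ 0 measurableT); last exact: (fun n _ => cutoff_energy k n).
- move=> n; apply: measurable_sqr; apply: measurable_funM; last exact: mdr.
  by apply: continuous_measurable_fun; exact: ccut.
- by move=> n x _; rewrite lee_fin sqr_ge0.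
move=> x _; apply: cvg_EFin; first exact: nearW.
have h : (cutoff (c_ n) x * dr k x) @[n --> \oo] --> 1 * dr k x.
  by apply: cvgMl; exact: cutoff_cvg.
rewrite mul1r in h; rewrite expr2.
by under eq_cvg do rewrite /= expr2; exact: cvgM.
Qed.

(** Test the weak equation of [r k] with a cutoff times [r l] and remove the cutoff: the left side
    is dominated by [|r_l' r_k'| + 4 |r_l r_k'|], integrable because the derivatives are now known
    to be square integrable. *)
Lemma drfun_orth k l : rip nu (dr k) (dr l) = lam alpha k *+ (k == l).
Proof.
pose g n x := cutoff (c_ n) x * r l x.
pose dg n x := cutoff (c_ n) x * dr l x + r l x * dcutoff (c_ n) x.
have hg n : C1 (g n) (dg n) := C1_mul (cutoff_C1 (c_ n)) (Cr l).
have gM n : csupp (c_ n)^-1 (g n) := csuppM _ (cutoff_csupp (c_gt0 n)).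
have W n := weak_eigen k (hg n) (gM n).
have mg n : measurable_fun setT (g n).
  by apply: continuous_measurable_fun; exact: C1_continuous (hg n).
have mdg n : measurable_fun setT (dg n).
  by apply: continuous_measurable_fun; case: (hg n).
have cut1 n x : `|cutoff (c_ n) x| <= 1.
  by rewrite ger0_norm ?cutoff_le1 ?cutoff_ge0.
have dcut4 n x : `|dcutoff (c_ n) x| <= 4.
  apply: le_trans (dcutoff_le x (c_gt0 n)) _; have := c_le1 n; lra.
have irr := sqi_integrable (rfun_sqi l) (rfun_sqi k).
have idd := sqi_integrable (drfun_sqi l) (drfun_sqi k).
have ird := sqi_integrable (rfun_sqi l) (drfun_sqi k).
have nint (f : R -> R) : nu.-integrable setT (EFin \o f) ->
    nu.-integrable setT (EFin \o (fun x => `|f x|)).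
  by move=> /integrable_abse.
have lim1 : \int[nu]_x (dg n x * dr k x) @[n --> \oo] --> \int[nu]_x (dr l x * dr k x).
  have mdgr n := measurable_funM (mdg n) (mdr k).
  have mdd := measurable_funM (mdr l) (mdr k).
  have bi : nu.-integrable setT
      (EFin \o (fun x => `|dr l x * dr k x| + 4 * `|r l x * dr k x|)).
    exact: (integrableD measurableT (nint _ idd) (integrableZl measurableT 4 (nint _ ird))).
  have ptw x : dg n x * dr k x @[n --> \oo] --> dr l x * dr k x.
    apply: cvgMl; rewrite -[X in _ --> X](_ : 1 * dr l x + r l x * 0 = _); last by ring.
    by apply: cvgD; [apply: cvgMl; exact: cutoff_cvg|apply: cvgMr; exact: dcutoff_cvg].
  have bd n x : `|dg n x * dr k x| <= `|dr l x * dr k x| + 4 * `|r l x * dr k x|.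
    rewrite /dg mulrDl (le_trans (ler_normD _ _))// lerD//.
      by rewrite -mulrA normrM -[leRHS]mul1r ler_wpM2r.
    by rewrite [r l x * _]mulrC -mulrA normrM ler_wpM2r.
  by have [] := @Rintegral_dominated _ (measurableTypeR R) R nu _ _ _ mdgr mdd ptw bi bd.
have lim2 : \int[nu]_x (g n x * r k x) @[n --> \oo] --> \int[nu]_x (r l x * r k x).
  have mgr n := measurable_funM (mg n) (mr k).
  have mrr := measurable_funM (mr l) (mr k).
  have ptw x : g n x * r k x @[n --> \oo] --> r l x * r k x.
    apply: cvgMl; rewrite -[X in _ --> X]mul1r.
    by apply: cvgMl; exact: cutoff_cvg.
  have bd n x : `|g n x * r k x| <= `|r l x * r k x|.
    by rewrite /g -mulrA normrM -[leRHS]mul1r ler_wpM2r.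
  by have [] := @Rintegral_dominated _ (measurableTypeR R) R nu _ _ _ mgr mrr ptw (nint _ irr) bd.
have lim3 : \int[nu]_x (dg n x * dr k x) @[n --> \oo] -->
    lam alpha k * \int[nu]_x (r l x * r k x).
  by under eq_cvg do rewrite W; apply: cvgMr.
have := cvg_unique (@Rhausdorff R) lim1 lim3.
rewrite -/(rip nu (dr l) (dr k)) -/(rip nu (r l) (r k)) ripC => ->.
by rewrite rfun_orth eq_sym mulr_natr.
Qed.

(** Approximate [f e_0] in L^2(gauss) by the eigenfunctions and divide by [e 0]. As [f] and the
    [r k] are real, keeping only the real parts of the coefficients does not increase the error. *)
Lemma rfun_dense (f : R -> R) : sqi nu f -> forall eps : R, 0 < eps ->
  exists (S : {fset nat}) (c : nat -> R),
    (\int[nu]_x ((f x - \sum_(k <- S) c k * r k x) ^+ 2)%:E < eps%:E)%E.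
Proof.
move=> [mf fi] eps eps0.
have fe : sqi G (fun x => f x * e 0%N x).
  split; first by apply: measurable_funM => //; exact: me.
  apply: (le_lt_trans _ fi);
    rewrite [leRHS](_ : _ = \int[G]_x (((f x) ^+ 2)%:E * ((e 0%N x) ^+ 2)%:E))%E.
    rewrite le_eqVlt; apply/orP; left; apply/eqP; apply: eq_integral => x _.
    by rewrite -EFinM exprMn.
  have f0 x : (0 <= ((f x) ^+ 2)%:E)%E by rewrite lee_fin sqr_ge0.
  exact: (@density_ge0_integral _ (measurableTypeR R) R G nu _ mw w0 nuE _
    (measurable_sqr mf) f0).
case: (eigen_basis H) => mb _ /(_ _ (real_fun_mem fe) _ eps0)[S [c hS]].
exists S, (fun k => complex.Re (c k)); apply: le_lt_trans hS.
pose h x := f x - \sum_(k <- S) complex.Re (c k) * r k x.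
have mh : measurable_fun setT h.
  apply: measurable_funB => //; apply: measurable_sum => k.
  by apply: measurable_funM => //; exact: mr.
have h0 x : (0 <= ((h x) ^+ 2)%:E)%E by rewrite lee_fin sqr_ge0.
rewrite [leLHS](_ : _ = \int[G]_x (((h x) ^+ 2)%:E * ((e 0%N x) ^+ 2)%:E))%E; last first.
  exact: (@density_ge0_integral _ (measurableTypeR R) R G nu _ mw w0 nuE _
    (measurable_sqr mh) h0).
pose z : L2fun (L2 G) := real_fun (fun x => f x * e 0%N x) - \sum_(k <- S) c k *: real_fun (e k).
have mz : L2mem z.
  apply: (memB (L2_hilbert G)); first exact: real_fun_mem.
  by apply: (mem_sum (L2_hilbert G)) => k; apply: (memZ (L2_hilbert G)).
have Rez x : complex.Re (z x) = h x * e 0%N x.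
  rewrite /z !fctE Re_add Re_opp fct_sumE Re_sum mulrBl mulr_suml; congr (_ - _).
  apply: eq_bigr => k _; rewrite [(c k *: _) x]/(c k * _) !CE mulr0 subr0.
  by rewrite -mulrA -(rfun_eq H).
have mCz : measurable_fun setT (fun x => (Cabs2 (z x))%:E).
  case: mz => -[mrz miz] _; apply/measurable_EFinP; apply: measurable_funD.
    exact: measurable_funX.
  exact: measurable_funX.
apply: ge0_le_integral => //.
- by move=> x _; rewrite -EFinM lee_fin; apply: mulr_ge0; exact: sqr_ge0.
- by apply: emeasurable_funM; apply: measurable_sqr => //; exact: me.
- move=> x _; rewrite -EFinM lee_fin /Cabs2 Rez -exprMn lerDl; exact: sqr_ge0.
Qed.

End GroundLaw.

(** * The product basis *)

Section Adherence.
Variables (R : realType) (H : L2type R) (hH : hilbert H).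
Variables (I : choiceType) (w : I -> L2fun H).
Hypothesis mw : forall i, L2mem (w i).

(** The closed linear span of the family [w]. *)
Definition adherent (x : L2fun H) : Prop := L2mem x /\
  forall eps : R, 0 < eps -> exists (S : {fset I}) c, nq (x - lin_comb w S c) < eps.

Lemma adherent_basis i : adherent (w i).
Proof.
split => // eps e0; exists [fset i]%fset, (fun=> 1).
by rewrite /lin_comb big_seq_fset1 scale1r subrr /nq (dot0l hH)//; exact: hil0.
Qed.

Lemma adherent_lin a x y : adherent x -> adherent y -> adherent (a *: x + y).
Proof.
move=> [mx ax] [my ay]; split; first exact: (hil_lin hH).
move=> eps e0; have a0 := Cabs2_ge0 a.
(* Scaling by [a] and [nqD_le] multiply the error of [x] by [2 |a|^2]; this denominator keeps the
   result below [eps / 2], also for [a = 0]. *)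
have p : 0 < 4 * Cabs2 a + 1 by lra.
have [|S [c hS]] := ax (eps / (4 * Cabs2 a + 1)); first by rewrite divr_gt0.
have [|S' [c' hS']] := ay (eps / 4); first by rewrite divr_gt0.
pose b i := a * (if i \in S then c i else 0) + (if i \in S' then c' i else 0).
exists (S `|` S')%fset, b.
have -> : a *: x + y - lin_comb w (S `|` S')%fset b =
    a *: (x - lin_comb w S c) + (y - lin_comb w S' c').
  rewrite (lin_comb_incl w c (fsubsetUl S S')) (lin_comb_incl w c' (fsubsetUr S S')).
  rewrite scalerBr addrACA; congr (_ + _); rewrite -opprD; congr (- _).
  rewrite scaler_sumr -big_split; apply: eq_bigr => i _.
  by rewrite scalerDl scalerA.
have m1 := memB hH mx (lin_comb_mem hH mw S c).
have m2 := memB hH my (lin_comb_mem hH mw S' c').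
apply: le_lt_trans (nqD_le hH (memZ hH a m1) m2) _; rewrite (nqZ hH)//.
have n0 := nq_ge0 hH m1; rewrite ltr_pdivlMr in hS => //; nra.
Qed.

Lemma adherent0 : adherent 0.
Proof.
split; first exact: hil0.
move=> eps e0; exists fset0, (fun=> 0).
by rewrite /lin_comb big_seq_fset0 subrr /nq (dot0l hH)//; exact: hil0.
Qed.

Lemma adherentD x y : adherent x -> adherent y -> adherent (x + y).
Proof. by move=> ax ay; rewrite -[x]scale1r; exact: adherent_lin. Qed.

Lemma adherentZ a x : adherent x -> adherent (a *: x).
Proof. by move=> ax; rewrite -[_ *: _]addr0; apply: adherent_lin => //; exact: adherent0. Qed.

Lemma adherent_sum (J : Type) (s : seq J) (f : J -> L2fun H) :
  (forall j, adherent (f j)) -> adherent (\sum_(j <- s) f j).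
Proof.
move=> h; elim: s => [|j s IH]; first by rewrite big_nil; exact: adherent0.
by rewrite big_cons; exact: adherentD.
Qed.

Lemma adherent_lim x : L2mem x ->
  (forall eps : R, 0 < eps -> exists2 y, adherent y & nq (x - y) < eps) -> adherent x.
Proof.
move=> mx h; split => // eps e0.
have [|y [my ay] xy] := h (eps / 4); first by rewrite divr_gt0.
have [|S [c hS]] := ay (eps / 4); first by rewrite divr_gt0.
exists S, c; apply: le_lt_trans (nqB3_le hH mx my (lin_comb_mem hH mw S c)) _; lra.
Qed.

End Adherence.

(** * Density in L^2(P) from a generating pi-system *)

Section L2Density.
Context d (T : measurableType d) (R : realType) (P : probability T R).
Variables (I : choiceType) (w : I -> L2fun (L2 P)).
Hypothesis mw : forall i, L2mem (w i).
Local Notation hH := (L2_hilbert P).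
Local Notation adh := (adherent w).

Lemma L2mem_real_fun (f : T -> R) : sqi P f -> L2mem (H := L2 P) (real_fun f).
Proof. by move=> hf; apply/L2_memP; split => //; exact: sqi0. Qed.

Lemma nq_real_fun (f : T -> R) : nq (real_fun f : L2fun (L2 P)) = \int[P]_x ((f x) ^+ 2).
Proof. by apply: eq_Rintegral => x _; rewrite /real_fun !CE; ring. Qed.

Lemma real_funD (f g : T -> R) : (real_fun f : L2fun (L2 P)) + real_fun g =
  real_fun (fun x => f x + g x).
Proof. by apply/funext => x; rewrite fctE /real_fun CcstD. Qed.

Lemma real_funB (f g : T -> R) : (real_fun f : L2fun (L2 P)) - real_fun g =
  real_fun (fun x => f x - g x).
Proof. by apply/funext => x; rewrite !fctE /real_fun CcstB. Qed.

Lemma adherent_dominated (f_ : nat -> T -> R) (f g : T -> R) :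
  (forall n, adh (real_fun (f_ n))) -> measurable_fun setT f ->
  (forall x, f_ n x @[n --> \oo] --> f x) ->
  P.-integrable setT (EFin \o g) -> (forall n x, (f x - f_ n x) ^+ 2 <= g x) ->
  sqi P f -> adh (real_fun f).
Proof.
move=> hf_ mf cf ig bg sf; apply: (adherent_lim hH mw) => [|eps e0].
  exact: L2mem_real_fun.
have mf_ n : measurable_fun setT (f_ n) by case: (hf_ n) => /L2_memP[[]].
have c0 x : (f x - f_ n x) ^+ 2 @[n --> \oo] --> (0 : R).
  have h : (f x - f_ n x) @[n --> \oo] --> f x - f x.
    by apply: cvgB; [exact: cvg_cst|exact: cf].
  rewrite subrr in h; rewrite -[X in _ --> X](mulr0 (0 : R)).
  by under eq_cvg do rewrite /= expr2; exact: cvgM.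
have mh n : measurable_fun setT (fun x => (f x - f_ n x) ^+ 2).
  by apply: measurable_funX; exact: measurable_funB.
have bd n x : `|(f x - f_ n x) ^+ 2| <= g x by rewrite ger0_norm ?sqr_ge0.
have [_] := Rintegral_dominated mh (@measurable_cst _ _ _ _ _ _) c0 ig bd.
rewrite Rintegral_cst// mul0r => /cvgr0Pnorm_lt/(_ _ e0)[N _ /(_ N (leqnn N)) hN].
exists (real_fun (f_ N)) => //.
by rewrite real_funB nq_real_fun; apply: le_lt_trans hN; exact: ler_norm.
Qed.

Lemma cst_integrable (a : R) : P.-integrable setT (EFin \o (fun=> a)).
Proof. exact: finite_measure_integrable_cst. Qed.

Lemma sqi_bounded (f : T -> R) (B : R) : measurable_fun setT f ->
  (forall x, `|f x| <= B) -> sqi P f.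
Proof.
move=> mf fB; split => //; apply: (integrable_lty measurableT).
apply: (@bounded_integrable _ _ _ P _ (B ^+ 2)); first exact: measurable_funX.
move=> x; rewrite normrX ler_sqr ?nnegrE//; exact: le_trans (fB x).
Qed.

Lemma sqi_indic (A : set T) : measurable A -> sqi P (\1_A).
Proof.
move=> mA; apply: (sqi_bounded (B := 1)); first exact: measurable_indic.
by move=> x; rewrite indicE; case: (_ \in _); rewrite ?normr1// normr0.
Qed.

Section PiSystem.
Variable G : set (set T).
Hypothesis GE : @measurable _ T = <<s G >>.
Hypothesis GI : setI_closed G.
Hypothesis G1 : adh (real_fun (fun=> 1)).
Hypothesis GA : forall A, G A -> adh (real_fun (\1_A)).

(** Sets whose indicator lies in the closed span form a Dynkin system: complements through
    [1 - \1_A], disjoint unions through finite sums of indicators and dominated convergence. *)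
Lemma adherent_indic (A : set T) : measurable A -> adh (real_fun (\1_A)).
Proof.
rewrite GE; apply: (dynkin_induction (P := fun A => adh (real_fun (\1_A))) GE GI).
- rewrite (_ : \1_setT = fun=> 1)//; apply/funext => x.
  by rewrite indicE mem_set.
- exact: GA.
- move=> S mS aS; have := adherent_lin hH mw (-1) aS G1.
  rewrite scaleN1r addrC real_funB; congr (adherent (H := L2 P) _ (real_fun _));
    apply/funext => x.
  by rewrite !indicE in_setC; case: (_ \in _); rewrite ?subrr ?subr0.
move=> F mF tF aF.
pose V n : set T := \big[setU/set0]_(k < n) F k.
have mV n : measurable (V n) by exact: bigsetU_measurable.
have aV n : adh (real_fun (\1_(V n))).
  elim: n => [|n IH].
    rewrite /V big_ord0; have := adherent0 hH w.
    congr (adherent (H := L2 P) _ _); apply/funext => x.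
    by rewrite /real_fun indicE in_set0.
  have := adherentD hH mw IH (aF n); rewrite real_funD.
  congr (adherent (H := L2 P) _ (real_fun _)); apply/funext => x.
  rewrite /V big_ord_recr/= -/(V n) !indicE in_setU.
  have [xV|xV] := boolP (x \in V n); last by rewrite add0r.
  have [xF|xF] := boolP (x \in F n); last by rewrite addr0.
  exfalso; move: xV xF; rewrite !inE /V -bigcup_mkord => -[k /= kn Fk] Fn.
  move/trivIsetP : tF => /(_ k n Logic.I Logic.I); rewrite lt_eqF// => /(_ isT) /seteqP[+ _].
  by move=> /(_ x); apply.
have mU : measurable (\bigcup_k F k) by exact: bigcupT_measurable.
apply: (adherent_dominated (f_ := fun n => \1_(V n)) (g := fun=> 1)).
- exact: aV.
- exact: measurable_indic.
- move=> x; have [[k _ Fk]|nF] := pselect ((\bigcup_k F k) x).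
    apply: cvg_near_cst; exists k.+1 => // n /= kn.
    rewrite !indicE !mem_set//; first by exists k.
    by rewrite /V -bigcup_mkord; exists k.
  apply: cvg_near_cst; exists 0%N => // n _.
  rewrite !indicE !memNset// => h; apply: nF; move: h.
  by rewrite /V -bigcup_mkord => -[j _ Fj]; exists j.
- exact: cst_integrable.
- by move=> n x; rewrite !indicE; do 2 case: (_ \in _);
  rewrite ?subrr ?subr0 ?sub0r ?sqrrN ?expr0n ?expr1n.
- exact: sqi_indic.
Qed.

Import HBNNSimple.

Lemma adherent_nnsfun (f : {nnsfun T >-> R}) : adh (real_fun f).
Proof.
have -> : real_fun f = \sum_(y <- fset_set (range f))
    Ccst y *: (real_fun (\1_(f @^-1` [set y])) : L2fun (L2 P)).
  apply/funext => x; rewrite fct_sumE /real_fun fimfunE fsbig_finite//= Ccst_sum.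
  by apply: eq_bigr => y _; rewrite CcstM.
apply: (adherent_sum hH mw) => y; apply: (adherentZ hH mw); exact: adherent_indic.
Qed.

Lemma adherent_nonneg (f : T -> R) : (forall x, 0 <= f x) -> sqi P f -> adh (real_fun f).
Proof.
move=> f0 sf; have [mf f2] := sf.
have mEf : measurable_fun setT (EFin \o f) by exact/measurable_EFinP.
pose f_ := nnsfun_approx measurableT mEf.
have fc x : (f_ n x)%:E @[n --> \oo] --> (f x)%:E.
  by apply: cvg_nnsfun_approx => // y _; rewrite lee_fin.
have nd x a b : (a <= b)%N -> f_ a x <= f_ b x.
  by move=> ab; exact/lefP/nd_nnsfun_approx.
have fc' x : f_ n x @[n --> \oo] --> f x by exact: fine_cvg (fc x).
have fle n x : f_ n x <= f x.
  have := nondecreasing_cvgn_le (fun a b => nd x a b) (cvgP _ (fc' x)) n.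
  by rewrite (cvg_lim _ (fc' x)).
apply: (adherent_dominated (f_ := fun n => f_ n : T -> R) (g := fun x => f x * f x)).
- by move=> n; exact: adherent_nnsfun.
- exact: mf.
- exact: fc'.
- exact: sqi_integrable.
- move=> n x; have h1 := fle n x; have h2 : 0 <= f_ n x by [].
  by have h3 := f0 x; rewrite expr2; apply: ler_pM; lra.
- exact: sf.
Qed.

Lemma adherent_real (f : T -> R) : sqi P f -> adh (real_fun f).
Proof.
move=> sf; have [mf f2] := sf.
have part (g : T -> R) : measurable_fun setT g -> (forall x, 0 <= g x) ->
    (forall x, g x <= `|f x|) -> adh (real_fun g).
  move=> mg g0 gf; apply: adherent_nonneg => //; split => //.
  apply: le_lt_trans f2; apply: ge0_le_integral => //.
  - by move=> x _; rewrite lee_fin sqr_ge0.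
  - exact: measurable_sqr.
  - exact: measurable_sqr.
  move=> x _; rewrite lee_fin -[leRHS]real_normK ?num_real//.
  by rewrite ler_sqr ?nnegrE.
have h1 : adh (real_fun (fun x => (`|f x| + f x) / 2)).
  apply: part.
  - by apply: measurable_funM => //; apply: measurable_funD => //; exact: measurableT_comp.
  - by move=> x; rewrite divr_ge0//; have := ler_norm (- f x); rewrite normrN; lra.
  - by move=> x; have := ler_norm (f x); lra.
have h2 : adh (real_fun (fun x => (`|f x| - f x) / 2)).
  apply: part.
  - by apply: measurable_funM => //; apply: measurable_funB => //; exact: measurableT_comp.
  - by move=> x; rewrite divr_ge0//; have := ler_norm (f x); lra.
  - by move=> x; have := ler_norm (- f x); rewrite normrN; lra.
have := adherent_lin hH mw (-1) h2 h1; rewrite scaleN1r addrC real_funB.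
congr (adherent (H := L2 P) _ (real_fun _)); apply/funext => x; lra.
Qed.

Lemma adherent_all (F : L2fun (L2 P)) : L2mem F -> adh F.
Proof.
move=> /L2_memP[sr si].
have := adherent_lin hH mw (Complex 0 1) (adherent_real si) (adherent_real sr).
congr (adherent (H := L2 P) _ _); apply/funext => x.
rewrite fctE [(Complex 0 1 *: _) x]/(Complex 0 1 * real_fun (fun x => complex.Im (F x)) x).
by apply: Cext; rewrite /real_fun !CE; ring.
Qed.

End PiSystem.

End L2Density.

(** * Multi-indices and initial segments containing their supports *)

Section MultiIndices.
Implicit Types k l : multi_index.

(** Replacing the exact support by an initial segment lets two multi-indices share a single product
    over ['I_N]. *)
Definition supp_below (N : nat) k := forall j, (N <= j)%N -> k j = 0%N.

Lemma supp_below_exists k : exists N, supp_below N k.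
Proof.
exists (\max_(j <- finsupp k) j).+1 => j Nj.
apply/eqP; rewrite -memNfinsupp; apply/negP => jk.
by have := leq_bigmax_seq (F := id) j jk isT; rewrite leqNgt Nj.
Qed.

Lemma supp_below_le N M k : (N <= M)%N -> supp_below N k -> supp_below M k.
Proof. by move=> NM h j Mj; apply: h; exact: leq_trans Mj. Qed.

Lemma big_finsupp (T : Type) (idx : T) (op : Monoid.com_law idx) (F : nat -> nat -> T)
    (p : pred nat) N k : supp_below N k -> (forall j, F j 0%N = idx) ->
  \big[op/idx]_(j <- finsupp k | p j) F j (k j) = \big[op/idx]_(j < N | p j) F j (k j).
Proof.
move=> kN F0; rewrite -(big_mkord p (fun j => F j (k j))) /index_iota subn0.
rewrite [RHS](bigID (mem (finsupp k)))/= [X in op _ X]big1 ?Monoid.mulm1.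
  rewrite -[LHS]big_filter -[RHS]big_filter; apply: perm_big.
  apply: uniq_perm; [exact/filter_uniq/fset_uniq|exact/filter_uniq/iota_uniq|].
  move=> j; rewrite !mem_filter mem_iota leq0n add0n.
  case: (boolP (j \in finsupp k)) => jk; last by rewrite !andbF.
  rewrite !andbT; case: (p j) => //=; apply/esym; rewrite ltnNge; apply/negP => Nj.
  by move: jk; rewrite mem_finsupp kN.
by move=> j /andP[_]; rewrite memNfinsupp => /eqP ->.
Qed.

Lemma multi_index_eq N k l : supp_below N k -> supp_below N l ->
  (k == l) = [forall j : 'I_N, k j == l j].
Proof.
move=> kN lN; apply/eqP/forallP => [->//|h]; apply/fsfunP => j.
have [jN|jN] := ltnP j N; first by have /eqP := h (Ordinal jN).
by rewrite kN// lN.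
Qed.

End MultiIndices.

Lemma prod_indicator (R : realType) N (p : 'I_N -> bool) :
  \prod_(j < N) (p j)%:R = [forall j, p j]%:R :> R.
Proof.
case: (boolP [forall j, p j]) => [/forallP h|].
  by rewrite big1// => j _; rewrite h.
by rewrite negb_forall => /existsP[j /negbTE pj]; rewrite (bigD1 j)//= pj mul0r.
Qed.

(** * Orthonormality and completeness of the products R_k *)

Section ProductBasis.
Variables (R : realType) (e : nat -> R -> R).
Variables (nu : probability (measurableTypeR R) R) (P : probability (RN R) R).
Hypothesis hP : is_product_law nu P.
Local Notation r := (rfun e).
Hypothesis r0 : forall x, r 0 x = 1.
Hypothesis r_sqi : forall k, sqi nu (r k).
Hypothesis r_orth : forall k l, rip nu (r k) (r l) = (k == l)%:R.
Hypothesis r_dense : forall f : R -> R, sqi nu f -> forall eps : R, 0 < eps ->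
  exists (S : {fset nat}) (c : nat -> R),
    (\int[nu]_x ((f x - \sum_(k <- S) c k * r k x) ^+ 2)%:E < eps%:E)%E.

Definition coord_prod (N : nat) (F : nat -> R -> R) (x : RN R) : R :=
  \prod_(j < N) F j (coordRN j x).

(** The factors below [N] are invariant under [trunc N], hence independent of coordinate [N], which
    can be split off inductively. *)
Lemma coord_prod_expectation N (F : nat -> R -> R) :
  (forall j, nu.-integrable setT (EFin \o F j)) ->
  P.-integrable setT (EFin \o coord_prod N F) /\
  \int[P]_x coord_prod N F x = \prod_(j < N) \int[nu]_x F j x.
Proof.
move=> hF; have mF j : measurable_fun setT (F j).
  by apply/measurable_EFinP; exact: measurable_int (hF j).
elim: N => [|N [IH1 IH2]].
  rewrite big_ord0 (_ : coord_prod 0 F = fun=> 1); last first.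
    by apply/funext => x; rewrite /coord_prod big_ord0.
  split; first exact: cst_integrable.
  by rewrite Rintegral_cst// mul1r -[1]/(fine 1%E) -(probability_setT P).
have [i1 E1] := coord_integrable hP N (hF N).
have mG : measurable_fun setT (coord_prod N F).
  by apply/measurable_EFinP; exact: measurable_int IH1.
have GN x : coord_prod N F (trunc N x) = coord_prod N F x.
  by apply: eq_bigr => j _; rewrite /trunc /coordRN ltn_ord.
have [i2 E2] := coord_trunc_integrable hP (mF N) mG GN i1 IH1.
have -> : coord_prod N.+1 F = fun x => F N (coordRN N x) * coord_prod N F x.
  by apply/funext => x; rewrite /coord_prod big_ord_recr/= mulrC.
by split => //; rewrite E2 E1 IH2 big_ord_recr/= mulrC.
Qed.

Definition Qk (k : multi_index) (x : RN R) : R :=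
  \prod_(j <- finsupp k) r (k j) (coordRN j x).

Lemma RkE k : Rk e k = real_fun (Qk k).
Proof. by []. Qed.

Lemma Qk_below N k : supp_below N k -> Qk k = coord_prod N (fun j => r (k j)).
Proof.
move=> kN; apply/funext => x.
by rewrite /Qk (big_finsupp _ (F := fun j n => r n (coordRN j x)) xpredT kN)// => j; exact: r0.
Qed.

Lemma supp_below2 (k l : multi_index) : exists N, supp_below N k /\ supp_below N l.
Proof.
have [N hN] := supp_below_exists k; have [M hM] := supp_below_exists l.
exists (maxn N M); split; first exact: supp_below_le (leq_maxl _ _) hN.
exact: supp_below_le (leq_maxr _ _) hM.
Qed.

Lemma coord_prodM N F F' x : coord_prod N F x * coord_prod N F' x =
  coord_prod N (fun j t => F j t * F' j t) x.
Proof. by rewrite /coord_prod big_split. Qed.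

Lemma coord_prod_rip N (F F' : nat -> R -> R) :
  (forall j, sqi nu (F j)) -> (forall j, sqi nu (F' j)) ->
  rip P (coord_prod N F) (coord_prod N F') = \prod_(j < N) rip nu (F j) (F' j).
Proof.
move=> hF hF'.
have [_ E] := coord_prod_expectation N (fun j => sqi_integrable (hF j) (hF' j)).
by rewrite -E; apply: eq_Rintegral => x _; rewrite coord_prodM.
Qed.

Lemma coord_prod_sqi N (F : nat -> R -> R) : (forall j, sqi nu (F j)) ->
  sqi P (coord_prod N F).
Proof.
move=> hF; split.
  rewrite /coord_prod; apply: measurable_prod => j _.
  have [mF _] := hF j; apply: (measurableT_comp (f := F j)) => //.
  exact: measurable_coord.
have [i _] := coord_prod_expectation N (fun j => sqi_integrable (hF j) (hF j)).
have := integrable_lty measurableT i; congr (_ < _)%E; apply: eq_integral => x _.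
by rewrite /= -coord_prodM expr2.
Qed.

Lemma Qk_sqi k : sqi P (Qk k).
Proof. by have [N kN] := supp_below_exists k; rewrite (Qk_below kN);
  exact: coord_prod_sqi. Qed.

Lemma Qk_orth k l : rip P (Qk k) (Qk l) = (k == l)%:R.
Proof.
have [N [kN lN]] := supp_below2 k l.
rewrite (Qk_below kN) (Qk_below lN) coord_prod_rip// (multi_index_eq kN lN).
by rewrite -prod_indicator; apply: eq_bigr => j _; rewrite r_orth.
Qed.

Lemma real_fun_dot d (T : measurableType d) (m : probability T R) (f g : T -> R) :
  sqi m f -> sqi m g ->
  L2dot (l := L2 m) (real_fun f) (real_fun g) = Ccst (rip m f g).
Proof.
move=> sf sg; rewrite L2_dotE; [|exact: L2mem_real_fun|exact: L2mem_real_fun].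
have z (h : T -> R) : rip m h (fun=> 0) = 0.
  by rewrite /rip; under eq_Rintegral do rewrite mulr0; rewrite Rintegral_cst// mul0r.
apply: Cext; rewrite !CE /=.
  by rewrite [X in _ + X](z (fun=> 0)) addr0.
by rewrite [X in X - _]ripC [X in X - _]z [X in _ - X]z subrr.
Qed.

Lemma Rk_mem k : L2mem (H := L2 P) (Rk e k).
Proof. by rewrite RkE; apply: L2mem_real_fun; exact: Qk_sqi. Qed.

Lemma Rk_orth k l : L2dot (l := L2 P) (Rk e k) (Rk e l) = (k == l)%:R.
Proof.
rewrite !RkE real_fun_dot; [|exact: Qk_sqi|exact: Qk_sqi].
by rewrite Qk_orth; case: (k == l).
Qed.

(** A list of weighted indices, repetitions allowed, so that products expand into lists of pairs
    without collecting equal indices. *)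
Definition span_below (N : nat) (g : RN R -> R) : Prop :=
  exists s : seq (R * multi_index), (forall p, p \in s -> supp_below N p.2) /\
    g = fun x => \sum_(p <- s) p.1 * Qk p.2 x.

Lemma span_below_adherent N g : span_below N g ->
  adherent (H := L2 P) (Rk e) (real_fun g).
Proof.
move=> [s [_ ->]].
have -> : (real_fun (fun x => \sum_(p <- s) p.1 * Qk p.2 x) : L2fun (L2 P)) =
    \sum_(p <- s) Ccst p.1 *: (Rk e p.2 : L2fun (L2 P)).
  apply/funext => x; rewrite fct_sumE /real_fun Ccst_sum.
  by apply: eq_bigr => p _; rewrite CcstM.
apply: (adherent_sum (L2_hilbert P) Rk_mem) => p.
apply: (adherentZ (L2_hilbert P) Rk_mem); exact: (adherent_basis (L2_hilbert P) Rk_mem).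
Qed.

Lemma span_below_sqi N g : span_below N g -> sqi P g.
Proof. by move=> /span_below_adherent[/L2_memP[]]. Qed.

Lemma Qk_trunc N k x : supp_below N k -> Qk k (trunc N x) = Qk k x.
Proof.
move=> kN; rewrite (Qk_below kN); apply: eq_bigr => j _.
by rewrite /trunc /coordRN ltn_ord.
Qed.

Lemma span_below_trunc N g x : span_below N g -> g (trunc N x) = g x.
Proof.
move=> [s [hs ->]]; apply: eq_big_seq => p ps.
by rewrite (Qk_trunc _ (hs p ps)).
Qed.

Lemma Qk_with N k n x : supp_below N k ->
  Qk [fsfun k with N |-> n] x = Qk k x * r n (coordRN N x).
Proof.
move=> kN; have kN1 : supp_below N.+1 [fsfun k with N |-> n].
  move=> j Nj; rewrite fsfun_withE gtn_eqF//; exact/kN/ltnW.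
rewrite (Qk_below kN1) (Qk_below kN) /coord_prod big_ord_recr/= fsfun_withE eqxx.
congr (_ * _); apply: eq_bigr => j _.
by rewrite fsfun_withE ltn_eqF.
Qed.

(** Entry [N] of the indices is still 0, and setting it to [n] multiplies [Qk] by [r n] of
    coordinate [N]. *)
Lemma span_below_mul N g (S : seq nat) (c : nat -> R) : span_below N g ->
  span_below N.+1 (fun x => (\sum_(n <- S) c n * r n (coordRN N x)) * g x).
Proof.
move=> [s [hs ->]].
exists [seq (p.1 * c n, [fsfun p.2 with N |-> n]) | p <- s, n <- S]; split.
  move=> _ /allpairsP[[p n] [/= ps nS ->]] j Nj /=.
  by rewrite fsfun_withE gtn_eqF//; exact/(hs _ ps)/ltnW.
apply/funext => x; rewrite big_allpairs_dep mulrC mulr_suml.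
apply: eq_big_seq => p ps; rewrite mulr_sumr; apply: eq_bigr => n _ /=.
by rewrite (Qk_with _ _ (hs p ps)); ring.
Qed.

Lemma coord_mul_sqi N (f : R -> R) (g : RN R -> R) : sqi nu f -> sqi P g ->
  (forall x, g (trunc N x) = g x) ->
  sqi P (fun x => f (coordRN N x) * g x) /\
  \int[P]_x ((f (coordRN N x) * g x) ^+ 2) = rip nu f f * rip P g g.
Proof.
move=> sf sg gN; have [mf _] := sf; have [mg _] := sg.
have iff := sqi_integrable sf sf; have igg := sqi_integrable sg sg.
have [iff' Ef] := coord_integrable hP N iff.
have [i E] := coord_trunc_integrable hP (measurable_funM mf mf) (measurable_funM mg mg)
  (fun x => congr2 *%R (gN x) (gN x)) iff' igg.
have sqE x : (f (coordRN N x) * g x) ^+ 2 =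
  f (coordRN N x) * f (coordRN N x) * (g x * g x) by ring.
split; last by rewrite /rip -Ef -E; apply: eq_Rintegral => x _; exact: sqE.
split.
  apply: measurable_funM => //; apply: (measurableT_comp (f := f)) => //.
  exact: measurable_coord.
have := integrable_lty measurableT i; congr (_ < _)%E; apply: eq_integral => x _.
by rewrite sqE.
Qed.

Let zero_index : multi_index := [fsfun of _ => 0%N].

Let supp_zero : supp_below 0 zero_index.
Proof. by move=> j _; rewrite fsfun0E. Qed.

(** With [h] the error on the first [N] factors, the new error is [F_N h + (F_N - s) g], and by
    independence each squared norm is a product. The approximation [s] of the last factor is chosen
    after [g], since its tolerance depends on the norm of [g]; the factors 8 leave a total below
    [eps / 2]. *)
Lemma coord_prod_approx N (F : nat -> R -> R) : (forall j, sqi nu (F j)) ->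
  forall eps : R, 0 < eps -> exists2 g, span_below N g &
    \int[P]_x ((coord_prod N F x - g x) ^+ 2) < eps.
Proof.
move=> sF; elim: N => [|N IH] eps e0.
  exists (fun=> 1).
    exists [:: (1, zero_index)]; split.
      by move=> p; rewrite inE => /eqP ->.
    apply/funext => x; rewrite big_seq1 /= (Qk_below supp_zero).
    by rewrite /coord_prod big_ord0 mulr1.
  under eq_Rintegral do rewrite /coord_prod big_ord0 subrr expr0n/=.
  by rewrite Rintegral_cst// mul0r.
have f0 : 0 <= rip nu (F N) (F N).
  by apply: Rintegral_ge0 => x _; rewrite -expr2 sqr_ge0.
have [|g sg hg] := IH (eps / (8 * (rip nu (F N) (F N) + 1))).
  by rewrite divr_gt0// mulr_gt0//; lra.
have sqg := span_below_sqi sg; have gN x := span_below_trunc x sg.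
have g0 : 0 <= rip P g g by apply: Rintegral_ge0 => x _; rewrite -expr2 sqr_ge0.
have [|S [c hS]] := r_dense (sF N) (eps := eps / (8 * (rip P g g + 1))).
  by rewrite divr_gt0// mulr_gt0//; lra.
pose s t := \sum_(n <- S) c n * r n t.
exists (fun x => s (coordRN N x) * g x); first exact: span_below_mul.
have ss : sqi nu s.
  rewrite /s; elim: (S : seq nat) => [|n T IHT].
    by under eq_fun do rewrite big_nil; exact: sqi0.
  by under eq_fun do rewrite big_cons; apply: sqi_comb.
pose h x := coord_prod N F x - g x.
have sh : sqi P h by apply: sqiB => //; exact: coord_prod_sqi.
have hN x : h (trunc N x) = h x.
  rewrite /h gN; congr (_ - _); apply: eq_bigr => j _.
  by rewrite /trunc /coordRN ltn_ord.
pose u t := F N t - s t.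
have su : sqi nu u by exact: sqiB.
have [sfh Efh] := coord_mul_sqi (sF N) sh hN.
have [sug Eug] := coord_mul_sqi su sqg gN.
have E : \int[P]_x ((coord_prod N.+1 F x - s (coordRN N x) * g x) ^+ 2) <=
    2 * (rip nu (F N) (F N) * rip P h h) + 2 * (rip nu u u * rip P g g).
  rewrite -Efh -Eug -!nq_real_fun.
  have := nqD_le (L2_hilbert P) (L2mem_real_fun sfh) (L2mem_real_fun sug).
  rewrite real_funD; congr (nq (H := L2 P) (real_fun _) <= _); apply/funext => x.
  by rewrite /coord_prod big_ord_recr/= -/(coord_prod N F x) /h /u; ring.
apply: le_lt_trans E _.
have hh : rip P h h < eps / (8 * (rip nu (F N) (F N) + 1)).
  by apply: le_lt_trans hg; rewrite le_eqVlt; apply/orP; left; apply/eqP;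
    apply: eq_Rintegral => x _; rewrite expr2.
have hu : rip nu u u < eps / (8 * (rip P g g + 1)).
  by rewrite -lte_fin -(rip_sqr su).
rewrite ltr_pdivlMr in hh; last lra.
rewrite ltr_pdivlMr in hu; last lra.
have h0 : 0 <= rip P h h by apply: Rintegral_ge0 => x _; rewrite -expr2 sqr_ge0.
have u0 : 0 <= rip nu u u by apply: Rintegral_ge0 => x _; rewrite -expr2 sqr_ge0.
nra.
Qed.

(** The indicator of a box is a product of indicators of single coordinates, so [coord_prod_approx]
    puts it in the closed span, and boxes generate the sigma-algebra. *)
Lemma Rk_onb : orthonormal_basis (H := L2 P) (Rk e).
Proof.
have hH := L2_hilbert P.
split; [exact: Rk_mem|exact: Rk_orth|move=> F mF eps e0].
have box B : boxes B -> adherent (H := L2 P) (Rk e) (real_fun (\1_B)).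
  move=> [n [A [mA ->]]].
  have mI j : sqi nu (\1_(A j)) by exact: sqi_indic.
  have -> : \1_[set x : RN R | forall j, (j < n)%N -> A j (coordRN j x)] =
      coord_prod n (fun j => \1_(A j)).
    apply/funext => x; rewrite /coord_prod indicE.
    under eq_bigr do rewrite indicE.
    rewrite prod_indicator; congr (_%:R); congr nat_of_bool.
    apply/idP/forallP => [|h].
      by rewrite inE => h j; rewrite inE; exact: h.
    by rewrite inE => j jn; have := h (Ordinal jn); rewrite inE.
  apply: (adherent_lim hH Rk_mem) => [|d d0].
    by apply: L2mem_real_fun; exact: coord_prod_sqi.
  have [g sg hg] := coord_prod_approx n mI d0.
  exists (real_fun g); first exact: span_below_adherent sg.
  by rewrite real_funB nq_real_fun.
have one : adherent (H := L2 P) (Rk e) (real_fun (fun=> 1)).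
  have <- : Rk e zero_index = real_fun (fun=> 1).
    rewrite RkE (Qk_below supp_zero); apply/funext => x.
    by rewrite /real_fun /coord_prod big_ord0.
  exact: (adherent_basis hH Rk_mem).
have [_ /(_ eps e0)[S [c hS]]] := adherent_all Rk_mem (@boxes_generate R)
  (@boxes_setI R) one box mF.
exists S, c; rewrite -/(lin_comb (H := L2 P) (Rk e) S c) (nsqE hH) ?lte_fin//.
by apply: (memB hH mF); apply: (lin_comb_mem hH); exact: Rk_mem.
Qed.

End ProductBasis.

(** * Orthogonality and norms of the gradients *)

Section ProductGradient.
Variables (R : realType) (alpha : nat -> R) (e : nat -> R -> R).
Variables (nu : probability (measurableTypeR R) R) (P : probability (RN R) R).
Hypothesis hP : is_product_law nu P.
Local Notation r := (rfun e).
Local Notation dr k := (derive1 (rfun e k)).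
Hypothesis r0 : forall x, r 0 x = 1.
Hypothesis r_sqi : forall k, sqi nu (r k).
Hypothesis r_orth : forall k l, rip nu (r k) (r l) = (k == l)%:R.
Hypothesis dr_sqi : forall k, sqi nu (dr k).
Hypothesis dr_orth : forall k l, rip nu (dr k) (dr l) = lam alpha k *+ (k == l).
Hypothesis lam_ge0 : forall k, 0 <= lam alpha k.
Hypothesis lam0 : lam alpha 0 = 0.

Lemma Lam_below N k : supp_below N k -> Lam alpha k = \sum_(j < N) lam alpha (k j).
Proof.
move=> kN; exact: (big_finsupp _ (F := fun _ n => lam alpha n) xpredT kN).
Qed.

Lemma Lam_ge0 k : 0 <= Lam alpha k.
Proof. exact: sumr_ge0. Qed.

Definition dQk (k : multi_index) (j : nat) (x : RN R) : R :=
  dr (k j) (coordRN j x) * \prod_(i <- finsupp k | i != j) r (k i) (coordRN i x).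

Lemma gradRkE k j : (fun x => gradRk e k x j) = real_fun (dQk k j).
Proof. by []. Qed.

Lemma dQk_below N k j : supp_below N k -> (j < N)%N ->
  dQk k j = coord_prod N (fun i => if i == j then dr (k i) else r (k i)).
Proof.
move=> kN jN; apply/funext => x; rewrite /dQk.
rewrite (big_finsupp _ (F := fun i n => r n (coordRN i x)) (fun i => i != j) kN); last first.
  by move=> i; exact: r0.
rewrite /coord_prod [RHS](bigD1 (Ordinal jN))//= eqxx; congr (_ * _).
by apply: eq_bigr => i /negbTE ->.
Qed.

Lemma supp_below2_gt (k l : multi_index) j :
  exists N, [/\ (j < N)%N, supp_below N k & supp_below N l].
Proof.
have [N [kN lN]] := supp_below2 k l; exists (maxn j.+1 N); split.
- exact: leq_maxl.
- exact: supp_below_le (leq_maxr _ _) kN.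
- exact: supp_below_le (leq_maxr _ _) lN.
Qed.

Let factor_sqi (k : multi_index) j i : sqi nu (if i == j then dr (k i) else r (k i)).
Proof. by case: ifP. Qed.

Lemma dQk_sqi k j : sqi P (dQk k j).
Proof.
have [N [jN kN _]] := supp_below2_gt k k j.
by rewrite (dQk_below kN jN); exact: (coord_prod_sqi hP _ (factor_sqi k j)).
Qed.

(** The inner product factorises over coordinates: the differentiated factor contributes
    [lam alpha (k j)] times a Kronecker delta, the others a Kronecker delta each. *)
Lemma dQk_orth k l j : rip P (dQk k j) (dQk l j) = lam alpha (k j) *+ (k == l).
Proof.
have [N [jN kN lN]] := supp_below2_gt k l j.
rewrite (dQk_below kN jN) (dQk_below lN jN) (coord_prod_rip hP _ (factor_sqi k j) (factor_sqi l j)).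
rewrite (multi_index_eq kN lN) -[RHS]mulr_natr -prod_indicator.
rewrite (bigD1 (Ordinal jN))//= eqxx dr_orth [in RHS](bigD1 (Ordinal jN))//= mulrA.
rewrite mulr_natr; congr (_ * _); apply: eq_bigr => i /negbTE.
by rewrite -val_eqE /= => ->; rewrite r_orth.
Qed.

Lemma sum_lam_le (k : multi_index) n : \sum_(0 <= j < n) lam alpha (k j) <= Lam alpha k.
Proof.
have [N kN] := supp_below_exists k.
rewrite (Lam_below (supp_below_le (leq_maxr n N) kN)).
rewrite -(big_mkord xpredT (fun j => lam alpha (k j))).
rewrite [leRHS](big_cat_nat (n := n))//=; last exact: leq_maxl.
by rewrite lerDl sumr_ge0.
Qed.

Lemma gradRk_mem k : L2mem (H := L2l2 P) (gradRk e k).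
Proof.
apply/L2l2_memP; split.
  by move=> j; apply: L2mem_real_fun; exact: dQk_sqi.
exists (Lam alpha k) => n; apply: le_trans (sum_lam_le k n).
apply: ler_sum => j _; rewrite -/(gradRk e k) gradRkE /nq.
rewrite real_fun_dot ?Re_Ccst; [|exact: dQk_sqi|exact: dQk_sqi].
by rewrite dQk_orth eqxx.
Qed.

(** Sum [dQk_orth] over the components; as [lam alpha 0 = 0], the partial sums are constant once
    they cover the support of [k]. *)
Lemma gradRk_dot k l : L2dot (l := L2l2 P) (gradRk e k) (gradRk e l) =
  Ccst (Lam alpha k) *+ (k == l).
Proof.
have dj j : L2dot (l := L2 P) (fun x => gradRk e k x j) (fun x => gradRk e l x j) =
    Ccst (lam alpha (k j) *+ (k == l)).
  by rewrite !gradRkE real_fun_dot; [rewrite dQk_orth|exact: dQk_sqi|exact: dQk_sqi].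
have -> : Ccst (Lam alpha k) *+ (k == l) = Ccst (Lam alpha k *+ (k == l)).
  by case: (k == l).
rewrite L2l2_dotE; apply: Cext; rewrite !CE; apply/cvg_lim => //.
  have [N kN] := supp_below_exists k.
  apply: cvg_near_cst; exists N => // n Nn.
  transitivity (\sum_(0 <= j < n) lam alpha (k j) *+ (k == l)).
    by apply: eq_bigr => j _; rewrite dj.
  by rewrite (Lam_below (supp_below_le Nn kN)) big_mkord sumrMnl.
apply: cvg_near_cst; exists 0%N => // n _.
transitivity (\sum_(0 <= j < n) (0 : R)); last by rewrite big1.
by apply: eq_bigr => j _; rewrite dj.
Qed.

End ProductGradient.

Unset Implicit Arguments.
Theorem theorem3p3 (R : realType) (mu : R) (alpha : nat -> R)
    (e : nat -> R -> R) (P : probability (RN R) R) :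
  0 < mu -> mu <= 1 ->
  eigensystem mu alpha e ->
  is_product_law (ground_law e) P ->
  (* orthonormal basis, expansion and Parseval *)
  orthonormal_basis (H := L2 P) (Rk e) /\
  (forall F : L2fun (L2 P), L2mem F ->
     L2sum (fun k => coef e F k *: (Rk e k : L2fun (L2 P))) F /\
     L2nsq F = \esum_(k in [set: multi_index]) (Cabs2 (coef e F k))%:E) /\
  (* the gradient and its closure *)
  linear_operator (H := L2 P) (K := L2l2 P) (D0 e) /\
  closable (H := L2 P) (K := L2l2 P) (D0 e) /\
  (forall F : L2fun (L2 P),
     (exists V, Dmu e F V) <->
     L2mem F /\
     (\esum_(k in [set: multi_index])
        (Lam alpha k * Cabs2 (coef e F k))%:E < +oo)%E) /\
  (forall (F : L2fun (L2 P)) (V : L2fun (L2l2 P)), Dmu e F V ->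
     L2nsq V = \esum_(k in [set: multi_index])
       (Lam alpha k * Cabs2 (coef e F k))%:E) /\
  (* the number operator *)
  linear_operator (@Nmu R e P) /\
  nonnegative (@Nmu R e P) /\
  self_adjoint (@Nmu R e P) /\
  (forall F : L2fun (L2 P),
     (exists G, Nmu e F G) <->
     L2mem F /\
     (\esum_(k in [set: multi_index])
        ((Lam alpha k) ^+ 2 * Cabs2 (coef e F k))%:E < +oo)%E) /\
  (forall F G : L2fun (L2 P), Nmu e F G ->
     L2sum (fun k =>
       (Ccst (Lam alpha k) * coef e F k) *: (Rk e k : L2fun (L2 P))) G) /\
  (forall k : multi_index,
     Nmu e (Rk e k : L2fun (L2 P)) (Ccst (Lam alpha k) *: Rk e k)).
Proof.
move=> _ _ He hP0.
(* [ground_law e] is a bare set function. The law of coordinate 0 under [P] agrees with it on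
   measurable sets and is a probability by construction. *)
pose X : {mfun RN R >-> measurableTypeR R} :=
  HB.pack (@coordRN R 0 : RN R -> measurableTypeR R)
    (isMeasurableFun.Build _ _ _ _ _ (measurable_coord 0)).
pose nu : probability (measurableTypeR R) R := distribution P X.
have nuE A : measurable A -> nu A = ground_law e A.
  move=> mA; have := hP0 1%N (fun=> A) (fun=> mA).
  rewrite big_ord_recl big_ord0 mule1 => <-; congr (P _).
  by apply/seteqP; split => x /= h; [case|exact: (h 0%N)].
have hP : is_product_law nu P.
  by move=> n A mA; rewrite hP0//; apply: eq_bigr => j _; rewrite nuE.
have r0 := rfun0 He.
have r_sqi := rfun_sqi He nuE; have r_orth := rfun_orth He nuE.
have dr_sqi := drfun_sqi He nuE; have dr_orth := drfun_orth He nuE.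
have hH := L2_hilbert P; have hK := L2l2_hilbert P.
have onb : orthonormal_basis (H := L2 P) (Rk e).
  exact: (Rk_onb hP r0 r_sqi r_orth (rfun_dense He nuE)).
have mw : forall k, L2mem (H := L2l2 P) (gradRk e k).
  exact: (gradRk_mem hP r0 r_sqi r_orth dr_sqi dr_orth (lam_ge0 He) (lam0 alpha)).
have ww : forall k l, L2dot (l := L2l2 P) (gradRk e k) (gradRk e l) =
    Ccst (Lam alpha k) *+ (k == l).
  exact: (gradRk_dot hP r0 r_sqi r_orth dr_sqi dr_orth (lam0 alpha)).
have L0 := Lam_ge0 (lam_ge0 He).
have DE : @Dmu R e P = grad (H := L2 P) (K := L2l2 P) (Rk e) (gradRk e) by [].
have NE : @Nmu R e P = number_op (H := L2 P) (K := L2l2 P) (Rk e) (gradRk e).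
  by rewrite /Nmu DE.
rewrite NE DE /coef.
split; first exact: onb.
split.
  by move=> F mF; split; [exact: (onb_expansion hH onb)|exact: (onb_parseval hH onb)].
split; first exact: (pre_grad_linear hH hK onb mw).
split; first exact: (pre_grad_closable hH hK onb mw L0 ww).
split; first exact: (grad_domain hH hK onb mw L0 ww).
split; first exact: (grad_parseval hH hK onb mw L0 ww).
split; first exact: (number_op_linear hH hK onb mw L0 ww).
split; first exact: (number_op_ge0 hH hK).
split; first exact: (number_op_self_adjoint hH hK onb mw L0 ww).
split; first exact: (number_op_domain hH hK onb mw L0 ww).
split; first exact: (number_op_expansion hH hK onb mw L0 ww).
exact: (number_op_basis hH hK onb mw L0 ww).
Qed.
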